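(* Let $\gamma,\alpha\in(0,1)$ with $\rho:=\gamma+\alpha-1>0$, and let $\beta\in(0,1)$ be such that $\beta+\alpha-1>0$. Let $W$ be a zero-mean $H$-valued Gaussian process with paths in $\mathcal{C}^\gamma([0,T],H)$ and covariance operator $Q_W\in\mathcal{Q}_\beta$. Let $A\in\mathcal{L}(H)$, $y\in H$, and let $Y$ be the fractional Ornstein–Uhlenbeck process driven by $W$, i.e. the unique (Hölder continuous, of any order smaller than $\rho$) solution to $$Y(t)=y+A\,I^\alpha(Y)(t)+\frac{1}{\Gamma(\alpha)}\int_0^t(t-s)^{\alpha-1}dW(s),\qquad t\in[0,T].$$ Then the covariance operator of $Y$ is $$Q_Y(t,t')=\int_0^t\int_0^{t'}(t-r)^{\alpha-1}E_{\alpha,\alpha}\big(A(t-r)^\alpha\big)\,d^2Q_W(r,r')\,(t'-r')^{\alpha-1}E_{\alpha,\alpha}\big(A^*(t'-r')^\alpha\big),$$ and $Q_Y\in\mathcal{Q}_\eta$ for any $\eta\in(0,\beta+\alpha-1)$.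
   Context: $T>0$, $H$ is a separable real Hilbert space, $\mathcal{L}(H)$ the bounded linear operators on $H$ with operator norm $\|\cdot\|_{op}$, $^*$ the adjoint; $\mathcal{C}^\gamma([0,T],H)$ denotes $\gamma$-Hölder functions. Gaussian process: all finite-dimensional vectors $(W(t_1),\dots,W(t_n))$ are Gaussian in $H^n$ (all their inner products with elements of $H^n$ are real Gaussian). The covariance operator of an $H$-valued square-integrable process $Z$ is $Q_Z(s,t)\in\mathcal{L}(H)$ determined by $\langle Q_Z(s,t)g,h\rangle_H=\mathbb{E}[\langle Z(t)-\mathbb{E}Z(t),g\rangle_H\langle Z(s)-\mathbb{E}Z(s),h\rangle_H]$. $I^\alpha(f)(t)=\frac{1}{\Gamma(\alpha)}\int_0^t(t-s)^{\alpha-1}f(s)ds$ (Bochner integral). Mittag-Leffler operator: $E_{\alpha,\beta}(At)=\sum_{i=0}^\infty\frac{A^{\circ i}t^i}{\Gamma(\alpha i+\beta)}$, $A^{\circ i}$ the $i$-fold composition. The integral against $W$ is pathwise: $\int_0^tk(t,s)dW(s)=\lim_{|\mathcal{P}|\to0}\sum_{[u,v]\in\mathcal{P}}k(t,u)(W(v)-W(u))$ in $H$ over partitions $\mathcal{P}$ of $[0,t]$. Rectangular increment: $\square_{(s,s'),(t,t')}f=f(t,t')-f(t,s')-f(s,t')+f(s,s')$. For $\alpha\in(0,1)$, $\mathcal{Q}_\alpha$ is the class of $Q:[0,T]^2\to\mathcal{L}(H)$ for which the sum of $\sup_{t>s,\,t'}\frac{\|Q(t,t')-Q(s,t')\|_{op}}{|t-s|^\alpha}$,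 $\sup_{t,\,t'>s'}\frac{\|Q(t,t')-Q(t,s')\|_{op}}{|t'-s'|^\alpha}$ and $\sup_{t>s,\,t'>s'}\frac{\|\square_{(s,s'),(t,t')}Q\|_{op}}{(|t-s||t'-s'|)^\alpha}$ is finite. The double integral $\int_0^t\int_0^{t'}F(r)\,d^2Q(r,r')\,G(r')$ is the operator-norm limit, as the meshes of partitions $\mathcal{P}$ of $[0,t]$ and $\mathcal{P}'$ of $[0,t']$ tend to $0$, of $\sum_{[u,v]\in\mathcal{P},[u',v']\in\mathcal{P}'}F(u)\,\square_{(u,u'),(v,v')}Q\,G(u')$. *)

(* Defs.v *)
From HB Require Import structures.
From mathcomp Require Import all_boot all_order all_algebra.
From mathcomp Require Import all_classical all_reals all_analysis.
From mathcomp Require Import sesquilinear.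

Set Implicit Arguments.
Unset Strict Implicit.
Unset Printing Implicit Defensive.

Import Order.TTheory GRing.Theory Num.Theory.
Import numFieldNormedType.Exports.

Local Open Scope classical_set_scope.
Local Open Scope ring_scope.

(* Real Hilbert spaces: complete normed modules whose norm comes from the
   scalar product [inner]. *)
HB.mixin Record isHilbert (R : realType) H & NormedModule R H := {
  inner : {dot H for (@idfun R)} ;
  inner_normE : forall x : H, `|x| ^+ 2 = inner x x
}.

#[short(type="hilbertType")]
HB.structure Definition Hilbert (R : realType) :=
  {H of isHilbert R H & CompleteNormedModule R H}.

Definition separable_space (X : topologicalType) :=
  exists2 D : set X, countable D & dense D.

Section bounded_operators.
Context {R : realType} (H : normedModType R).

Definition bounded_linear : {pred H -> H} :=
  mem [set f : H -> H | linear f /\ exists M, forall x, `|f x| <= M * `|x|].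

Record bop := Bop { bop_fun :> H -> H ; _ : bop_fun \in bounded_linear }.

HB.instance Definition _ := [isSub for bop_fun].
HB.instance Definition _ := [Choice of bop by <:].

Lemma bounded_linear_submod_closed : submod_closed bounded_linear.
Proof.
split.
  rewrite inE; split=> [k x y|]; first by rewrite /= scaler0 addr0.
  by exists 0 => x; rewrite normr0 mul0r.
move=> k f g; rewrite !inE => -[lf [M fM]] [lg [N gN]]; split.
  move=> a x y; rewrite !fctE lf lg !scalerDr !scalerA (mulrC k a).
  by rewrite addrACA.
exists (`|k| * M + N) => x; rewrite !fctE (le_trans (ler_normD _ _))// mulrDl.
by rewrite lerD// normrZ -mulrA ler_wpM2l.
Qed.

HB.instance Definition _ := GRing.isSubmodClosed.Build R (H -> H)
  bounded_linear bounded_linear_submod_closed.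
HB.instance Definition _ := [SubChoice_isSubLmodule of bop by <:].

Lemma bopD (A B : bop) x : (A + B) x = A x + B x. Proof. by []. Qed.
Lemma bopZ k (A : bop) x : (k *: A) x = k *: A x. Proof. by []. Qed.
Lemma bop0 x : (0 : bop) x = 0. Proof. by []. Qed.

Lemma bop_linear (A : bop) : linear A.
Proof. by case: A => f /= /[!inE] -[]. Qed.

HB.instance Definition _ (A : bop) :=
  GRing.isLinear.Build R H H *:%R A (bop_linear A).

Lemma bop_bounded (A : bop) : exists M, forall x, `|A x| <= M * `|x|.
Proof. by case: A => f /= /[!inE] -[]. Qed.

Definition opnorm (A : bop) : R := sup [set `|A x| | x in [set x | `|x| <= 1]].

Lemma opnorm_has_sup (A : bop) :
  has_sup [set `|A x| | x in [set x | `|x| <= 1]].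
Proof.
split; first by exists `|A 0|, 0 => //=; rewrite normr0.
have [M AM] := bop_bounded A; exists `|M| => _ [x /= x1 <-].
rewrite (le_trans (AM x))// (le_trans (ler_norm _))// normrM normr_id.
by rewrite ler_piMr.
Qed.

Lemma opnorm_ub (A : bop) x : `|x| <= 1 -> `|A x| <= opnorm A.
Proof.
by move=> x1; apply: ub_le_sup; [case: (opnorm_has_sup A)|exists x].
Qed.

Lemma opnorm_le (A : bop) M :
  (forall x, `|x| <= 1 -> `|A x| <= M) -> opnorm A <= M.
Proof.
move=> AM; apply: ge_sup; first by case: (opnorm_has_sup A).
by move=> _ [x /= x1 <-]; exact: AM.
Qed.

Lemma le_opnorm (A : bop) x : `|A x| <= opnorm A * `|x|.
Proof.
have [->|x0] := eqVneq x 0; first by rewrite raddf0 !normr0 mulr0.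
have nx : 0 < `|x| by rewrite normr_gt0.
have /opnorm_ub : `| (`|x|)^-1 *: x | <= 1.
  by rewrite normrZ normfV normr_id mulVf// gt_eqF.
by move/(_ A); rewrite linearZ/= normrZ normfV normr_id mulrC ler_pdivrMr.
Qed.

Lemma opnorm_triangle (A B : bop) : opnorm (A + B) <= opnorm A + opnorm B.
Proof.
apply: opnorm_le => x x1; rewrite bopD (le_trans (ler_normD _ _))//.
by rewrite lerD// opnorm_ub.
Qed.

Lemma opnorm_scale k (A : bop) : opnorm (k *: A) = `|k| * opnorm A.
Proof.
apply/eqP; rewrite eq_le; apply/andP; split.
  by apply: opnorm_le => x x1; rewrite bopZ normrZ ler_wpM2l// opnorm_ub.
have [->|k0] := eqVneq k 0.
  rewrite normr0 mul0r (le_trans _ (opnorm_ub (x := 0) _ _))//.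
  by rewrite normr0.
rewrite -ler_pdivlMl ?normr_gt0//; apply: opnorm_le => x x1.
by rewrite ler_pdivlMl ?normr_gt0// -normrZ -bopZ opnorm_ub.
Qed.

Lemma opnorm0_eq0 (A : bop) : opnorm A = 0 -> A = 0.
Proof.
move=> A0; apply/val_inj/funext => x /=; apply/eqP.
by rewrite -normr_le0 (le_trans (le_opnorm A x))// A0 mul0r.
Qed.

HB.instance Definition _ := @Lmodule_isNormed.Build R bop
  opnorm opnorm_triangle opnorm_scale opnorm0_eq0.

Lemma bid_subproof : idfun \in bounded_linear.
Proof. by rewrite inE; split=> //; exists 1 => x; rewrite mul1r. Qed.

Definition bid : bop := Bop bid_subproof.

Lemma bcomp_subproof (A B : bop) : A \o B \in bounded_linear.
Proof.
rewrite inE; split=> [k x y|]; first by rewrite /= !linearP.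
exists (opnorm A * opnorm B) => x /=.
rewrite (le_trans (le_opnorm _ _))// -mulrA ler_wpM2l ?le_opnorm//.
by rewrite (le_trans _ (opnorm_ub (x := 0) _ _))// normr0.
Qed.

Definition bcomp (A B : bop) : bop := Bop (bcomp_subproof A B).

Definition bpow (A : bop) (i : nat) : bop := iter i (bcomp A) bid.

End bounded_operators.

Section functions_of_operators.
Context {R : realType}.

Definition Gamma (a : R) : R :=
  \int[lebesgue_measure]_(x in `]0, +oo[) (x `^ (a - 1) * expR (- x)).

(* E_{a,b}(A t): the series converges in the operator norm. *)
Definition mittag_leffler {H : normedModType R} (a b : R) (A : bop H) (t : R) :
  bop H :=
  lim (series (fun i => (t ^+ i / Gamma (a * i%:R + b)) *: bpow A i) @ \oo).

(* The operator singled out here exists by the Riesz representation theorem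
   and is unique; the default value 0 is never used. *)
Definition adjoint {H : hilbertType R} (A : bop H) : bop H :=
  xget 0 [set B : bop H | forall x y, inner (A x) y = inner x (B y)].

End functions_of_operators.

Section partitions.
Context {R : realType}.

(* As for [itv_partition], a partition a = s_0 < s_1 < ... < s_n = b is given by
   the sequence s_1, ..., s_n, the left endpoint being kept separate. *)
Definition subintervals (a : R) (s : seq R) : seq (R * R) := zip (a :: s) s.

Definition mesh (a : R) (s : seq R) : R :=
  \big[Num.max/0]_(p <- subintervals a s) (p.2 - p.1).

Definition fine_partitions (a b : R) : set_system (seq R) :=
  filter_from [set d : R | 0 < d]
    (fun d => [set s | itv_partition a b s /\ mesh a s < d]).

Lemma fine_partition_exists (a b d : R) : a <= b -> 0 < d ->
  exists s, itv_partition a b s /\ mesh a s < d.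
Proof.
move=> ab d0; pose e := d / 2.
have e0 : 0 < e by rewrite divr_gt0.
suff [s [abs sd]] : exists s, itv_partition a b s /\ mesh a s <= e.
  by exists s; split => //; rewrite (le_lt_trans sd)// ltr_pdivrMr// mulr_natr
    mulr2n ltrDl.
have [n] : exists n : nat, b - a <= n%:R * e.
  exists (Num.truncn ((b - a) / e)).+1; rewrite -ler_pdivrMr//.
  by rewrite ltW// truncnS_gt.
elim: n a ab => [|n IH] a ab.
  rewrite mul0r subr_le0 => ba; exists [::]; rewrite /mesh /= big_nil ltW//.
  by split => //; split => //=; rewrite eq_le ab ba.
rewrite -natr1 mulrDl mul1r => ban; have [aeb|bae] := leP (a + e) b.
  have [|s [[p1 p2] ms]] := IH _ aeb; first by rewrite opprD addrA lerBlDr.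
  exists (a + e :: s); split.
    by split => //=; rewrite p1 andbT ltrDl.
  by rewrite /mesh /= big_cons /= addrAC subrr add0r ge_max lexx.
have [->|nab] := eqVneq a b.
  by exists [::]; rewrite /mesh /= big_nil ltW//; split => //; split => /=.
exists [:: b]; split; first by split => //=; rewrite lt_neqAle nab ab.
by rewrite /mesh /= big_cons big_nil /= ge_max lerBlDl (ltW bae) (ltW e0).
Qed.

Lemma fine_partitions_filter (a b : R) : a <= b ->
  ProperFilter (fine_partitions a b).
Proof.
move=> ab; apply: filter_from_proper; last first.
  by move=> d /= /(fine_partition_exists ab)[s]; exists s.
apply: filter_from_filter; first by exists 1 => /=.
move=> d d' /= d0 d'0; exists (Num.min d d'); first by rewrite /= lt_min d0.
by move=> s /= [ps]; rewrite lt_min => /andP[].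
Qed.

Definition stieltjes_sum {H : normedModType R} (k : R -> R) (w : R -> H)
    (s : seq R) : H :=
  \sum_(p <- subintervals 0 s) k p.1 *: (w p.2 - w p.1).

Definition is_stieltjes_integral {H : normedModType R} (t : R) (k : R -> R)
    (w : R -> H) (J : H) :=
  stieltjes_sum k w s @[s --> fine_partitions 0 t] --> J.

(* The increment of Q over the rectangle with corners (s, s') and (t, t'). *)
Definition rect_incr {V : zmodType} (Q : R -> R -> V) (s s' t t' : R) : V :=
  Q t t' - Q t s' - Q s t' + Q s s'.

Definition double_sum {H : normedModType R} (F : R -> bop H)
    (Q : R -> R -> bop H) (G : R -> bop H) (s s' : seq R) : bop H :=
  \sum_(p <- subintervals 0 s) \sum_(q <- subintervals 0 s')
    bcomp (F p.1) (bcomp (rect_incr Q p.1 q.1 p.2 q.2) (G q.1)).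

Definition is_double_integral {H : normedModType R} (t t' : R)
    (F : R -> bop H) (Q : R -> R -> bop H) (G : R -> bop H) (V : bop H) :=
  double_sum F Q G s.1 s.2
    @[s --> filter_prod (fine_partitions 0 t) (fine_partitions 0 t')] --> V.

End partitions.

Section regularity.
Context {R : realType} {H : normedModType R}.

Definition holder_on (T g : R) (f : R -> H) :=
  exists M : R, forall s t : R, s \in `[0, T] -> t \in `[0, T] ->
    `|f t - f s| <= M * `|t - s| `^ g.

Definition holder_quotients1 (T a : R) (Q : R -> R -> bop H) : set R :=
  [set z | exists s t t' : R,
     [/\ s \in `[0, T], t \in `[0, T], t' \in `[0, T], s < t &
         z = `|Q t t' - Q s t'| / `|t - s| `^ a]].

Definition holder_quotients2 (T a : R) (Q : R -> R -> bop H) : set R :=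
  [set z | exists t s' t' : R,
     [/\ t \in `[0, T], s' \in `[0, T], t' \in `[0, T], s' < t' &
         z = `|Q t t' - Q t s'| / `|t' - s'| `^ a]].

Definition holder_quotients12 (T a : R) (Q : R -> R -> bop H) : set R :=
  [set z | exists s t s' t' : R,
     [/\ s \in `[0, T] /\ t \in `[0, T], s' \in `[0, T] /\ t' \in `[0, T],
         s < t, s' < t' &
         z = `|rect_incr Q s s' t t'| / (`|t - s| * `|t' - s'|) `^ a]].

Definition Qnorm (T a : R) (Q : R -> R -> bop H) : \bar R :=
  (ereal_sup (EFin @` holder_quotients1 T a Q) +
   ereal_sup (EFin @` holder_quotients2 T a Q) +
   ereal_sup (EFin @` holder_quotients12 T a Q))%E.

Definition Qclass (T a : R) : set (R -> R -> bop H) :=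
  [set Q | (Qnorm T a Q < +oo)%E].

End regularity.

Section bochner.
Context d (X : measurableType d) {R : realType} {H : normedModType R}.

(* The H-valued simple function x |-> \sum_i 1_(E_i) x *: c_i. *)
Record simple_function := SimpleFunction {
  sf_size : nat ;
  sf_set : 'I_sf_size -> set X ;
  sf_val : 'I_sf_size -> H
}.
Arguments sf_set : clear implicits.
Arguments sf_val : clear implicits.

Definition sf_eval (f : simple_function) (x : X) : H :=
  \sum_i \1_(sf_set f i) x *: sf_val f i.

Definition sf_integral (mu : set X -> \bar R) (f : simple_function) : H :=
  \sum_i fine (mu (sf_set f i)) *: sf_val f i.

(* f is Bochner integrable over D, with integral v. *)
Definition is_bochner (mu : {measure set X -> \bar R}) (D : set X) (f : X -> H)
    (v : H) :=
  exists f_ : nat -> simple_function,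
    [/\ forall n i, [/\ measurable (sf_set (f_ n) i), sf_set (f_ n) i `<=` D &
                        (mu (sf_set (f_ n) i) < +oo)%E],
        forall n, mu.-integrable D (fun x => `|f x - sf_eval (f_ n) x|%:E),
        (\int[mu]_(x in D) `|f x - sf_eval (f_ n) x|%:E)%E @[n --> \oo] --> 0%E &
        sf_integral mu (f_ n) @[n --> \oo] --> v].

End bochner.

Section processes.
Context d (Omega : measurableType d) {R : realType} {H : hilbertType R}.
Variables (P : probability Omega R) (T : R).

Definition is_process (Z : R -> Omega -> H) :=
  forall t : R, t \in `[0, T] -> forall U : set H, open U -> measurable (Z t @^-1` U).

(* Degenerate (constant) Gaussian variables are allowed. *)
Definition is_gaussian_rv (X : Omega -> R) :=
  measurable_fun setT X /\
  ((exists m, forall B, measurable B -> pushforward P X B = \d_m B) \/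
   (exists m s : R, s != 0 /\
      forall B, measurable B -> pushforward P X B = normal_prob m s B)).

Definition is_gaussian_process (Z : R -> Omega -> H) :=
  is_process Z /\
  forall (n : nat) (t : 'I_n -> R) (h : 'I_n -> H),
    (forall i, t i \in `[0, T]) ->
    is_gaussian_rv (fun w => \sum_i inner (Z (t i) w) (h i)).

Definition has_mean (Z : R -> Omega -> H) (m : R -> H) :=
  forall t : R, t \in `[0, T] -> is_bochner P setT (Z t) (m t).

Definition square_integrable (Z : R -> Omega -> H) :=
  is_process Z /\
  forall t : R, t \in `[0, T] -> (\int[P]_w (`|Z t w| ^+ 2)%:E < +oo)%E.

(* Mind the order of the time arguments: the first one goes with h. *)
Definition is_covariance_operator (Z : R -> Omega -> H) (Q : R -> R -> bop H) :=
  square_integrable Z /\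
  exists2 m, has_mean Z m &
    forall s t : R, s \in `[0, T] -> t \in `[0, T] -> forall g h : H,
      (inner (Q s t g) h)%:E =
      ('E_P[(fun w => inner (Z t w - m t) g * inner (Z s w - m s) h)%R])%E.

End processes.

Section fractional_ornstein_uhlenbeck.
Context {R : realType}.

Definition is_fractional_integral {H : normedModType R} (a : R) (f : R -> H)
    (t : R) (v : H) :=
  exists2 I, is_bochner lebesgue_measure `[0, t]
               (fun s => (t - s) `^ (a - 1) *: f s) I &
             v = (Gamma a)^-1 *: I.

Definition solves_fOU_equation {H : normedModType R} (T a : R) (A : bop H)
    (y : H) (w Y : R -> H) :=
  forall t : R, t \in `[0, T] ->
    exists I J, [/\ is_fractional_integral a Y t I,
      is_stieltjes_integral t (fun s => (t - s) `^ (a - 1)) w J &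
      Y t = y + A I + (Gamma a)^-1 *: J].

(* The singular kernel (t - r)^(a - 1) E_(a, a)(A (t - r)^a). *)
Definition ML_kernel {H : normedModType R} (a : R) (A : bop H) (t r : R) :
  bop H := (t - r) `^ (a - 1) *: mittag_leffler a a A ((t - r) `^ a).

End fractional_ornstein_uhlenbeck.

(* Main.v *)
(* Let X(t) be the Young integral of the kernel (t - r)^(alpha - 1)
   E_(alpha, alpha)(A (t - r)^alpha) against W.  Testing the equation against the
   vectors (A^* )^i h and iterating it shows that Y - X is weakly a deterministic
   series, so that Y and X have the same covariance.  The left-point sums defining
   X are finite combinations of increments of W, and the covariance of two such
   sums is a double sum of the kernels against the increments of Q_W.  These double
   sums converge, as iterated Young integrals of operators, to a limit whose
   increments are controlled by those of Q_W; Fatou's lemma then turns the pathwise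
   convergence of the sums to X into convergence in L^2.

   That |X(t)|^2 is integrable does not follow from the weak second moments.  The
   variables <X(t), h> are limits of centred Gaussian ones, so
   E (min (<X(t), h>^2, v)) >= v / 128 with v = E <X(t), h>^2; summing over an
   orthonormal system bounds the trace of the covariance of X(t), because
   |X(t)|^2 is finite. *)

Require Import Defs.
From HB Require Import structures.
From mathcomp Require Import all_boot all_order all_algebra.
From mathcomp Require Import all_classical all_reals all_analysis.
From mathcomp Require Import measurable_realfun sesquilinear ring lra.

Set Implicit Arguments.
Unset Strict Implicit.
Unset Printing Implicit Defensive.

Import Order.TTheory GRing.Theory Num.Theory.
Import numFieldNormedType.Exports.

Local Open Scope classical_set_scope.
Local Open Scope ring_scope.

(** The kernels behave like [(t - r)^(-a)] with [a = 1 - alpha] and blow up at the right end point,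
    so Young's estimate, which wants a Hölder kernel, does not apply. It is replaced by three
    conditions comparing the size, the increments and the second differences of a kernel with those
    of [x^(-a)]. They are stable under sums, hence pass from the terms of the Mittag-Leffler series
    to the series. Abel summation from the singular end turns them into telescoping sums of powers,
    so that bounds, rates in the mesh and Hölder continuity of the integral come out uniformly in
    the partition. In the double integral the inner error must be Hölder, not merely small, in the
    outer variable; the rectangular increments of [Q_W] provide this.

    Iterating the tested equation needs two facts: fractional integration of order [alpha] maps each
    scalar Young integral to the next one, by the Beta integral, and [Gamma] outgrows geometric
    sequences. In the double sums the two partitions are refined independently, which is what makes
    the sums for [X] Cauchy in [L^2]. *)

Section zmodule_expressions.

(** * Reflexive proofs of identities in abelian groups *)

Inductive zexpr := ZVar of nat | ZAdd of zexpr & zexpr | ZOpp of zexpr | ZZero.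

Fixpoint zeval (V : zmodType) (env : seq V) (e : zexpr) : V :=
  match e with
  | ZVar i => nth 0 env i
  | ZAdd e1 e2 => zeval env e1 + zeval env e2
  | ZOpp e1 => - zeval env e1
  | ZZero => 0
  end.

Fixpoint zcoef (e : zexpr) (i : nat) : int :=
  match e with
  | ZVar j => (i == j)%:Z
  | ZAdd e1 e2 => zcoef e1 i + zcoef e2 i
  | ZOpp e1 => - zcoef e1 i
  | ZZero => 0
  end.

Lemma zevalE (V : zmodType) (env : seq V) e :
  zeval env e = \sum_(i < size env) env`_i *~ zcoef e i.
Proof.
elim: e => [j|e1 IH1 e2 IH2|e1 IH1|] /=.
- have [jn|nj] := ltnP j (size env).
    rewrite (bigD1 (Ordinal jn))//= eqxx mulr1z big1 ?addr0// => i ij.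
    by rewrite (_ : (_ == _) = false) ?mulr0z//; apply/negbTE.
  rewrite nth_default// big1// => i _.
  by rewrite (_ : (_ == _) = false) ?mulr0z// ltn_eqF// (leq_trans (ltn_ord i)).
- by rewrite IH1 IH2 -big_split/=; apply: eq_bigr => i _; rewrite mulrzDr.
- by rewrite IH1 -sumrN; apply: eq_bigr => i _; rewrite mulrNz.
- by rewrite big1// => i _; rewrite mulr0z.
Qed.

(** Atoms beyond the environment evaluate to [0], so comparing the coefficients below its size is
    enough. *)
Lemma zeval_eq (V : zmodType) (env : seq V) e1 e2 :
  all (fun i => zcoef e1 i == zcoef e2 i) (iota 0 (size env)) ->
  zeval env e1 = zeval env e2.
Proof.
move=> /allP h; rewrite !zevalE; apply: eq_bigr => i _.
by congr (_ *~ _); apply/eqP/h; rewrite mem_iota/= add0n.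
Qed.

End zmodule_expressions.

Ltac zmem x l :=
  lazymatch l with
  | nil => constr:(false)
  | x :: _ => constr:(true)
  | _ :: ?l' => zmem x l'
  end.

Ltac zindex x l :=
  lazymatch l with
  | x :: _ => constr:(O)
  | _ :: ?l' => let n := zindex x l' in constr:(S n)
  end.

Ltac zatoms env t :=
  lazymatch t with
  | ?a + ?b => let env := zatoms env a in zatoms env b
  | - ?a => zatoms env a
  | GRing.zero => env
  | _ => let b := zmem t env in
         lazymatch b with true => env | false => constr:(t :: env) end
  end.

Ltac zreify env t :=
  lazymatch t with
  | ?a + ?b => let a := zreify env a in let b := zreify env b in
               constr:(ZAdd a b)
  | - ?a => let a := zreify env a in constr:(ZOpp a)
  | GRing.zero => constr:(ZZero)
  | _ => let n := zindex t env in constr:(ZVar n)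
  end.

(* Decides equalities in abelian groups, by comparison of the coefficients of
   syntactically equal atoms. *)
Ltac zmodule :=
  lazymatch goal with
  | |- @eq ?V ?t1 ?t2 =>
    let env := zatoms (@nil V) t1 in
    let env := zatoms env t2 in
    let e1 := zreify env t1 in
    let e2 := zreify env t2 in
    refine (@zeval_eq _ env e1 e2 _); by vm_compute
  end.

(** * Left-point sums, Abel summation and comparison of partitions *)

Section abel_summation.
Context {R : realType} {E : normedModType R}.

(** The kernel takes values in the maps of [E], so that scalar kernels, operators acting on vectors
    and compositions with operators are treated at once. *)
Definition ksum (k : R -> E -> E) (w : R -> E) (a : R) (s : seq R) : E :=
  \sum_(p <- subintervals a s) k p.1 (w p.2 - w p.1).

Lemma ksum_nil k w a : ksum k w a [::] = 0.
Proof. by rewrite /ksum /subintervals big_nil. Qed.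

Lemma ksum_cons k w a b s :
  ksum k w a (b :: s) = k a (w b - w a) + ksum k w b s.
Proof. by rewrite /ksum /subintervals/= big_cons. Qed.

Lemma ksumB k w1 w2 a s : (forall u, {morph k u : x y / x - y}) ->
  ksum k (fun r => w1 r - w2 r) a s = ksum k w1 a s - ksum k w2 a s.
Proof.
move=> kB; rewrite /ksum -sumrB; apply: eq_bigr => p _.
by rewrite -kB; congr (k _ _); zmodule.
Qed.

(* A control of the increments of a kernel by [Phi], together with a path whose
   oscillation at the right end is of order [e], yields telescoping bounds. *)
Definition profile (T e d K : R) (Phi : R -> R) :=
  forall x y : R, 0 < x -> x <= y -> y <= T ->
    0 <= Phi x - Phi y /\ (Phi x - Phi y) * x `^ e <= K * (y `^ d - x `^ d).

Lemma profile_le T T' e d K Phi :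
  T' <= T -> profile T e d K Phi -> profile T' e d K Phi.
Proof. by move=> T'T h x y x0 xy yT'; apply: h => //; exact: le_trans T'T. Qed.

Lemma path_lt_last (a : R) s : path <%R a s -> a <= last a s.
Proof.
rewrite lt_path_sortedE => /andP[/allP s1 _].
by have := mem_last a s; rewrite in_cons => /predU1P[->//|/s1/ltW].
Qed.

Lemma path_lt_last_nil (a : R) s : path <%R a s -> last a s = a -> s = [::].
Proof.
case: s => //= c s /andP[ac cs] lb.
by have := path_lt_last cs; rewrite lb leNgt ac.
Qed.

(** Abel summation from the right end: the change of kernel at [b] only meets the remaining
    oscillation [w t - w b], at most [L (t - b)^e], and the profile turns the product into a
    difference of [d]-th powers, which telescopes. No increment of the kernel up to [t] occurs,
    since [t] is the left point of no cell. *)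
Lemma ksum_abel (k : R -> E -> E) (w : R -> E) (Phi : R -> R)
    (e d K L t a : R) (s : seq R) :
  0 < d -> 0 <= L -> 0 <= K ->
  (forall u, {morph k u : x y / x - y}) ->
  (forall (u v : R) x, a <= u -> u < v -> v < t ->
    `|k v x - k u x| <= (Phi (t - v) - Phi (t - u)) * `|x|) ->
  (forall r : R, a <= r -> r <= t -> `|w t - w r| <= L * (t - r) `^ e) ->
  profile (t - a) e d K Phi ->
  path <%R a s -> last a s = t ->
  `|ksum k w a s - k a (w t - w a)| <= L * K * (t - a) `^ d.
Proof.
move=> d0 L0 K0 kB.
have k0 u : k u 0 = 0 by have := kB u 0 0; rewrite !subrr.
elim: s a => [|b s IH] a kPhi wL PhiK /=.
  by move=> _ ->; rewrite ksum_nil !subrr k0 subrr normr0 powR0 ?gt_eqF// mulr0.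
move=> /andP[ab bs] lb; rewrite ksum_cons.
have bt : b <= t by rewrite -lb path_lt_last.
have -> : k a (w b - w a) + ksum k w b s - k a (w t - w a) =
    (ksum k w b s - k b (w t - w b)) + (k b (w t - w b) - k a (w t - w b)).
  have -> : w b - w a = (w t - w a) - (w t - w b).
    by zmodule.
  by rewrite kB; zmodule.
apply: (le_trans (ler_normD _ _)).
move: bt; rewrite le_eqVlt => /predU1P[bt|bt].
  have s0 : s = [::] by apply: path_lt_last_nil bs _; rewrite lb bt.
  rewrite s0 ksum_nil bt !subrr !k0 !subrr !normr0 addr0.
  by rewrite mulr_ge0 ?powR_ge0 ?mulr_ge0.
have ta : a <= t by rewrite ltW// (lt_trans ab).
have abt : t - b <= t - a by rewrite lerB// ltW.
have tb0 : 0 < t - b by rewrite subr_gt0.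
have [Phi0 PhiKb] := PhiK (t - b) (t - a) tb0 abt (lexx _).
apply: (@le_trans _ _ (L * K * (t - b) `^ d +
    (Phi (t - b) - Phi (t - a)) * (L * (t - b) `^ e))).
  apply: lerD.
    apply: IH => //.
    - by move=> u v x bu; apply: kPhi; rewrite (le_trans (ltW ab)).
    - by move=> r br; apply: wL; rewrite (le_trans (ltW ab)).
    - exact: profile_le abt PhiK.
  apply: le_trans (kPhi _ _ _ _ _ _) _ => //.
  by rewrite ler_wpM2l// wL ?ltW.
rewrite mulrCA -mulrA -mulrDr -mulrA ler_wpM2l//.
by move: PhiKb; rewrite mulrBr; lra.
Qed.

(** Precomposing a path with this rounding transfers a left-point sum from a partition to a
    refinement of it. *)
Fixpoint ceil_in (p : seq R) (r : R) : R :=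
  if p is x :: p' then if r <= x then x else ceil_in p' r else r.

Lemma ceil_in_mem p r : r \in p -> path.sorted <%R p -> ceil_in p r = r.
Proof.
elim: p => //= x p IH; rewrite in_cons => /predU1P[->|rp] sp.
  by rewrite lexx.
have xr : x < r by move: sp; rewrite lt_path_sortedE => /andP[/allP/(_ _ rp)].
by rewrite leNgt xr /= IH// (path_sorted sp).
Qed.

Lemma ceil_in_between a s r : path <%R a s -> a <= r -> r <= last a s ->
  [/\ r <= ceil_in (a :: s) r, ceil_in (a :: s) r <= last a s &
      ceil_in (a :: s) r - r <= mesh a s].
Proof.
elim: s a => [|b s IH] a.
  move=> _ /= ar ra; have -> : r = a by apply/eqP; rewrite eq_le ra.
  by rewrite lexx subrr /mesh/= big_nil.
move=> /= /andP[ab bs] ar rl.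
have mE : mesh a (b :: s) = Num.max (b - a) (mesh b s).
  by rewrite /mesh /subintervals/= big_cons.
rewrite mE; have [ra|ar'] := leP r a.
  have -> : r = a by apply/eqP; rewrite eq_le ra.
  rewrite lexx subrr le_max subr_ge0 (ltW ab); split=> //.
  exact: le_trans (ltW ab) (path_lt_last bs).
have [rb|br] := leP r b.
  rewrite rb; split=> //; first exact: path_lt_last.
  by rewrite le_max lerB.
have [] := IH b bs (ltW br) rl => /=.
have -> : (r <= b) = false by rewrite leNgt br.
move=> -> -> h; split=> //.
by rewrite le_max h orbT.
Qed.

Lemma subintervals_bounds (a : R) s p : path <%R a s -> p \in subintervals a s ->
  [/\ a <= p.1, p.1 < p.2 & p.2 <= last a s].
Proof.
elim: s a => [|b s IH] a; first by rewrite /subintervals.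
move=> /= /andP[ab bs]; rewrite /subintervals/= in_cons => /predU1P[->/=|].
  by rewrite lexx ab path_lt_last.
by move=> /(IH _ bs)[bp -> ->]; rewrite (le_trans (ltW ab)).
Qed.

Lemma path_lt_mem (a x : R) s : path <%R a s -> x \in s -> a < x.
Proof. by rewrite lt_path_sortedE => /andP[/allP as_ _] /as_. Qed.

(** Over a coarse cell the rounded path makes its whole jump in the first fine cell, whose left
    point is that of the coarse cell. The refinement may start before [p0], as the induction
    requires; there the rounded path is constant. *)
Lemma ksum_refine k w b s p0 p : (forall u, k u 0 = 0) ->
  path <%R b s -> path <%R p0 p -> {subset p0 :: p <= b :: s} ->
  last p0 p = last b s ->
  ksum k (w \o ceil_in (p0 :: p)) b s = ksum k w p0 p.
Proof.
move=> k0; elim: s b p0 p => [|c s IH] b p0 p.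
  move=> _ pp sub lE; have p0b : p0 = b.
    by have := sub p0; rewrite !inE eqxx => /(_ isT) /eqP.
  have -> : p = [::] by apply: path_lt_last_nil pp _; rewrite lE p0b.
  by rewrite !ksum_nil.
move=> bcs pp sub lE; have /= /andP[bc cs] := bcs; rewrite ksum_cons.
have cle x : x \in c :: s -> c <= x.
  by rewrite in_cons => /predU1P[->//|/(path_lt_mem cs)/ltW].
have [p0b|p0b] := eqVneq p0 b.
  case: p pp sub lE => [|p1 p] /=.
    by move=> _ _ lE; have := path_lt_last cs; rewrite -lE p0b leNgt bc.
  move=> p01p sub lE; have /andP[p01 pp] := p01p.
  have subp : {subset p1 :: p <= c :: s}.
    move=> x xp; have := sub x; rewrite inE xp orbT => /(_ isT).
    rewrite in_cons => /predU1P[xb|//].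
    by have := path_lt_mem (p01p : path <%R p0 (p1 :: p)) xp; rewrite p0b xb ltxx.
  rewrite ksum_cons p0b lexx leNgt bc/= -(IH c)//.
  rewrite cle ?subp ?mem_head//; congr (_ + _).
  rewrite /ksum !big_seq; apply: eq_bigr => -[u v] uv /=.
  have [/= cu uv' _] := subintervals_bounds cs uv.
  have bu : b < u by rewrite (lt_le_trans bc).
  by rewrite (leNgt u b) bu (leNgt v b) (lt_trans bu).
have bp0 : b < p0.
  by have := sub _ (mem_head _ _); rewrite in_cons (negbTE p0b)/= => /(path_lt_mem bcs).
have subp : {subset p0 :: p <= c :: s}.
  move=> x xp; have := sub x xp; rewrite in_cons => /predU1P[xb|//].
  move: xp; rewrite in_cons => /predU1P[xp|/(path_lt_mem pp)].
    by rewrite -xp xb ltxx in bp0.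
  by rewrite xb ltNge (ltW bp0).
rewrite /= (ltW bp0) cle ?subp ?mem_head// subrr k0 add0r.
by rewrite -[RHS](IH c).
Qed.

Lemma common_refinement (a t : R) s1 s2 :
  itv_partition a t s1 -> itv_partition a t s2 ->
  exists2 s, itv_partition a t s &
    {subset a :: s1 <= a :: s} /\ {subset a :: s2 <= a :: s}.
Proof.
move=> [p1 /eqP l1] [p2 /eqP l2].
pose s := sort <=%R (undup (s1 ++ s2)).
have ms x : (x \in s) = (x \in s1) || (x \in s2).
  by rewrite mem_sort mem_undup mem_cat.
have ps : path <%R a s.
  rewrite lt_path_sortedE; apply/andP; split.
    by apply/allP => x; rewrite ms => /orP[/(path_lt_mem p1)|/(path_lt_mem p2)].
  rewrite lt_sorted_uniq_le sort_uniq undup_uniq/=.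
  exact/sort_sorted/le_total.
exists s; last first.
  by split=> x; rewrite !in_cons ms => /predU1P[->|->]; rewrite ?eqxx ?orbT.
split=> //; apply/eqP.
have sle x : x \in a :: s -> x <= t.
  rewrite in_cons ms => /predU1P[->|/orP[|]]; first by rewrite -l1 path_lt_last.
    move=> xs; rewrite -l1; case/splitPr: xs p1 => s' s'' /=.
    by rewrite cat_path last_cat/= => /and3P[_ _ /path_lt_last].
  move=> xs; rewrite -l2; case/splitPr: xs p2 => s' s'' /=.
  by rewrite cat_path last_cat/= => /and3P[_ _ /path_lt_last].
apply/eqP; rewrite eq_le sle ?mem_last//=.
have : t \in a :: s1 by rewrite -l1 mem_last.
rewrite in_cons => /predU1P[->|ts]; first exact: path_lt_last.
have : t \in s by rewrite ms ts.
by move=> {}ts; case/splitPr: ts ps => s' s'' /=;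
  rewrite cat_path last_cat/= => /and3P[_ _ /path_lt_last].
Qed.

(** On a common refinement the difference of the two sums is the sum for the difference of the two
    rounded paths, which vanishes at both ends. Two roundings of [r] are at distance at most [D] and
    at most [t - r]; splitting the exponent [b] as [(b - e) + e] gives the power of the mesh and
    leaves the [(t - r)^e] that the profile needs. *)
Lemma ksum_cauchy (k : R -> E -> E) (w : R -> E) (Phi : R -> R)
    (b e d K L t D : R) (s1 s2 : seq R) :
  0 < d -> 0 <= L -> 0 <= K -> 0 < e -> e <= b ->
  (forall u, {morph k u : x y / x - y}) ->
  (forall (u v : R) x, 0 <= u -> u < v -> v < t ->
    `|k v x - k u x| <= (Phi (t - v) - Phi (t - u)) * `|x|) ->
  (forall r r' : R, 0 <= r -> r <= t -> 0 <= r' -> r' <= t ->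
     `|w r - w r'| <= L * `|r - r'| `^ b) ->
  profile t e d K Phi ->
  itv_partition 0 t s1 -> itv_partition 0 t s2 ->
  mesh 0 s1 <= D -> mesh 0 s2 <= D ->
  `|ksum k w 0 s1 - ksum k w 0 s2| <= L * K * t `^ d * D `^ (b - e).
Proof.
move=> d0 L0 K0 e0 eb kB kPhi wL PhiK is1 is2 m1 m2.
have k0 u : k u 0 = 0 by have := kB u 0 0; rewrite !subrr.
have [s [ps /eqP ls] [sub1 sub2]] := common_refinement is1 is2.
have [p1 /eqP l1] := is1; have [p2 /eqP l2] := is2.
have t0 : 0 <= t by rewrite -ls path_lt_last.
rewrite -(ksum_refine w k0 ps p1 sub1) ?ls//.
rewrite -(ksum_refine w k0 ps p2 sub2) ?ls//.
rewrite -ksumB//.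
pose w' := fun r => (w \o ceil_in (0 :: s1)) r - (w \o ceil_in (0 :: s2)) r.
have ct (s' : seq R) : path <%R 0 s' -> last 0 s' = t -> ceil_in (0 :: s') t = t.
  move=> p' l'; rewrite ceil_in_mem//.
  by rewrite -l' mem_last.
have w't : w' t = 0 by rewrite /w' /comp !ct// subrr.
have w'0 : w' 0 = 0 by rewrite /w'/= lexx subrr.
have D0 : 0 <= D.
  have [] := ceil_in_between p1 (lexx 0) (path_lt_last p1).
  by move=> c0 _ cD; rewrite (le_trans _ m1)// (le_trans _ cD)// subr_ge0.
have := @ksum_abel k w' Phi e d K (L * D `^ (b - e)) t 0 s.
rewrite w't w'0 subrr k0 !subr0 => h.
have -> : L * K * t `^ d * D `^ (b - e) = L * D `^ (b - e) * K * t `^ d by ring.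
apply: h => //; first by rewrite mulr_ge0 ?powR_ge0.
move=> r r0 rt; rewrite sub0r normrN.
have [] := ceil_in_between p1 r0; rewrite l1// => a1 b1 c1.
have [] := ceil_in_between p2 r0; rewrite l2// => a2 b2 c2.
rewrite /w'/comp; set r1 := ceil_in (0 :: s1) r in a1 b1 c1 *.
set r2 := ceil_in (0 :: s2) r in a2 b2 c2 *.
apply: (le_trans (wL r1 r2 _ _ _ _)) => //; try exact: le_trans r0 _.
rewrite -mulrA ler_wpM2l//.
have n1 : `|r1 - r2| <= D by rewrite ler_norml; apply/andP; split; lra.
have n2 : `|r1 - r2| <= t - r by rewrite ler_norml; apply/andP; split; lra.
have -> : `|r1 - r2| `^ b = `|r1 - r2| `^ (b - e) * `|r1 - r2| `^ e.
  have [->|nz] := eqVneq `|r1 - r2| 0; last first.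
    by rewrite -powRD ?subrK// nz implybT.
  by rewrite !(@powR0 _ e, @powR0 _ b) ?mulr0 ?gt_eqF// (lt_le_trans e0).
by rewrite ler_pM ?powR_ge0//; apply: ge0_ler_powR;
  rewrite ?nnegrE ?subr_ge0// ltW.
Qed.
Lemma ksum_kernelB (k1 k2 : R -> E -> E) w (t0 : R) s :
  ksum k1 w t0 s - ksum k2 w t0 s = ksum (fun u x => k1 u x - k2 u x) w t0 s.
Proof. by rewrite /ksum -sumrB. Qed.

Lemma ksum_cat (k : R -> E -> E) w (t0 : R) s1 s2 :
  ksum k w t0 (s1 ++ s2) = ksum k w t0 s1 + ksum k w (last t0 s1) s2.
Proof.
elim: s1 t0 => [|u s1 IH] t0 /=; first by rewrite ksum_nil add0r.
by rewrite !ksum_cons IH addrA.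
Qed.

Lemma mesh_cat (t0 : R) s1 s2 :
  mesh t0 (s1 ++ s2) = Num.max (mesh t0 s1) (mesh (last t0 s1) s2).
Proof.
have mE (u0 u : R) s : mesh u0 (u :: s) = Num.max (u - u0) (mesh u s).
  by rewrite /mesh /subintervals/= big_cons.
elim: s1 t0 => [|u s1 IH] t0 /=; last by rewrite !mE IH maxA.
suff m0 (u0 : R) s : 0 <= mesh u0 s.
  by rewrite [mesh t0 [::]]/mesh /subintervals/= big_nil max_r.
elim: s u0 => [|u s IH] u0; first by rewrite /mesh /subintervals/= big_nil.
by rewrite mE le_max IH orbT.
Qed.

End abel_summation.

(** * Power functions, their differences and their profiles *)

Section power_profiles.
Context {R : realType}.
Implicit Types (f df g dg phi dphi : R -> R) (x y h T : R).

Lemma is_derive_powR (p x : R) : 0 < x ->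
  is_derive x 1 (fun r => r `^ p) (p * x `^ (p - 1)).
Proof.
move=> x0; have x0' : x \in `]0, +oo[ by rewrite in_itv/= x0.
rewrite -powR_derive1// derive1E; apply: derivableP.
exact: derivable_powR.
Qed.

Lemma le_of_derive f df x y : x <= y ->
  (forall r, x <= r <= y -> is_derive r 1 f (df r)) ->
  (forall r, x <= r <= y -> 0 <= df r) -> f x <= f y.
Proof.
rewrite le_eqVlt => /predU1P[->//|xy] fdf df0.
have [||c cxy] := @MVT R f df x y xy.
- by move=> r /[!in_itv]/= /andP[xr ry]; apply: fdf; rewrite !ltW.
- apply: derivable_within_continuous => r /[!in_itv]/= xry.
  by have [] := fdf r xry.
- rewrite -subr_ge0 => ->; rewrite mulr_ge0 ?subr_ge0 ?(ltW xy)// df0//.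
  by move: cxy; rewrite in_itv/= => /andP[/ltW -> /ltW ->].
Qed.

Lemma dominated_increment f df phi dphi x y : x <= y ->
  (forall r, x <= r <= y -> is_derive r 1 f (df r)) ->
  (forall r, x <= r <= y -> is_derive r 1 phi (dphi r)) ->
  (forall r, x <= r <= y -> `|df r| <= - dphi r) ->
  `|f x - f y| <= phi x - phi y.
Proof.
move=> xy fd phid h; rewrite ler_norml; apply/andP; split.
- have : (- phi - f) x <= (- phi - f) y.
    apply: (@le_of_derive _ (- dphi - df)) => // r xry.
      by have := fd r xry; have := phid r xry => ? ?; exact: is_deriveB.
    by have := h r xry; rewrite ler_norml => /andP[]; rewrite !fctE; lra.
  by rewrite !fctE; lra.
- have : (- phi + f) x <= (- phi + f) y.
    apply: (@le_of_derive _ (- dphi + df)) => // r xry.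
      by have := fd r xry; have := phid r xry => ? ?; exact: is_deriveD.
    by have := h r xry; rewrite ler_norml => /andP[]; rewrite !fctE; lra.
  by rewrite !fctE; lra.
Qed.

Lemma is_derive_addr f (a h r : R) : is_derive (r + h) 1 f a ->
  is_derive r 1 (fun s => f (s + h)) a.
Proof.
move=> fd; rewrite -[a]mulr1.
exact: (@is_derive1_comp _ f (shift h) r a 1 fd (is_derive_shift _ _ _)).
Qed.

(** The difference over a step [h] has derivative [df r - df (r + h)], which the first-order
    comparison, applied to [df], bounds in turn. *)
Lemma dominated_increment2 f df ddf phi dphi ddphi x y h : x <= y -> 0 <= h ->
  (forall r, x <= r <= y + h -> is_derive r 1 f (df r)) ->
  (forall r, x <= r <= y + h -> is_derive r 1 df (ddf r)) ->
  (forall r, x <= r <= y + h -> is_derive r 1 phi (dphi r)) ->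
  (forall r, x <= r <= y + h -> is_derive r 1 dphi (ddphi r)) ->
  (forall r, x <= r <= y + h -> `|ddf r| <= ddphi r) ->
  `|(f x - f (x + h)) - (f y - f (y + h))| <=
  (phi x - phi (x + h)) - (phi y - phi (y + h)).
Proof.
move=> xy h0 fd fdd phid phidd ddfphi.
pose g1 := f - (fun s => f (s + h)).
pose p1 := phi - (fun s => phi (s + h)).
apply: (@dominated_increment g1 (fun r => df r - df (r + h)) p1
  (fun r => dphi r - dphi (r + h)) x y xy) => r /andP[xr ry].
- apply: is_deriveB; first by apply: fd; lra.
  by apply/is_derive_addr/fd; lra.
- apply: is_deriveB; first by apply: phid; lra.
  by apply/is_derive_addr/phid; lra.
- have -> : - (dphi r - dphi (r + h)) = (- dphi) r - (- dphi) (r + h).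
    by rewrite !fctE opprB opprK addrC.
  apply: (@dominated_increment df ddf (- dphi) (- ddphi)).
  + by rewrite lerDl.
  + by move=> s /andP[rs sh]; apply: fdd; lra.
  + by move=> s /andP[rs sh]; apply: is_deriveN; apply: phidd; lra.
  + by move=> s /andP[rs sh]; rewrite !fctE opprK; apply: ddfphi; lra.
Qed.

(* Both differences are compared with [a * ln (y / x)]. *)
Lemma powR_increment_le (a d x y : R) : 0 <= a -> 0 < d -> 0 < x -> x <= y ->
  (x `^ (- a) - y `^ (- a)) * x `^ (a + d) <= a / d * (y `^ d - x `^ d).
Proof.
move=> a0 d0 x0 xy; have y0 : 0 < y by exact: lt_le_trans xy.
pose z := ln y - ln x.
have z0 : 0 <= z by rewrite subr_ge0 ler_ln.
have pE p : y `^ p = x `^ p * expR (p * z).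
  by rewrite /powR !gt_eqF// -expRD; congr expR; rewrite /z; ring.
have -> : (x `^ (- a) - y `^ (- a)) * x `^ (a + d) =
    x `^ d * (1 - expR (- a * z)).
  rewrite pE -[X in X - _]mulr1 -mulrBr mulrAC -powRD; last first.
    by rewrite (gt_eqF x0) implybT.
  by rewrite addKr.
have -> : a / d * (y `^ d - x `^ d) = x `^ d * (a / d * (expR (d * z) - 1)).
  by rewrite pE; ring.
rewrite ler_wpM2l ?powR_ge0//.
have h1 := expR_ge1Dx (- a * z); have h2 := expR_ge1Dx (d * z).
apply: (@le_trans _ _ (a * z)); first by lra.
rewrite mulrAC -mulrA ler_wpM2l// ler_pdivlMr// mulrC; lra.
Qed.

Lemma powR_nonincreasing (p x y : R) : p <= 0 -> 0 < x -> x <= y ->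
  y `^ p <= x `^ p.
Proof.
move=> p0 x0 xy; have y0 := lt_le_trans x0 xy.
by rewrite /powR !gt_eqF// ler_expR ler_wnM2l// ler_ln.
Qed.

Lemma profile_powR (T a e : R) : 0 <= a -> a < e ->
  profile T e (e - a) (a / (e - a)) (fun x => x `^ (- a)).
Proof.
move=> a0 ae x y x0 xy yT; split.
  by rewrite subr_ge0 powR_nonincreasing// oppr_le0.
have := @powR_increment_le a (e - a) x y a0; rewrite subr_gt0 => /(_ ae x0 xy).
by rewrite [a + _]addrC subrK.
Qed.

Lemma profileZ (T e d K c : R) (phi : R -> R) : 0 <= c ->
  profile T e d K phi -> profile T e d (c * K) (fun x => c * phi x).
Proof.
move=> c0 h x y x0 xy yT; have [h1 h2] := h x y x0 xy yT.
by rewrite -mulrBr mulr_ge0// -!mulrA ler_wpM2l.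
Qed.

(** Controls the difference between the kernels attached to two upper limits at distance [h]. *)
Definition shift_gap (a h x : R) := x `^ (- a) - (x + h) `^ (- a).

Lemma shift_gap_le (a h x : R) : 0 <= a -> 0 <= h -> 0 < x ->
  shift_gap a h x <= a * h * x `^ (- a - 1).
Proof.
move=> a0 h0 x0.
have := @dominated_increment (fun r => r `^ (- a)) (fun r => - a * r `^ (- a - 1))
  (- (a * x `^ (- a - 1)) *: id) (cst (- (a * x `^ (- a - 1)))) x (x + h).
rewrite !fctE => /(_ _ _ _ _).
have -> : - (a * x `^ (- a - 1)) *: x - - (a * x `^ (- a - 1)) *: (x + h) =
   a * h * x `^ (- a - 1) by rewrite /GRing.scale/=; ring.
move=> H; apply: le_trans (ler_norm _) (H _ _ _ _) => {H}.
- by rewrite lerDl.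
- by move=> r /andP[xr _]; apply: is_derive_powR; exact: lt_le_trans xr.
- move=> r _; apply: is_derive_eq (is_deriveZ _ (is_derive_id r 1)) _.
  by rewrite /GRing.scale/= mulr1.
- move=> r /andP[xr _]; rewrite opprK normrM normrN (ger0_norm a0).
  rewrite ger0_norm ?powR_ge0// ler_wpM2l// powR_nonincreasing//.
  by rewrite -opprD oppr_le0 addr_ge0.
Qed.

Lemma shift_gap_increment_le (a h x y : R) : 0 <= a -> 0 <= h -> 0 < x ->
  x <= y ->
  shift_gap a h x - shift_gap a h y <=
  a * h * (x `^ (- a - 1) - y `^ (- a - 1)).
Proof.
move=> a0 h0 x0 xy.
have := @dominated_increment
  ((fun r => r `^ (- a)) - (fun r => (r + h) `^ (- a)))
  (fun r => - a * r `^ (- a - 1) - (- a * (r + h) `^ (- a - 1)))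
  ((a * h) *: (fun r => r `^ (- a - 1)))
  (fun r => (a * h) * ((- a - 1) * r `^ (- a - 1 - 1))) x y xy.
rewrite !fctE => H; rewrite mulrBr.
apply: le_trans (ler_norm _) (H _ _ _) => {H} r /andP[xr ry].
all: have r0 : 0 < r by exact: lt_le_trans xr.
all: have rh0 : 0 < r + h by rewrite ltr_pwDl.
- apply: is_deriveB; first exact: is_derive_powR.
  exact: (@is_derive_addr (fun s => s `^ (- a)) _ h r (is_derive_powR _ rh0)).
- exact: (is_deriveZ (a * h) (is_derive_powR (- a - 1) r0)).
- have := @shift_gap_le (a + 1) h r; rewrite /shift_gap !opprD => /(_ _ _ _).
  move=> H; rewrite -mulrBr normrM normrN (ger0_norm a0).
  rewrite ger0_norm ?subr_ge0; last first.
    by rewrite powR_nonincreasing// ?lerDl//; lra.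
  have -> : - (a * h * ((- a - 1) * r `^ (- a - 1 - 1))) =
    a * ((a + 1) * h * r `^ (- a - 1 - 1)) by ring.
  by rewrite ler_wpM2l// H// addr_ge0.
Qed.

(** A gain of [h^eta] is bought with [eta] from the exponent. If [h <= x], the derivative bound is
    used with [h = h^eta h^(1 - eta)] and [h^(1 - eta) <= x^(1 - eta)]; if [x < h], the shifted
    power is dropped and [x^eta <= h^eta]. The constant [2] bounds both [a (a + 1)] and [a]. *)
Lemma profile_shift_gap (T a b eta h : R) : 0 < a -> a < 1 ->
  0 <= eta -> eta <= 1 -> a + eta < b -> 0 < h ->
  profile T b (b - a - eta) (h `^ eta * (2 / (b - a - eta))) (shift_gap a h).
Proof.
move=> a0 a1 eta0 eta1 aeb h0 x y x0 xy yT.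
set d := b - a - eta.
have d0 : 0 < d by rewrite /d; lra.
have dlt : x `^ d <= y `^ d.
  by rewrite ge0_ler_powR ?nnegrE ?(ltW d0) ?(ltW x0)// (le_trans (ltW x0)).
have gap0 : 0 <= shift_gap a h x - shift_gap a h y.
  have := @dominated_increment2
    (fun=> 0) (fun=> 0) (fun=> 0) (fun r => r `^ (- a))
    (fun r => - a * r `^ (- a - 1))
    (fun r => - a * ((- a - 1) * r `^ (- a - 1 - 1))) x y h xy (ltW h0).
  rewrite !subrr normr0; apply=> r /andP[xr _];
    have r0 : 0 < r := lt_le_trans x0 xr; try exact: is_derive_cst.
  + exact: is_derive_powR.
  + exact: (is_deriveZ (- a) (is_derive_powR (- a - 1) r0)).
  + have -> : - a * ((- a - 1) * r `^ (- a - 1 - 1)) =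
      a * (a + 1) * r `^ (- a - 1 - 1) by ring.
    by rewrite mulr_ge0 ?powR_ge0// mulr_ge0//; lra.
split=> //.
have [hx|xh] := ltP h x.
- apply: (@le_trans _ _ (h `^ eta * ((a * (x `^ (- (a + 1)) - y `^ (- (a + 1))))
      * x `^ (a + 1 + d)))).
    apply: le_trans (ler_wpM2r (powR_ge0 _ _)
      (shift_gap_increment_le (ltW a0) (ltW h0) x0 xy)) _.
    have -> : x `^ (a + 1 + d) = x `^ (1 - eta) * x `^ b.
      rewrite -powRD; last by rewrite (gt_eqF x0) implybT.
      by congr (_ `^ _); rewrite /d; ring.
    have {1}-> : h = h `^ eta * h `^ (1 - eta).
      rewrite -powRD; last by rewrite (gt_eqF h0) implybT.
      by rewrite addrC subrK powRr1// ltW.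
    have -> : - a - 1 = - (a + 1) by ring.
    set D := x `^ (- (a + 1)) - _.
    have D0 : 0 <= D by rewrite subr_ge0 powR_nonincreasing//; lra.
    have -> : a * (h `^ eta * h `^ (1 - eta)) * D * x `^ b =
      h `^ eta * (a * D * (h `^ (1 - eta) * x `^ b)) by ring.
    rewrite ler_wpM2l ?powR_ge0// ler_wpM2l ?mulr_ge0 ?(ltW a0)//.
    rewrite ler_wpM2r ?powR_ge0// ge0_ler_powR ?nnegrE ?(ltW h0) ?(ltW x0)//.
      by rewrite subr_ge0.
    exact: ltW.
  rewrite -[leRHS]mulrA ler_wpM2l ?powR_ge0// -[leLHS]mulrA.
  have := @powR_increment_le (a + 1) d x y _ d0 x0 xy.
  move=> /(_ ltac:(lra)) H.
  have := ler_wpM2l (ltW a0) H.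
  move=> /le_trans; apply; rewrite mulrA ler_wpM2r ?subr_ge0//.
  rewrite mulrA ler_wpM2r ?invr_ge0 ?(ltW d0)//.
  have : a * a <= 1 by rewrite -[leRHS]mulr1 ler_pM// ltW.
  lra.
- apply: (@le_trans _ _ (h `^ eta * ((x `^ (- a) - y `^ (- a)) * x `^ (a + d)))).
    have -> : x `^ b = x `^ eta * x `^ (a + d).
      rewrite -powRD; last by rewrite (gt_eqF x0) implybT.
      by congr (_ `^ _); rewrite /d; ring.
    rewrite mulrCA; apply: ler_pM; rewrite ?powR_ge0 ?mulr_ge0 ?powR_ge0//.
    + by rewrite ge0_ler_powR ?nnegrE ?(ltW h0) ?(ltW x0).
    + rewrite ler_wpM2r ?powR_ge0// /shift_gap.
      have : (y + h) `^ (- a) <= (x + h) `^ (- a).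
        by rewrite powR_nonincreasing ?oppr_le0 ?(ltW a0)// ?lerD2r// addr_gt0.
      lra.
  rewrite -[leRHS]mulrA ler_wpM2l ?powR_ge0//.
  apply: le_trans (powR_increment_le (ltW a0) d0 x0 xy) _.
  rewrite ler_wpM2r ?subr_ge0// ler_wpM2r ?invr_ge0 ?(ltW d0)//; lra.
Qed.

(** The same two cases [h <= x] and [x < h]; this is for the boundary term that Abel summation
    splits off. *)
Lemma shift_gap_mul_powR (a b eta h x : R) : 0 < a -> a < 1 ->
  0 <= eta -> eta <= 1 -> 0 < h -> 0 < x ->
  shift_gap a h x * x `^ b <= h `^ eta * x `^ (b - a - eta).
Proof.
move=> a0 a1 eta0 eta1 h0 x0.
have powD p q : x `^ p * x `^ q = x `^ (p + q).
  by rewrite -powRD// (gt_eqF x0) implybT.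
have [hx|xh] := ltP h x.
- apply: le_trans (ler_wpM2r (powR_ge0 _ _)
    (shift_gap_le (ltW a0) (ltW h0) x0)) _.
  have {1}-> : h = h `^ eta * h `^ (1 - eta).
    rewrite -powRD; last by rewrite (gt_eqF h0) implybT.
    by rewrite addrC subrK powRr1// ltW.
  have -> : a * (h `^ eta * h `^ (1 - eta)) * x `^ (- a - 1) * x `^ b =
    h `^ eta * (a * (h `^ (1 - eta) * (x `^ (- a - 1) * x `^ b))) by ring.
  rewrite ler_wpM2l ?powR_ge0//.
  have -> : x `^ (b - a - eta) = x `^ (1 - eta) * (x `^ (- a - 1) * x `^ b).
    by rewrite !powD; congr (_ `^ _); ring.
  apply: le_trans (ler_wpM2r _ (ltW a1)) _; first by rewrite !mulr_ge0 ?powR_ge0.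
  rewrite mul1r ler_wpM2r ?mulr_ge0 ?powR_ge0//.
  by rewrite ge0_ler_powR ?nnegrE ?(ltW h0) ?(ltW x0) ?(ltW hx)// subr_ge0.
- apply: (@le_trans _ _ (x `^ (- a) * x `^ b)).
    by rewrite ler_wpM2r ?powR_ge0// /shift_gap gerBl powR_ge0.
  have -> : x `^ (- a) * x `^ b = x `^ eta * x `^ (b - a - eta).
    by rewrite !powD; congr (_ `^ _); ring.
  by rewrite ler_wpM2r ?powR_ge0// ge0_ler_powR ?nnegrE ?(ltW h0) ?(ltW x0).
Qed.

End power_profiles.

(** * Young integrals against kernels with a power singularity *)

Section volterra_integral.
Context {R : realType} {E : completeNormedModType R}.
Implicit Types (f : R -> E -> E) (w : R -> E) (L D t eta : R).

(* The kernels to be considered behave like [x `^ (- a)] near [0]. *)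
Record volterra_kernel (T a C : R) f : Prop := VolterraKernel {
  vkB : forall x, {morph f x : u v / u - v} ;
  vk_le : forall x u, 0 < x -> x <= T -> `|f x u| <= C * x `^ (- a) * `|u| ;
  vk_incr : forall x y u, 0 < x -> x <= y -> y <= T ->
    `|f x u - f y u| <= C * (x `^ (- a) - y `^ (- a)) * `|u| ;
  vk_incr2 : forall x y h u, 0 < x -> x <= y -> 0 <= h -> y + h <= T ->
    `|(f x u - f (x + h) u) - (f y u - f (y + h) u)| <=
    C * (shift_gap a h x - shift_gap a h y) * `|u| }.

Definition holder_le (T b L : R) w := forall r r' : R, 0 <= r -> r <= T ->
  0 <= r' -> r' <= T -> `|w r - w r'| <= L * `|r - r'| `^ b.

Lemma holder_leW T T' b L w : T' <= T -> holder_le T b L w -> holder_le T' b L w.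
Proof. by move=> TT h r r' *; apply: h => //; exact: le_trans TT. Qed.

Lemma small_powR (k M e : R) : 0 < k -> 0 <= M -> 0 < e ->
  exists2 d : R, 0 < d & M * d `^ k < e.
Proof.
move=> k0 M0 e0; have M1 : 0 < M + 1 by lra.
exists ((e / (M + 1)) `^ k^-1); first exact/powR_gt0/divr_gt0.
rewrite -powRrM mulVf ?gt_eqF// powRr1 ?divr_ge0 ?(ltW e0) ?(ltW M1)//.
by rewrite mulrA ltr_pdivrMr// mulrC ltr_pM2l//; lra.
Qed.

Definition vsum f t w := fun s => ksum (fun u => f (t - u)) w 0 s.

Definition vint f t w : E := lim (vsum f t w s @[s --> fine_partitions 0 t]).

Variables (T a b C : R).
Hypotheses (a0 : 0 < a) (a1 : a < 1) (ab : a < b) (C0 : 0 <= C).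

(** The term [f (t - t0) (w t - w t0)] split off by Abel summation has the same order as the rest.
    An arbitrary starting point [t0] is allowed for the sake of increments in the upper limit, where
    a sum over [[s, t]] alone is left. *)
Lemma vk_ksum_le f w L t t0 s : volterra_kernel T a C f -> 0 <= L -> t <= T ->
  0 <= t0 -> holder_le t b L w -> path <%R t0 s -> last t0 s = t ->
  `|ksum (fun u => f (t - u)) w t0 s| <=
  C * (1 + a / (b - a)) * L * (t - t0) `^ (b - a).
Proof.
move=> fK L0 tT t00 wL ps ls.
have ba0 : 0 < b - a by rewrite subr_gt0.
have K0 : 0 <= C * (a / (b - a)) by rewrite mulr_ge0// divr_ge0// ltW.
have t0t : t0 <= t by rewrite -ls path_lt_last.
have := t0t; rewrite le_eqVlt => /predU1P[t0t'|t0t'].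
  rewrite (path_lt_last_nil ps) ?ls// ksum_nil normr0.
  by rewrite !mulr_ge0 ?powR_ge0// addr_ge0// divr_ge0// ltW.
have tt0 : 0 < t - t0 by rewrite subr_gt0.
have := @ksum_abel R E (fun u => f (t - u)) w (fun x => C * x `^ (- a))
  b (b - a) (C * (a / (b - a))) L t t0 s ba0 L0 K0.
move=> /(_ _ _ _ _ ps ls) H.
have {}H : `|ksum (fun u => f (t - u)) w t0 s - f (t - t0) (w t - w t0)|
     <= L * (C * (a / (b - a))) * (t - t0) `^ (b - a).
  apply: H.
  - by move=> u; exact: (vkB fK).
  - move=> u v x tu uv vt; rewrite -mulrBr; apply: (vk_incr fK).
    + by rewrite subr_gt0.
    + by rewrite lerB// ltW.
    + by rewrite lerBlDr (le_trans tT)// lerDl (le_trans t00).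
  - move=> r tr rt; have := wL t r; rewrite [`|t - r|]ger0_norm ?subr_ge0//.
    by apply=> //; apply: (le_trans t00) => //; exact: le_trans tr rt.
  - apply: profileZ => //; exact: profile_powR (ltW a0) ab.
have fw : `|f (t - t0) (w t - w t0)| <= C * L * (t - t0) `^ (b - a).
  apply: le_trans (vk_le fK _ _ _) _ => //.
    by rewrite lerBlDr (le_trans tT)// lerDl.
  have -> : C * L * (t - t0) `^ (b - a) =
      C * (t - t0) `^ (- a) * (L * (t - t0) `^ b).
    by rewrite mulrACA -powRD ?(gt_eqF tt0) ?implybT// [- a + b]addrC.
  rewrite ler_wpM2l ?mulr_ge0 ?powR_ge0//.
  have := wL t t0; rewrite [`|t - t0|]ger0_norm ?subr_ge0//.
  by apply=> //; exact: le_trans t0t.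
rewrite -[ksum _ _ _ _](subrK (f (t - t0) (w t - w t0))).
apply: le_trans (ler_normD _ _) _; apply: le_trans (lerD H fw) _.
by rewrite le_eqVlt; apply/orP; left; apply/eqP; ring.
Qed.

(** The margin [b - a] is shared equally: one half makes [x^(- a)] a profile for the exponent
    [a + kap], the other half is the rate in the mesh. *)
Let kap := (b - a) / 2.
Let K := C * (a / kap) * T `^ kap.

Let kap0 : 0 < kap. Proof. by rewrite divr_gt0// subr_gt0. Qed.

Let K_ge0 : 0 <= K.
Proof.
by rewrite /K mulr_ge0 ?powR_ge0// mulr_ge0// divr_ge0// ltW// kap0.
Qed.

Lemma vk_vsum_cauchy f w L t D s1 s2 : volterra_kernel T a C f -> 0 <= L ->
  t <= T -> holder_le t b L w ->
  itv_partition 0 t s1 -> itv_partition 0 t s2 ->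
  mesh 0 s1 <= D -> mesh 0 s2 <= D ->
  `|vsum f t w s1 - vsum f t w s2| <= L * K * D `^ kap.
Proof.
move=> fK L0 tT wL is1 is2 m1 m2.
have t0 : 0 <= t by have [p /eqP <-] := is1; rewrite path_lt_last.
have := @ksum_cauchy R E (fun u => f (t - u)) w (fun x => C * x `^ (- a))
  b (a + kap) kap (C * (a / kap)) L t D s1 s2 kap0 L0.
have -> : b - (a + kap) = kap by rewrite /kap; field.
move=> H; apply: le_trans (H _ _ _ _ _ _ _ _ _ _ _) _ => //.
- by rewrite mulr_ge0// divr_ge0// ltW.
- by rewrite addr_gt0.
- rewrite -lerBrDl ler_pdivrMr// mulr_natr mulr2n lerDl subr_ge0; exact: ltW.
- by move=> u; exact: (vkB fK).
- move=> u v x u0 uv vt; rewrite -mulrBr; apply: (vk_incr fK).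
  + by rewrite subr_gt0.
  + by rewrite lerB// ltW.
  + by rewrite lerBlDr (le_trans tT)// lerDl.
- apply: profileZ => //.
  by have := @profile_powR _ t a (a + kap) (ltW a0); rewrite addrC addrK;
    apply; rewrite ltrDr.
- rewrite ler_wpM2r ?powR_ge0// -mulrA ler_wpM2l// /K ler_wpM2l//.
    by rewrite mulr_ge0// divr_ge0// ltW.
  by rewrite ge0_ler_powR ?nnegrE ?(ltW kap0)// (le_trans t0).
Qed.

Lemma vsum_cvg f w L t : volterra_kernel T a C f -> 0 <= L ->
  0 <= t -> t <= T -> holder_le t b L w ->
  vsum f t w s @[s --> fine_partitions 0 t] --> vint f t w.
Proof.
move=> fK L0 t0 tT wL; have FF := fine_partitions_filter t0.
apply/cauchy_cvgP/cauchy_exP => e e0.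
have [d d0 de] := small_powR kap0 (mulr_ge0 L0 K_ge0) e0.
have [s0 [is0 ms0]] := fine_partition_exists t0 d0.
exists (vsum f t w s0); exists d => //= s [is_ ms].
rewrite -ball_normE /ball_/=; apply: le_lt_trans de.
by apply: vk_vsum_cauchy => //; exact: ltW.
Qed.

Lemma vsum_vint_le f w L t D s : volterra_kernel T a C f -> 0 <= L ->
  t <= T -> holder_le t b L w -> 0 < D ->
  itv_partition 0 t s -> mesh 0 s <= D ->
  `|vsum f t w s - vint f t w| <= L * K * D `^ kap.
Proof.
move=> fK L0 tT wL D0 is_ ms.
have t0 : 0 <= t by have [p /eqP <-] := is_; rewrite path_lt_last.
have FF := fine_partitions_filter t0.
have h : `|vsum f t w s - vsum f t w s'| @[s' --> fine_partitions 0 t] -->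
    `|vsum f t w s - vint f t w|.
  apply: cvg_norm; apply: cvgB; first exact: cvg_cst.
  exact: vsum_cvg fK L0 t0 tT wL.
apply: (cvgr_to_le h); exists D => //= s' [is' ms'].
by apply: vk_vsum_cauchy => //; exact: ltW.
Qed.

Lemma vintB f w1 w2 L1 L2 t : volterra_kernel T a C f -> 0 <= L1 -> 0 <= L2 ->
  0 <= t -> t <= T -> holder_le t b L1 w1 -> holder_le t b L2 w2 ->
  vint f t (fun r => w1 r - w2 r) = vint f t w1 - vint f t w2.
Proof.
move=> fK L10 L20 t0 tT wL1 wL2.
have FF := fine_partitions_filter t0.
apply/cvg_lim => //.
have -> : vsum f t (fun r => w1 r - w2 r) =
    (fun s => vsum f t w1 s - vsum f t w2 s).
  by apply/funext => s; rewrite /vsum ksumB// => u; exact: (vkB fK).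
by apply: cvgB; [exact: vsum_cvg wL1|exact: vsum_cvg wL2].
Qed.

Lemma vint_le f w L t : volterra_kernel T a C f -> 0 <= L ->
  0 <= t -> t <= T -> holder_le t b L w ->
  `|vint f t w| <= C * (1 + a / (b - a)) * L * t `^ (b - a).
Proof.
move=> fK L0 t0 tT wL; have FF := fine_partitions_filter t0.
have h : `|vsum f t w s| @[s --> fine_partitions 0 t] --> `|vint f t w|.
  by apply: cvg_norm; exact: vsum_cvg wL.
apply: (cvgr_to_le h); exists 1 => //= s [[ps /eqP ls] _].
by have := vk_ksum_le fK L0 tT (lexx 0) wL ps ls; rewrite subr0.
Qed.

(** The increments in [u] of [f (t - u) - f (s - u)] are second differences of [f] with step
    [t - s], hence the profile of [shift_gap] and the factor [(t - s)^eta]. *)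
Lemma vk_gap_ksum_le f w L s t eta s1 : volterra_kernel T a C f -> 0 <= L ->
  0 <= s -> s < t -> t <= T -> 0 < eta -> eta <= 1 -> a + eta < b ->
  holder_le t b L w -> itv_partition 0 s s1 ->
  `|ksum (fun u x => f (t - u) x - f (s - u) x) w 0 s1| <=
  C * (1 + 2 / (b - a - eta)) * L * T `^ (b - a - eta) * (t - s) `^ eta.
Proof.
move=> fK L0 s0 st tT eta0 eta1 aeb wL [ps /eqP ls].
have d0 : 0 < b - a - eta by lra.
have h0 : 0 < t - s by rewrite subr_gt0.
have c0 : 0 <= 1 + 2 / (b - a - eta) by rewrite addr_ge0// divr_ge0// ltW.
move: s0; rewrite le_eqVlt => /predU1P[s0|s0].
  rewrite (path_lt_last_nil ps) ?ls// ksum_nil normr0.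
  by rewrite !mulr_ge0 ?powR_ge0.
set k := fun u x => _.
have kB u : {morph k u : x y / x - y}.
  by move=> x y; rewrite /k !(vkB fK); zmodule.
have K0 : 0 <= C * ((t - s) `^ eta * (2 / (b - a - eta))).
  by rewrite !mulr_ge0 ?powR_ge0// invr_ge0 ltW.
have := @ksum_abel R E k w (fun x => C * shift_gap a (t - s) x)
  b (b - a - eta) _ L s 0 s1 d0 L0 K0 kB.
rewrite subr0 => /(_ _ _ _ ps ls) H.
have {}H := H _ _ _.
have {}H : `|ksum k w 0 s1 - k 0 (w s - w 0)|
     <= L * (C * ((t - s) `^ eta * (2 / (b - a - eta)))) * s `^ (b - a - eta).
  apply: H.
  - move=> u v x u0 uv vs; rewrite /k.
    have /= := @vk_incr2 T a C f fK (s - v) (s - u) (t - s) x.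
    have -> : s - v + (t - s) = t - v by ring.
    have -> : s - u + (t - s) = t - u by ring.
    move=> H'; rewrite -mulrBr.
    have -> : f (t - v) x - f (s - v) x - (f (t - u) x - f (s - u) x) =
       - (f (s - v) x - f (t - v) x - (f (s - u) x - f (t - u) x)) by zmodule.
    rewrite normrN; apply: H'.
    + by rewrite subr_gt0.
    + by rewrite lerB// ltW.
    + by rewrite ltW.
    + by rewrite lerBlDr (le_trans tT)// lerDl.
  - move=> r r0 rs; have := wL s r; rewrite [`|s - r|]ger0_norm ?subr_ge0//.
    apply=> //; [exact: ltW|exact: ltW|exact: le_trans rs (ltW st)].
  - apply: profileZ => //.
    by apply: profile_shift_gap => //; exact: ltW.
have fw : `|k 0 (w s - w 0)| <= C * L * (t - s) `^ eta * s `^ (b - a - eta).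
  rewrite /k !subr0 distrC.
  apply: le_trans (vk_incr fK _ s0 (ltW st) tT) _.
  have ws : `|w s - w 0| <= L * s `^ b.
    have := wL s 0; rewrite subr0 [`|s|]ger0_norm ?(ltW s0)//.
    by apply; rewrite ?(ltW st) ?lexx ?(ltW s0)// (le_trans (ltW s0) (ltW st)).
  have := shift_gap_mul_powR b a0 a1 (ltW eta0) eta1 h0 s0.
  rewrite /shift_gap [s + _]addrC subrK => G.
  have G0 : 0 <= C * (s `^ (- a) - t `^ (- a)).
    rewrite mulr_ge0// subr_ge0 powR_nonincreasing ?oppr_le0 ?(ltW a0)//.
    exact: ltW.
  apply: le_trans (ler_wpM2l G0 ws) _.
  have -> : C * (s `^ (- a) - t `^ (- a)) * (L * s `^ b) =
     C * L * ((s `^ (- a) - t `^ (- a)) * s `^ b) by ring.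
  by rewrite -[leRHS]mulrA ler_wpM2l ?mulr_ge0.
rewrite -[ksum _ _ _ _](subrK (k 0 (w s - w 0))).
apply: le_trans (ler_normD _ _) _; apply: le_trans (lerD H fw) _.
apply: (@le_trans _ _ (C * (1 + 2 / (b - a - eta)) * L * (t - s) `^ eta *
    s `^ (b - a - eta))).
  by rewrite le_eqVlt; apply/orP; left; apply/eqP; ring.
rewrite [leRHS]mulrAC ler_wpM2l ?mulr_ge0 ?powR_ge0//.
by rewrite ge0_ler_powR ?nnegrE ?(ltW d0)//; lra.
Qed.

(** The first summand stems from the change of kernel over [[0, s]], the second from the cells
    between [s] and [t]. *)
Definition vint_holder_cst eta :=
  C * (1 + 2 / (b - a - eta)) * T `^ (b - a - eta) +
  C * (1 + a / (b - a)) * T `^ (b - a - eta).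

(** The partition of [[0, t]] is made to pass through [s], so that both sums share the cells of
    [[0, s]]; the approximation errors stay below an arbitrary [e]. *)
Lemma vint_holder f w L s t eta : volterra_kernel T a C f -> 0 <= L ->
  0 <= s -> s <= t -> t <= T -> 0 < eta -> eta <= 1 -> a + eta < b ->
  holder_le t b L w ->
  `|vint f t w - vint f s w| <= vint_holder_cst eta * L * (t - s) `^ eta.
Proof.
move=> fK L0 s0 st tT eta0 eta1 aeb wL.
have sT : s <= T by exact: le_trans tT.
have d0 : 0 < b - a - eta by lra.
have ba0 : 0 < b - a by rewrite subr_gt0.
have c1p : 0 <= 1 + 2 / (b - a - eta) by rewrite addr_ge0// divr_ge0// ltW.
have c2p : 0 <= 1 + a / (b - a) by rewrite addr_ge0// divr_ge0// ltW.
have cst0 : 0 <= vint_holder_cst eta.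
  by rewrite /vint_holder_cst addr_ge0// mulr_ge0 ?powR_ge0// mulr_ge0.
move: st; rewrite le_eqVlt => /predU1P[<-|st].
  by rewrite subrr normr0 !mulr_ge0 ?powR_ge0.
have t0 : 0 <= t by rewrite (le_trans s0)// ltW.
have wLs : holder_le s b L w by apply: holder_leW wL; exact: ltW.
apply/ler_addgt0Pl => e e0.
have e20 : 0 < e / 2 by rewrite divr_gt0.
have [D D0 De] := small_powR kap0 (mulr_ge0 L0 K_ge0) e20.
have [s1 [is1 ms1]] := fine_partition_exists s0 D0.
have [s2 [is2 ms2]] := fine_partition_exists (ltW st) D0.
have is12 := itv_partition_cat is1 is2.
have [p1 /eqP l1] := is1; have [p2 /eqP l2] := is2.
have h1 := vsum_vint_le fK L0 sT wLs D0 is1 (ltW ms1).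
have h2 := vsum_vint_le fK L0 tT wL D0 is12.
have {}h2 := h2 _.
have {}h2 : `|vsum f t w (s1 ++ s2) - vint f t w| <= L * K * D `^ kap.
  by apply: h2; rewrite mesh_cat l1 ge_max (ltW ms1) (ltW ms2).
have g1 := vk_gap_ksum_le fK L0 s0 st tT eta0 eta1 aeb wL is1.
have g2 := vk_ksum_le fK L0 tT s0 wL p2 l2.
have -> : vint f t w - vint f s w =
   (vint f t w - vsum f t w (s1 ++ s2)) + (vsum f s w s1 - vint f s w) +
   (ksum (fun u x => f (t - u) x - f (s - u) x) w 0 s1 +
    ksum (fun u => f (t - u)) w s s2).
  have -> : ksum (fun u x => f (t - u) x - f (s - u) x) w 0 s1 =
      ksum (fun u => f (t - u)) w 0 s1 - vsum f s w s1.
    by rewrite -ksum_kernelB.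
  have -> : vsum f t w (s1 ++ s2) =
      ksum (fun u => f (t - u)) w 0 s1 + ksum (fun u => f (t - u)) w s s2.
    by rewrite /vsum ksum_cat l1.
  by zmodule.
apply: le_trans (ler_normD _ _) _; apply: lerD.
  apply: le_trans (ler_normD _ _) _; rewrite distrC.
  by apply: le_trans (lerD h2 h1) _; lra.
apply: le_trans (ler_normD _ _) _; apply: le_trans (lerD g1 g2) _.
rewrite /vint_holder_cst.
set c1 := C * (1 + 2 / _); set c2 := C * (1 + a / _).
have -> : (c1 * T `^ (b - a - eta) + c2 * T `^ (b - a - eta)) * L * (t - s) `^ eta
  = c1 * L * T `^ (b - a - eta) * (t - s) `^ eta +
    c2 * L * (T `^ (b - a - eta) * (t - s) `^ eta) by ring.
rewrite lerD2l; apply: ler_wpM2l.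
  by rewrite mulr_ge0// mulr_ge0.
have ts0 : 0 < t - s by rewrite subr_gt0.
have -> : (t - s) `^ (b - a) = (t - s) `^ (b - a - eta) * (t - s) `^ eta.
  by rewrite -powRD ?(gt_eqF ts0) ?implybT// subrK.
by rewrite ler_wpM2r ?powR_ge0// ge0_ler_powR ?nnegrE//; lra.
Qed.

End volterra_integral.

(** * The normed space of bounded operators and its completeness *)

Section bounded_operator_norms.
Context {R : realType} {H : normedModType R}.
Implicit Types (A B C : bop H) (M : R).

Lemma bop_norm_le A x : `|A x| <= `|A| * `|x|. Proof. exact: le_opnorm. Qed.

Lemma bop_norm_ub A M : 0 <= M -> (forall x, `|A x| <= M * `|x|) -> `|A| <= M.
Proof.
move=> M0 AM; apply: opnorm_le => x x1; apply: le_trans (AM x) _.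
by rewrite -[leRHS]mulr1 ler_wpM2l.
Qed.

Lemma bopP A B : (forall x, A x = B x) -> A = B.
Proof. by move=> AB; apply/val_inj/funext. Qed.

Lemma bopB A B x : (A - B) x = A x - B x. Proof. by []. Qed.

Lemma bop_sum I (s : seq I) (F : I -> bop H) x :
  (\sum_(i <- s) F i) x = \sum_(i <- s) F i x.
Proof. by elim/big_rec2 : _ => // i u v _ <-. Qed.

Lemma norm_bcomp A B : `|bcomp A B| <= `|A| * `|B|.
Proof.
apply: bop_norm_ub => [|x]; first by rewrite mulr_ge0.
by rewrite /= (le_trans (bop_norm_le _ _))// -mulrA ler_wpM2l// bop_norm_le.
Qed.

Lemma bcompBl (C : bop H) : {morph (fun A => bcomp A C) : A B / A - B}.
Proof. by move=> A B; apply: bopP. Qed.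

Lemma bcompBr (C : bop H) : {morph (fun A => bcomp C A) : A B / A - B}.
Proof. by move=> A B; apply: bopP => x /=; rewrite linearB. Qed.

Lemma norm_bpow A i : `|bpow A i| <= `|A| ^+ i.
Proof.
elim: i => [|i IH] /=.
  by apply: bop_norm_ub => // x; rewrite expr0 mul1r.
by rewrite exprS (le_trans (norm_bcomp _ _))// ler_wpM2l.
Qed.

End bounded_operator_norms.

Section bounded_operators_complete.
Context {R : realType} {H : completeNormedModType R}.

(** The limit is taken pointwise. A bound [e |x|] on [|A x - B x|], valid for [B] in a ball,
    survives this limit, which gives boundedness and convergence in norm. *)
Lemma bop_cauchy_cvg (F : set_system (bop H)) : ProperFilter F ->
  cauchy F -> cvg F.
Proof.
move=> FF /cauchyP FC.
have FCx x : cvg ((fun A : bop H => A x) @ F).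
  apply/cauchy_cvgP/cauchyP => e e0.
  have x0 : 0 < `|x| + 1 by rewrite ltr_wpDl.
  have [A FA] := FC _ (divr_gt0 e0 x0); exists (A x).
  suff : \forall B \near F, ball (A x) e ((B : bop H) x) by [].
  apply: filterS FA => B; rewrite -!ball_normE /ball_/= => AB.
  rewrite -bopB (le_lt_trans (bop_norm_le _ _))//.
  move: AB; rewrite ltr_pdivlMr//; apply: le_lt_trans.
  by rewrite ler_wpM2l// lerDl.
pose g x := lim ((fun A : bop H => A x) @ F).
have gE x : (fun A : bop H => A x) @ F --> g x by exact: FCx.
have glin : linear g.
  move=> k x y; apply/cvg_lim => //.
  rewrite (_ : (fun A : bop H => A (k *: x + y)) = fun A => k *: A x + A y).
    by apply: cvgD; [apply: cvgZr; exact: gE|exact: gE].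
  by apply/funext => A; rewrite linearP.
have gball (A : bop H) e x : F (ball A e) -> `|A x - g x| <= e * `|x|.
  move=> FA.
  have h : (fun B : bop H => `|A x - B x|) @ F --> `|A x - g x|.
    by apply: cvg_norm; apply: cvgB; [exact: cvg_cst|exact: gE].
  apply: (cvgr_to_le h); apply: filterS FA => B.
  rewrite -ball_normE /ball_/= => AB.
  rewrite -bopB (le_trans (bop_norm_le _ _))// ler_wpM2r//.
  exact: ltW.
have gb : g \in @bounded_linear R H.
  rewrite inE; split=> //.
  have [A FA] := FC 1 ltr01; exists (`|A| + 1) => x.
  rewrite mulrDl -[g x](subrK (A x)) addrC (le_trans (ler_normD _ _))//.
  by rewrite lerD ?bop_norm_le// distrC gball.
apply/cvg_ex; exists (Bop gb); apply/cvgrPdist_le => e e0.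
have [A FA] := FC _ (divr_gt0 e0 (ltr0n R 2)).
apply: filterS (FA) => B; rewrite -ball_normE /ball_/= => AB.
rewrite -(subrKA A) (le_trans (ler_normD _ _))// (splitr e) lerD//.
  rewrite distrC bop_norm_ub//; first by rewrite ltW// divr_gt0.
  by move=> x; rewrite bopB/=; exact: gball.
exact: ltW.
Qed.

HB.instance Definition _ := Uniform_isComplete.Build (bop H) bop_cauchy_cvg.

End bounded_operators_complete.

(** * Hilbert spaces: Cauchy-Schwarz, Riesz representation, adjoints *)

Section hilbert_spaces.
Context {R : realType} {H : hilbertType R}.
Implicit Types (x y z : H) (A B : bop H).

Lemma innerC x y : inner x y = inner y x.
Proof. by rewrite hermC/= expr0 mul1r. Qed.

Lemma innerDl x y z : inner (x + y) z = inner x z + inner y z.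
Proof. exact: linearDl. Qed.
Lemma innerBl x y z : inner (x - y) z = inner x z - inner y z.
Proof. exact: linearBl. Qed.
Lemma innerZl k x z : inner (k *: x) z = k * inner x z.
Proof. exact: linearZl_LR. Qed.
Lemma inner0l z : inner (0 : H) z = 0.
Proof. exact: linear0l. Qed.
Lemma innerDr x y z : inner z (x + y) = inner z x + inner z y.
Proof. by rewrite !(innerC z) innerDl. Qed.
Lemma innerBr x y z : inner z (x - y) = inner z x - inner z y.
Proof. by rewrite !(innerC z) innerBl. Qed.
Lemma innerZr k x z : inner z (k *: x) = k * inner z x.
Proof. by rewrite !(innerC z) innerZl. Qed.
Lemma inner0r z : inner z (0 : H) = 0.
Proof. by rewrite innerC inner0l. Qed.
Lemma inner_suml I (s : seq I) (F : I -> H) z :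
  inner (\sum_(i <- s) F i) z = \sum_(i <- s) inner (F i) z.
Proof. by elim/big_rec2 : _ => [|i u v _ <-]; rewrite ?inner0l ?innerDl. Qed.

Lemma inner_le x y : `|inner x y| <= `|x| * `|y|.
Proof.
have [->|y0] := eqVneq y 0; first by rewrite inner0r !normr0 mulr0.
have ny : 0 < `|y| by rewrite normr_gt0.
rewrite -(@ler_pXn2r _ 2)// ?nnegrE ?mulr_ge0// real_normK ?num_real//.
(* This vector is [|y|^2] times the component of [x] orthogonal to [y]. *)
have : 0 <= `| (`|y| ^+ 2) *: x - (inner x y) *: y| ^+ 2 by rewrite sqr_ge0.
rewrite inner_normE innerBl !innerBr !innerZl !innerZr -!inner_normE.
rewrite (innerC y x) => h.
have : 0 <= (`|y| ^+ 2) * (`|x| ^+ 2 * `|y| ^+ 2 - inner x y ^+ 2).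
  by apply: le_trans h _; rewrite le_eqVlt; apply/orP; left; apply/eqP; ring.
by rewrite pmulr_rge0 ?exprn_gt0// subr_ge0 exprMn.
Qed.

Lemma inner_cvgl (T : Type) (F : set_system T) {FF : Filter F} (f : T -> H) x y :
  f t @[t --> F] --> x -> inner (f t) y @[t --> F] --> inner x y.
Proof.
move=> fx; apply/cvgrPdist_le => e e0.
have y1 : 0 < `|y| + 1 by rewrite ltr_wpDl.
have /cvgrPdist_le/(_ _ (divr_gt0 e0 y1)) := fx.
apply: filterS => t h; rewrite -innerBl (le_trans (inner_le _ _))//.
move: h; rewrite ler_pdivlMr//; apply: le_trans.
by rewrite ler_wpM2l// lerDl.
Qed.

Lemma inner_inj x y : (forall h, inner x h = inner y h) -> x = y.
Proof.
move=> xy; apply/eqP; rewrite -subr_eq0 -normr_eq0 -(sqrf_eq0 `|_|).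
by rewrite inner_normE innerBl xy subrr.
Qed.

(** The first-order condition at a minimum: for small [t] of the right sign a nonzero linear term
    would prevail over the square. *)
Lemma quadratic_ge0_eq0 (d c : R) :
  (forall t : R, 0 <= 2 * t * d + t ^+ 2 * c) -> d = 0.
Proof.
move=> h; have c1 : 0 < `|c| + 1 by rewrite ltr_wpDl.
have := h (- d / (`|c| + 1)).
have -> : 2 * (- d / (`|c| + 1)) * d + (- d / (`|c| + 1)) ^+ 2 * c =
   d ^+ 2 * ((c - 2 * (`|c| + 1)) / (`|c| + 1) ^+ 2).
  by field; rewrite gt_eqF.
have [->//|d0] := eqVneq d 0.
rewrite pmulr_rge0 ?exprn_even_gt0// pmulr_lge0 ?invr_gt0 ?exprn_gt0//.
by have := ler_norm c; lra.
Qed.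

(* Minimization of [|x|^2 - 2 phi x]. *)
Lemma riesz (phi : H -> R) (M : R) : linear phi -> (forall x, `|phi x| <= M * `|x|) ->
  exists z, forall x, phi x = inner x z.
Proof.
move=> phil phiM.
have phiD x y : phi (x + y) = phi x + phi y.
  by have := phil 1 x y; rewrite !scale1r.
have phi0 : phi 0 = 0.
  by apply/eqP; rewrite -normr_le0 (le_trans (phiM 0))// normr0 mulr0.
have phiZ k x : phi (k *: x) = k * phi x.
  by have := phil k x 0; rewrite !addr0 phi0 addr0.
pose J x : R := `|x| ^+ 2 - 2 * phi x.
have JD x y : J (x + y) = J x + (2 * (inner x y - phi y) + `|y| ^+ 2).
  by rewrite /J !inner_normE innerDl !innerDr phiD (innerC y x); ring.
have Jlb x : - M ^+ 2 <= J x.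
  have := phiM x; rewrite ler_norml => /andP[_ h].
  have := sqr_ge0 (`|x| - M); rewrite /J; lra.
have Jinf : has_inf (range J).
  by split; [exists (J 0), 0|exists (- M ^+ 2) => _ [x _ <-]].
pose m := inf (range J).
have mJ x : m <= J x by apply: ge_inf; [case: Jinf|exists x].
have ex n : exists x, J x < m + n.+1%:R^-1.
  have [_ [x _ <-] h] := inf_adherent (ltac:(by rewrite invr_gt0) : 0 < n.+1%:R^-1) Jinf.
  by exists x.
have [u uJ] := choice ex.
clear Jinf Jlb; clearbody m.
(* Parallelogram identity: [J] at the midpoint cannot go below the infimum, so a minimizing sequence
   is Cauchy. *)
have par n k : `|u n - u k| ^+ 2 <= 2 * (n.+1%:R^-1 + k.+1%:R^-1).
  have := mJ (2^-1 *: (u n + u k)); have := uJ n; have := uJ k.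
  rewrite /J !inner_normE !innerZl !innerZr innerBl !innerBr !innerDl !innerDr.
  rewrite phiZ phiD (innerC (u k) (u n)).
  move: (inner (u n) (u n)) (inner (u k) (u k)) (inner (u n) (u k)) (phi (u n))
    (phi (u k)) (n.+1%:R^-1) (k.+1%:R^-1) => p q r s t e e'.
  by lra.
have uC : cvg (u @ \oo).
  apply/cauchy_cvgP/cauchyP => e e0.
  pose N := Num.truncn (4 / e ^+ 2); exists (u N).
  suff : \forall n \near \oo, ball (u N) e (u n) by [].
  near=> n; rewrite -ball_normE /ball_/=.
  rewrite -(@ltr_pXn2r _ 2) ?nnegrE ?(ltW e0)//.
  have Ne : (4 / e ^+ 2) < N.+1%:R by rewrite truncnS_gt.
  apply: le_lt_trans (par _ _) _.
  have nN : n.+1%:R^-1 <= N.+1%:R^-1 :> R.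
    by rewrite lef_pV2 ?posrE// ler_nat ltnS; near: n; exact: nbhs_infty_ge.
  apply: (@le_lt_trans _ _ (4 * N.+1%:R^-1)).
    by move: nN; move: (n.+1%:R^-1) (N.+1%:R^-1) => p q; lra.
  by rewrite ltr_pdivrMr// mulrC -ltr_pdivrMr ?exprn_gt0.
pose z := lim (u @ \oo); exists z => x.
apply/esym/eqP; rewrite -subr_eq0; apply/eqP.
apply: (@quadratic_ge0_eq0 _ (`|x| ^+ 2)) => t.
have h : 2 * t * (inner (u n) x - phi x) + t ^+ 2 * `|x| ^+ 2 + n.+1%:R^-1
    @[n --> \oo] --> 2 * t * (inner x z - phi x) + t ^+ 2 * `|x| ^+ 2 + 0.
  apply: cvgD; last exact: cvg_harmonic.
  apply: cvgD; last exact: cvg_cst.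
  apply: cvgMr; apply: cvgB; last exact: cvg_cst.
  by rewrite innerC; exact: inner_cvgl.
rewrite addr0 in h.
apply: (cvgr_to_ge h); near=> n.
have := mJ (u n + t *: x); rewrite JD innerZr phiZ normrZ exprMn real_normK ?num_real//.
have := uJ n; move: (J (u n)) (inner (u n) x) (phi x) (n.+1%:R^-1) => p q r s.
rewrite -mulrBr mulrA; move: (2 * t * (q - r)) => v; lra.
Unshelve. all: by end_near. Qed.

Lemma adjoint_exists A : exists B : bop H, forall x y, inner (A x) y = inner x (B y).
Proof.
have h y : exists z, forall x, inner (A x) y = inner x z.
  apply: (@riesz _ (`|A| * `|y|)) => [k x x'|x].
    by rewrite linearP innerDl innerZl.
  rewrite (le_trans (inner_le _ _))// mulrAC ler_wpM2r//; exact: bop_norm_le.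
have [g gE] := choice h.
have gb : g \in @bounded_linear R H.
  rewrite inE; split.
    move=> k y y'; apply: inner_inj => x.
    by rewrite innerC -gE innerDr innerZr !gE -innerZr -innerDr innerC.
  exists `|A| => y; have [->|gy0] := eqVneq (g y) 0.
    by rewrite normr0 mulr_ge0.
  have gy : 0 < `|g y| by rewrite normr_gt0.
  rewrite -(ler_pM2l gy) -expr2 inner_normE -gE.
  rewrite (le_trans (ler_norm _))// (le_trans (inner_le _ _))//.
  by rewrite mulrA [_ * `|A|]mulrC ler_wpM2r// bop_norm_le.
by exists (Bop gb).
Qed.

Lemma adjointE A x y : inner (A x) y = inner x (adjoint A y).
Proof.
rewrite /adjoint; case: xgetP => [B _ -> //|h].
by have [B BE] := adjoint_exists A; have := h B BE.
Qed.

Lemma bpow_adjoint A x y i :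
  inner (bpow A i x) y = inner x (bpow (adjoint A) i y).
Proof.
have bpowC B j v : bpow B j (B v) = B (bpow B j v).
  by elim: j => //= j ->.
by elim: i x y => //= i IH x y; rewrite adjointE IH bpowC.
Qed.

End hilbert_spaces.

(** * Affine substitutions in Lebesgue integrals *)

Section affine_change_of_variable.
Context {R : realType}.
Local Open Scope ereal_scope.
Local Notation mu := (@lebesgue_measure R).

Lemma measurable_affine (c k : R) :
  measurable_fun [set: R] (fun x : R => (c * x + k)%R : measurableTypeR R).
Proof. by apply: measurable_funD => //; exact: measurable_funM. Qed.

(** Lebesgue measure is determined by its values on half-open intervals, and the scaled image
    measure has these values. *)
Lemma lebesgue_measure_affine (c k : R) (A : set R) : (0 < c)%R ->
  measurable A ->
  c%:E * pushforward mu (fun x : R => (c * x + k)%R : measurableTypeR R) A = mu A.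
Proof.
move=> c0 mA.
pose phi : measurableTypeR R -> measurableTypeR R := fun x => (c * x + k)%R.
have h := @lebesgue_measure_unique R
  (mscale (NngNum (ltW c0)) (pushforward mu phi)).
have {}h := h (measurable_affine c k).
apply/esym; apply: h mA => _ [[a b]] _ <-.
have phiE : phi @^-1` `]a, b] = `]((a - k) / c)%R, ((b - k) / c)%R]%classic.
  apply/seteqP; split => x /=; rewrite !in_itv/= ltr_pdivrMr// ler_pdivlMr//;
  by rewrite ltrBlDr lerBrDr [(x * c)%R]mulrC.
change (mu `]a, b] = c%:E * mu (phi @^-1` `]a, b])).
rewrite phiE !lebesgue_measure_itv/= !lte_fin ltr_pM2r ?invr_gt0// ltrD2r.
case: ifPn => _; last by rewrite mule0.
rewrite -EFinM; congr EFin; field.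
by rewrite gt_eqF.
Qed.

Lemma ge0_integral_affine (c k : R) (f : R -> \bar R) : (0 < c)%R ->
  measurable_fun [set: R] f -> (forall x, 0 <= f x) ->
  \int[mu]_x f x = c%:E * \int[mu]_x f (c * x + k)%R.
Proof.
move=> c0 mf f0.
pose phi : measurableTypeR R -> measurableTypeR R := fun x => (c * x + k)%R.
have mphi : measurable_fun [set: measurableTypeR R] phi by exact: measurable_affine.
have mf' : measurable_fun [set: measurableTypeR R] f by exact: mf.
have := ge0_integral_pushforward mphi
  [the {measure set (measurableTypeR R) -> \bar R} of mu]
  measurableT mf' (fun y _ => f0 y).
rewrite preimage_setT => <-.
rewrite -(@ge0_integral_mscale _ _ _ _ _ measurableT (NngNum (ltW c0)))//.
apply: eq_measure_integral => A mA _ /=.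
by rewrite -(lebesgue_measure_affine k c0 mA).
Qed.

End affine_change_of_variable.

(** * The Gamma function, the Beta integral and fractional kernels *)

Section gamma_function.
Context {R : realType}.
Local Notation mu := (@lebesgue_measure R).

(** Truncation to positive arguments turns convolutions over [[0, z]] into integrals over the line,
    where substitutions and Tonelli need no care about domains. *)
Definition ppow (a x : R) : R := if 0 < x then x `^ (a - 1) else 0.

Lemma ppow_ge0 a x : 0 <= ppow a x.
Proof. by rewrite /ppow; case: ifP => _; rewrite ?powR_ge0. Qed.

Lemma ppow_eq0 a x : x <= 0 -> ppow a x = 0.
Proof. by rewrite /ppow ltNge => ->. Qed.

Lemma measurable_ppow a : measurable_fun [set: R] (ppow a).
Proof.
apply: measurable_fun_if => //.
- exact: measurable_fun_ltr.
- by apply: measurable_funTS; exact: measurable_powR.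
Qed.

Lemma ppowM a c x : 0 < c -> ppow a (c * x) = c `^ (a - 1) * ppow a x.
Proof.
move=> c0; rewrite /ppow pmulr_rgt0//; case: ifPn => x0; last by rewrite mulr0.
by rewrite powRM// ltW.
Qed.

Local Open Scope ereal_scope.

(** Kept in the extended reals, so that Tonelli and the product formula need no prior finiteness. *)
Definition egamma (a : R) := \int[mu]_x (ppow a x * expR (- x))%:E.

(** The convolution at [z] of two truncated powers; for [z = 1] it is the Beta integral. *)
Definition ebeta (a b z : R) := \int[mu]_x (ppow a x * ppow b (z - x))%:E.

Lemma egammaE (a : R) :
  egamma a = \int[mu]_(x in `]0%R, +oo[) (x `^ (a - 1) * expR (- x))%:E.
Proof.
rewrite [RHS]integral_mkcond; apply: eq_integral => x _.
rewrite patchE mem_setE in_itv/= andbT /ppow.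
by case: ifP => // _; rewrite mul0r.
Qed.

Lemma GammaE a : Gamma a = fine (egamma a).
Proof. by rewrite egammaE. Qed.

Lemma measurable_gamma_integrand a :
  measurable_fun [set: R] (fun x => (ppow a x * expR (- x))%:E).
Proof.
apply/measurable_EFinP; apply: measurable_funM; first exact: measurable_ppow.
exact: measurableT_comp.
Qed.

Lemma gamma_integrand_ge0 a (x : R) : 0 <= (ppow a x * expR (- x))%:E.
Proof. by rewrite lee_fin mulr_ge0 ?ppow_ge0// expR_ge0. Qed.

Lemma measurable_ebeta_integrand a b z :
  measurable_fun [set: R] (fun x => (ppow a x * ppow b (z - x))%:E).
Proof.
apply/measurable_EFinP; apply: measurable_funM; first exact: measurable_ppow.
apply: measurableT_comp; first exact: measurable_ppow.
exact: measurable_funB.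
Qed.

Lemma ebeta_integrand_ge0 a b z (x : R) : 0 <= (ppow a x * ppow b (z - x))%:E.
Proof. by rewrite lee_fin mulr_ge0 ?ppow_ge0. Qed.

(** For positive [z], the substitution of [z x] for [x] pulls out [z^(a + b - 1)]; for [z <= 0] the
    supports do not meet. *)
Lemma ebetaE a b z : ebeta a b z = (ppow (a + b) z)%:E * ebeta a b 1.
Proof.
have [z0|z0] := leP z 0%R.
  rewrite ppow_eq0// mul0e /ebeta integral0_eq// => x _.
  have [x0|x0] := leP x 0%R; first by rewrite [ppow a x]ppow_eq0// mul0r.
  by rewrite [ppow b _]ppow_eq0 ?mulr0// subr_le0 (le_trans z0)// ltW.
rewrite [LHS](ge0_integral_affine 0 z0); last 2 first.
- exact: measurable_ebeta_integrand.
- exact: ebeta_integrand_ge0.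
transitivity (z%:E * ((z `^ (a - 1) * z `^ (b - 1))%:E * ebeta a b 1)).
  congr (_ * _).
  rewrite /ebeta -ge0_integralZl ?lee_fin ?mulr_ge0 ?powR_ge0//; last 2 first.
  - exact: measurable_ebeta_integrand.
  - by move=> x _; exact: ebeta_integrand_ge0.
  apply: eq_integral => x _; rewrite addr0 -EFinM; congr EFin.
  have -> : (z - z * x = z * (1 - x))%R by ring.
  by rewrite !ppowM//; ring.
rewrite muleA -EFinM; congr (_%:E * _); rewrite /ppow z0.
have zz : z != 0%R by rewrite gt_eqF.
rewrite -{1}[z](powRr1 (ltW z0)) -!powRD ?zz ?implybT//.
by congr powR; ring.
Qed.

(** Tonelli for [F]. With [x] fixed, a translation in [z] separates the two Gamma integrals; with
    [z] fixed, [exp (- z)] comes out and the homogeneity of the Beta convolution finishes. *)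
Lemma egamma_mul a b : egamma a * egamma b = egamma (a + b) * ebeta a b 1.
Proof.
pose F (z x : R) :=
  (ppow a x * expR (- x) * (ppow b (z - x) * expR (- (z - x))))%:E.
have F0 z x : 0 <= F z x by rewrite lee_fin !mulr_ge0 ?ppow_ge0 ?expR_ge0.
have mF : measurable_fun [set: R * R] (fun p => F p.1 p.2).
  have mBz : measurable_fun [set: R * R] (fun p => p.1 - p.2)%R.
    by apply: measurable_funB.
  apply/measurable_EFinP; apply: measurable_funM; apply: measurable_funM.
  - by apply: measurableT_comp => //; exact: measurable_ppow.
  - by do 2 apply: measurableT_comp => //.
  - by apply: measurableT_comp => //; exact: measurable_ppow.
  - by do 2 apply: measurableT_comp => //.
transitivity (\int[mu]_z \int[mu]_x F z x); last first.
  have B0 : 0 <= ebeta a b 1.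
    by apply: integral_ge0 => x _; exact: ebeta_integrand_ge0.
  rewrite /egamma muleC -ge0_integralZl//; last 2 first.
  - exact: measurable_gamma_integrand.
  - by move=> x _; exact: gamma_integrand_ge0.
  apply: eq_integral => z _.
  transitivity ((expR (- z))%:E * ebeta a b z).
    rewrite /ebeta -ge0_integralZl ?lee_fin ?expR_ge0//; last 2 first.
    - exact: measurable_ebeta_integrand.
    - by move=> x _; exact: ebeta_integrand_ge0.
    apply: eq_integral => x _; rewrite /F -EFinM; congr EFin.
    have -> : expR (- z) = (expR (- x) * expR (- (z - x)))%R.
      by rewrite -expRD; congr expR; ring.
    by ring.
  by rewrite ebetaE EFinM muleA [RHS]muleC; congr (_ * _); exact: muleC.
transitivity (\int[mu]_x \int[mu]_z F z x); last first.
  apply/esym.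
  apply: (@fubini_tonelli _ _ (measurableTypeR R) (measurableTypeR R) R _ _
    (fun p => F p.1 p.2)) => //; exact: mF.
transitivity (\int[mu]_x ((ppow a x * expR (- x))%:E * egamma b)).
  rewrite ge0_integralZr//; first exact: measurable_gamma_integrand.
  - by move=> x _; exact: gamma_integrand_ge0.
  - by apply: integral_ge0 => x _; exact: gamma_integrand_ge0.
apply: eq_integral => x _.
rewrite /egamma (ge0_integral_affine (- x) ltr01)//; last 2 first.
- exact: measurable_gamma_integrand.
- by move=> y; exact: gamma_integrand_ge0.
rewrite mul1e -ge0_integralZl ?gamma_integrand_ge0//.
- by apply: eq_integral => z _; rewrite mul1r -EFinM.
- exact: (measurableT_comp (measurable_gamma_integrand b)
    (measurable_affine 1 (- x))).
- by move=> y _; exact: gamma_integrand_ge0.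
Qed.

(** Only the window [[L, L + 1]] of the integral is kept; choosing [L] freely will give the growth
    of [Gamma]. *)
Lemma egamma_ge (a L c : R) : (0 <= L)%R -> (0 <= c)%R ->
  (forall x, L <= x <= L + 1 -> c <= ppow a x)%R ->
  (c * expR (- (L + 1)))%:E <= egamma a.
Proof.
move=> L0 c0 cx.
apply: (@le_trans _ _ (\int[mu]_(x in `[L, (L + 1)%R]) (c * expR (- (L + 1)))%:E)).
  rewrite integral_cst//= [X in _ <= _ * X](_ : _ = 1) ?mule1//.
  rewrite lebesgue_measure_itv/= lte_fin ltrDl ltr01.
  by rewrite -EFinB addrAC subrr add0r.
apply: (@le_trans _ _ (\int[mu]_(x in `[L, (L + 1)%R]) (ppow a x * expR (- x))%:E)).
  apply: ge0_le_integral => //.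
  - by move=> x _; rewrite lee_fin mulr_ge0 ?expR_ge0.
  - by apply: measurable_funTS; exact: measurable_gamma_integrand.
  - move=> x; rewrite /= in_itv/= => xL; rewrite lee_fin.
    apply: ler_pM; rewrite ?expR_ge0 ?cx// ler_expR lerN2.
    by case/andP: xL.
apply: ge0_subset_integral => //; first exact: measurable_gamma_integrand.
by move=> x _; exact: gamma_integrand_ge0.
Qed.

(** Monotone exhaustion by [[1 / (n + 1), 1]], where the primitive [x^a / a] bounds the integral by
    [1 / a]. *)
Lemma integral_powR01_lty (a : R) : (0 < a)%R ->
  \int[mu]_(x in `]0%R, 1%R]) (x `^ (a - 1))%:E < +oo.
Proof.
move=> a0.
pose F (n : nat) : set R := `[(n.+1%:R^-1)%R, 1%R]%classic.
have F0 n (x : R) : F n x -> (0 < x)%R.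
  by rewrite /F/= in_itv/= => /andP[h _]; rewrite (lt_le_trans _ h)// invr_gt0.
have UF : \bigcup_n F n = `]0%R, 1%R]%classic.
  apply/seteqP; split => [x [n _ Fnx]|x]/=; rewrite in_itv/=.
    by rewrite (F0 n)//; move: Fnx; rewrite /F/= in_itv/= => /andP[].
  move=> /andP[x0 x1]; exists (Num.truncn x^-1) => //.
  rewrite /F/= in_itv/= x1 andbT -[leRHS]invrK lef_pV2 ?posrE ?invr_gt0//.
  by rewrite ltW// truncnS_gt.
have mf : measurable_fun [set: R] (fun x : R => (x `^ (a - 1))%:E).
  by apply/measurable_EFinP; exact: measurable_powR.
have h : \int[mu]_(x in F n) (x `^ (a - 1))%:E @[n --> \oo] -->
    \int[mu]_(x in `]0%R, 1%R]) (x `^ (a - 1))%:E.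
  rewrite -UF; apply: ge0_nondecreasing_set_cvg_integral.
  - apply/nondecreasing_seqP => n; apply/subsetPset => x.
    rewrite /F/= !in_itv/= => /andP[h ->]; rewrite andbT (le_trans _ h)//.
    by rewrite lef_pV2 ?posrE// ler_nat.
  - by move=> n; exact: measurable_itv.
  - by move=> n; exact: measurable_funTS.
  - by move=> n x _; rewrite lee_fin powR_ge0.
suff : \int[mu]_(x in `]0%R, 1%R]) (x `^ (a - 1))%:E <= (a^-1)%:E.
  by move=> /le_lt_trans; apply; rewrite ltry.
apply: (cvge_to_le h); apply: nearW => n.
have : (n.+1%:R^-1 <= 1 :> R)%R by rewrite invf_le1// ler1n.
rewrite le_eqVlt => /predU1P[n1|n1].
  by rewrite /F n1 set_itv1 integral_set1 lee_fin invr_ge0 ltW.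
have n0 : (0 < n.+1%:R^-1 :> R)%R by rewrite invr_gt0.
have gd (x : R) : (0 < x)%R -> is_derive x (1%R : R) (a^-1 \*: (fun y : R => y `^ a))%R
    (x `^ (a - 1))%R.
  move=> x0; apply: is_derive_eq (is_deriveZ _ (is_derive_powR a x0)) _.
  by rewrite /GRing.scale/= mulrA mulVf ?gt_eqF// mul1r.
have gc (x : R) : (0 < x)%R -> {for x, continuous (a^-1 \*: (fun y : R => y `^ a))%R}.
  move=> x0; apply: differentiable_continuous; apply/derivable1_diffP.
  by have [] := gd x x0.
rewrite (@continuous_FTC2 _ (fun x => x `^ (a - 1))%R (a^-1 \*: (fun y : R => y `^ a))%R)//.
- rewrite -EFinB lee_fin /= powR1 /GRing.scale/= mulr1 gerBl mulr_ge0 ?powR_ge0//.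
  by rewrite invr_ge0 ltW.
- apply: derivable_within_continuous => x /[!in_itv]/= /andP[nx _].
  by have [] := is_derive_powR (a - 1) (lt_le_trans n0 nx).
- split.
  + move=> x /[!in_itv]/= /andP[nx _].
    by have [] := gd x (lt_trans n0 nx).
  + by apply: cvg_at_right_filter; exact: gc.
  + by apply: cvg_at_left_filter; exact: gc.
- move=> x /[!in_itv]/= /andP[nx _].
  have := gd x (lt_trans n0 nx) => ?.
  by rewrite derive1E derive_val.
Qed.

(** One half of the exponential absorbs the power, through the term of degree [n + 1] of its series;
    the other half is, up to a constant, the exponential density of rate [1 / 2]. *)
Lemma exp_half_bound (a : R) : exists2 C : R, (0 <= C)%R &
  forall x : R, (1 <= x)%R -> (x `^ (a - 1) * expR (- x) <= C * expR (- (2^-1 * x)))%R.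
Proof.
have [n an] : exists n : nat, (a - 1 <= n.+1%:R)%R.
  exists (Num.truncn (a - 1)); exact/ltW/truncnS_gt.
exists (2 ^+ n.+1 * n.+1`!%:R)%R; first by rewrite mulr_ge0 ?exprn_ge0.
move=> x x1; have x0 : (0 <= x)%R by rewrite (le_trans ler01).
have -> : (expR (- x) = expR (- (2^-1 * x)) * expR (- (2^-1 * x)))%R.
  by rewrite -expRD; congr expR; field.
rewrite mulrA ler_wpM2r ?expR_ge0//.
have hx : (0 <= 2^-1 * x)%R by rewrite mulr_ge0// invr_ge0.
have := expR_ge1Dxn n hx.
rewrite expRN ler_pdivrMr ?expR_gt0// => h.
apply: (@le_trans _ _ (x ^+ n.+1)%R).
  by rewrite -powR_mulrn// ler_powR.
have fn : (0 < n.+1`!%:R :> R)%R by rewrite ltr0n fact_gt0.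
have : ((2^-1 * x) ^+ n.+1 / n.+1`!%:R <= expR (2^-1 * x))%R.
  by apply: le_trans h; rewrite lerDr.
rewrite ler_pdivrMr// exprMn exprVn ler_pdivrMl ?exprn_gt0//.
by move=> /le_trans; apply; rewrite [(expR _ * _)%R]mulrC mulrA.
Qed.

(** The majorant is the power on []0, 1]] plus a multiple of the exponential density of rate
    [1 / 2]. *)
Lemma egamma_lty (a : R) : (0 < a)%R -> egamma a < +oo.
Proof.
move=> a0; have [C C0 Cx] := exp_half_bound a.
have h2 : (0 < 2^-1 :> R)%R by [].
pose f1 (x : R) := (((fun x => (x `^ (a - 1))) \_ `]0%R, 1%R]) x)%:E : \bar R.
pose f2 (x : R) := (2 * C)%:E * (exponential_pdf 2^-1 x)%:E.
have f10 x : 0 <= f1 x.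
  by rewrite lee_fin /patch; case: ifP => // _; rewrite powR_ge0.
have f20 x : 0 <= f2 x.
  by rewrite mule_ge0// lee_fin ?mulr_ge0// exponential_pdf_ge0// ltW.
have mf1 : measurable_fun [set: R] f1.
  apply/measurable_EFinP; apply/(measurable_restrictT _ _).1 => //.
  by apply: measurable_funTS; exact: measurable_powR.
have mf2 : measurable_fun [set: R] f2.
  apply: measurable_funeM; apply/measurable_EFinP.
  exact: measurable_exponential_pdf.
apply: (@le_lt_trans _ _ (\int[mu]_x (f1 x + f2 x))).
  apply: ge0_le_integral => //.
  - by move=> x _; exact: gamma_integrand_ge0.
  - exact: measurable_gamma_integrand.
  - exact: emeasurable_funD.
  - move=> x _; have [x0|x0] := leP x 0%R.
      by rewrite ppow_eq0// mul0r adde_ge0.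
    have [x1|x1] := leP x 1%R.
      apply: (@le_trans _ _ (f1 x)); last by rewrite leeDl.
      rewrite /f1 patchE mem_setE in_itv/= x0 x1/= lee_fin /ppow x0.
      by rewrite ger_pMr ?powR_gt0// -expR0 ler_expR oppr_le0 ltW.
    apply: (@le_trans _ _ (f2 x)); last by rewrite leeDr.
    rewrite /f2 -EFinM lee_fin /ppow x0 exponential_pdfE ?(ltW x0)// mulNr.
    apply: le_trans (Cx _ (ltW x1)) _.
    by rewrite le_eqVlt; apply/orP; left; apply/eqP; field.
rewrite ge0_integralD// lte_add_pinfty//.
  rewrite (_ : \int[mu]_x f1 x = \int[mu]_(x in `]0%R, 1%R]) (x `^ (a - 1))%:E).
    exact: integral_powR01_lty.
  by rewrite [RHS]integral_mkcond; apply: eq_integral => x _; rewrite /f1 restrict_EFin.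
rewrite /f2 ge0_integralZl//; last 3 first.
- by apply/measurable_EFinP; exact: measurable_exponential_pdf.
- by move=> x _; rewrite lee_fin exponential_pdf_ge0// ltW.
- by rewrite lee_fin mulr_ge0.
by rewrite integral_exponential_pdf// mule1 ltry.
Qed.

Lemma egamma_ge0 a : 0 <= egamma a.
Proof. by apply: integral_ge0 => x _; exact: gamma_integrand_ge0. Qed.

Lemma egamma_fineK (a : R) : (0 < a)%R -> (Gamma a)%:E = egamma a.
Proof.
by move=> a0; rewrite GammaE fineK// ge0_fin_numE ?egamma_ge0 ?egamma_lty.
Qed.

Lemma Gamma_gt0 (a : R) : (0 < a)%R -> (0 < Gamma a)%R.
Proof.
move=> a0; rewrite -lte_fin egamma_fineK//.
(* The window [[1, 2]], on which [x^(a - 1) >= x^(- 1) >= 1 / 2]. *)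
apply: (lt_le_trans _ (@egamma_ge a 1 (2^-1) ler01 _ _)).
- by rewrite lte_fin mulr_gt0// ?expR_gt0 ?invr_gt0.
- by rewrite invr_ge0.
- move=> x /andP[x1 x2]; rewrite /ppow (lt_le_trans ltr01 x1).
  apply: (@le_trans _ _ (x `^ (- 1))%R); last by rewrite ler_powR// lerBrDr addrC subrr ltW.
  by rewrite powR_inv1 ?(le_trans ler01)// lef_pV2 ?posrE// (lt_le_trans ltr01 x1).
Qed.

Lemma Gamma1 : Gamma (1 : R) = 1%R.
Proof.
apply: EFin_inj; rewrite egamma_fineK// -(@integral_exponential_pdf R 1 ltr01).
rewrite egammaE integral_itv_obnd_cbnd.
  rewrite integral_mkcond; apply: eq_integral => x _.
  rewrite /exponential_pdf !patchE; case: ifP => // _.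
  by rewrite subrr powRr0 !mul1r mulN1r.
apply/measurable_EFinP; apply: measurable_funTS; apply: measurable_funM.
  exact: measurable_powR.
exact: measurableT_comp.
Qed.

(* The kernel of the fractional integral of order [a]. *)
Definition fker (a x : R) : R := (ppow a x / Gamma a)%R.

(** The Beta integral, normalized: fractional kernels form a convolution semigroup. The value [B] at
    [1] is finite and nonzero because [Gamma a * Gamma b] is. *)
Lemma fker_conv (a b z : R) : (0 < a)%R -> (0 < b)%R ->
  \int[mu]_x (fker a x * fker b (z - x))%:E = (fker (a + b) z)%:E.
Proof.
move=> a0 b0; have ab0 : (0 < a + b)%R by rewrite addr_gt0.
have Ga := Gamma_gt0 a0; have Gb := Gamma_gt0 b0; have Gab := Gamma_gt0 ab0.
transitivity (((Gamma a)^-1 * (Gamma b)^-1)%:E * ebeta a b z).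
  rewrite /ebeta -ge0_integralZl ?lee_fin ?mulr_ge0 ?invr_ge0 ?(ltW Ga) ?(ltW Gb)//.
  - by apply: eq_integral => x _; rewrite -EFinM /fker; congr EFin; ring.
  - exact: measurable_ebeta_integrand.
  - by move=> x _; exact: ebeta_integrand_ge0.
have B0 : 0 <= ebeta a b 1.
  by apply: integral_ge0 => x _; exact: ebeta_integrand_ge0.
rewrite (ebetaE a b z); have := egamma_mul a b; rewrite -!egamma_fineK//.
case: (ebeta a b 1) B0 => [B| |]// _.
  rewrite -!EFinM => -[GB]; congr EFin; rewrite /fker.
  rewrite -invfM GB invfM.
  have [B0|B0] := eqVneq B 0%R.
    by have := mulr_gt0 Ga Gb; rewrite GB B0 mulr0 ltxx.
  by field; rewrite B0 gt_eqF.
by rewrite mulry gtr0_sg// mul1e.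
Qed.

Local Close Scope ereal_scope.

Lemma fker_ge0 (a x : R) : 0 < a -> 0 <= fker a x.
Proof. by move=> a0; rewrite divr_ge0 ?ppow_ge0// ltW// Gamma_gt0. Qed.

Lemma fker_eq0 (a x : R) : x <= 0 -> fker a x = 0.
Proof. by move=> x0; rewrite /fker ppow_eq0// mul0r. Qed.

Lemma fker1 (x : R) : 0 < x -> fker 1 x = 1.
Proof. by move=> x0; rewrite /fker /ppow x0 subrr powRr0 Gamma1 divr1. Qed.

Lemma measurable_fker (a : R) : measurable_fun [set: R] (fker a).
Proof. by apply: measurable_funM => //; exact: measurable_ppow. Qed.

Lemma fkerE (a x : R) : 0 < x -> fker a x = x `^ (a - 1) / Gamma a.
Proof. by move=> x0; rewrite /fker /ppow x0. Qed.

End gamma_function.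

#[local] Opaque Gamma fker.

(** * Series dominated by a geometric one *)

Section geometric_series.
Context {R : realType} {E : completeNormedModType R}.
Implicit Types (u : nat -> E).

Lemma series_geometric_cauchy u (K : R) m n :
  (forall i, `|u i| <= K * 2^-1 ^+ i) ->
  `|series u (n + m)%N - series u n| <= 2 * K * (2^-1 ^+ n - 2^-1 ^+ (n + m)).
Proof.
move=> uK; elim: m => [|m IH]; first by rewrite addn0 !subrr normr0 mulr0.
rewrite addnS /series/= big_nat_recr//= addrAC.
rewrite (le_trans (ler_normD _ _))//; apply: le_trans (lerD IH (uK _)) _.
by rewrite le_eqVlt; apply/orP; left; apply/eqP; rewrite exprS; field.
Qed.

Lemma series_geometric_le u (K : R) : (forall i, `|u i| <= K * 2^-1 ^+ i) ->
  cvg (series u @ \oo) /\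
  forall n, `|lim (series u @ \oo) - series u n| <= 2 * K * 2^-1 ^+ n.
Proof.
move=> uK.
have K0 : 0 <= K by have := uK 0%N; rewrite expr0 mulr1; exact: le_trans.
have bnd n m : (n <= m)%N -> `|series u m - series u n| <= 2 * K * 2^-1 ^+ n.
  move=> /subnKC <-; apply: le_trans (series_geometric_cauchy _ _ uK) _.
  by rewrite ler_wpM2l ?mulr_ge0// gerBl exprn_ge0// invr_ge0.
have cv : cvg (series u @ \oo).
  apply/cauchy_cvgP/cauchyP => e e0.
  have h : 2 * K * 2^-1 ^+ n @[n --> \oo] --> (0 : R).
    rewrite -[0](mulr0 (2 * K)); apply: cvgMr; apply: cvg_expr.
    by rewrite ger0_norm ?invr_ge0// invf_lt1// ltr1n.
  have /cvgrPdist_lt/(_ _ e0)[N _ NE] := h.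
  exists (series u N); suff : \forall m \near \oo, ball (series u N) e (series u m).
    by [].
  near=> m; rewrite -ball_normE /ball_/= distrC.
  apply: (le_lt_trans (bnd N m _)); first by near: m; exact: nbhs_infty_ge.
  have := NE N (leqnn N); rewrite sub0r normrN ger0_norm//.
  by rewrite !mulr_ge0// exprn_ge0// invr_ge0.
split=> // n.
have h : `|series u m - series u n| @[m --> \oo] --> `|lim (series u @ \oo) - series u n|.
  by apply: cvg_norm; apply: cvgB => //; exact: cvg_cst.
apply: (cvgr_to_le h); near=> m; apply: bnd.
by near: m; exact: nbhs_infty_ge.
Unshelve. all: by end_near. Qed.

End geometric_series.

(** * Growth of Gamma and estimates of the terms of the Mittag-Leffler kernel *)

Section fractional_kernel_bounds.
Context {R : realType}.

(** The factor [1 / 2] is for [a < 1], where the power decreases along the window: there [x <= 2 L],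
    and [2^(a - 1) >= 1 / 2]. *)
Lemma Gamma_geW (a L : R) : 0 < a -> 1 <= L ->
  L `^ (a - 1) * expR (- (L + 1)) / 2 <= Gamma a.
Proof.
move=> a0 L1; have L0 : 0 < L by exact: lt_le_trans L1.
have Lp := powR_ge0 L (a - 1).
rewrite mulrAC -lee_fin egamma_fineK//.
apply: egamma_ge; rewrite ?divr_ge0 ?(ltW L0)// => x /andP[Lx xL].
have x0 := lt_le_trans L0 Lx.
rewrite /ppow x0; have [a1|a1] := leP 1 a.
  apply: (@le_trans _ _ (L `^ (a - 1))); first by rewrite ler_pdivrMr//; lra.
  by rewrite ge0_ler_powR ?nnegrE ?(ltW L0) ?(ltW x0)// subr_ge0.
have x2L : x <= 2 * L by lra.
apply: (@le_trans _ _ ((2 * L) `^ (a - 1))); last first.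
  by apply: powR_nonincreasing => //; lra.
rewrite powRM// ?(ltW L0)// mulrC ler_wpM2r//.
rewrite -[2^-1]powR_inv1// ler_powR//; lra.
Qed.

(* The factor [(i + 1) (i + 2)] absorbs the constants in the first and second
   order increment estimates of the i-th term of the Mittag-Leffler kernel. *)
Lemma Gamma_growth (al b q : R) : 0 < al -> 0 < b -> 0 <= q ->
  exists2 M : R, 0 <= M & forall i,
    (i.+1 * i.+2)%:R * q ^+ i / Gamma (al * i%:R + b) <= M * 2^-1 ^+ i.
Proof.
(* With this [L] one has [L^(al i) = 8^i (1 + q)^i], whereas the numerator is at most
   [2 4^i (1 + q)^i]; the quotient decays like [2^(- i)]. *)
move=> al0 b0 q0; pose L := (8 * (1 + q)) `^ al^-1.
have q1 : 0 < 1 + q by rewrite ltr_wpDr.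
have La : L `^ al = 8 * (1 + q).
  by rewrite /L -powRrM mulVf ?gt_eqF// powRr1// mulr_ge0// ltW.
have L1 : 1 <= L.
  rewrite -(@powRr0 _ (8 * (1 + q))) /L ler_powR ?invr_ge0 ?(ltW al0)//.
  by lra.
have L0 : 0 < L by exact: lt_le_trans L1.
exists (4 * expR (L + 1) * L `^ (1 - b)) => [|i].
  by rewrite !mulr_ge0 ?expR_ge0 ?powR_ge0.
have ab0 : 0 < al * i%:R + b by rewrite ltr_wpDl// mulr_ge0// ltW.
have G := Gamma_geW ab0 L1.
have G0 := Gamma_gt0 ab0.
have e4 : (i.+1 * i.+2)%:R <= 2 * 4 ^+ i :> R.
  rewrite -natrX -natrM ler_nat; elim: (i) => // k IH.
  rewrite expnS; have : (k.+2 * k.+3 <= 4 * (k.+1 * k.+2))%N.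
    rewrite [(k.+1 * _)%N]mulnC mulnCA leq_mul2l/= -[in leqLHS]addn2.
    by rewrite (mulnDl 1 3) mul1n leq_add2l (@leq_trans (3 * 1))// leq_mul.
  by move=> /leq_trans; apply; rewrite [leqRHS]mulnCA leq_mul2l IH orbT.
rewrite ler_pdivrMr//.
apply: (@le_trans _ _ (2 * 4 ^+ i * (1 + q) ^+ i)).
  rewrite ler_pM ?exprn_ge0//.
  by rewrite lerXn2r ?nnegrE ?(ltW q1)// lerDr.
apply: le_trans (ler_wpM2l _ G); last first.
  by rewrite !mulr_ge0 ?expR_ge0 ?powR_ge0 ?exprn_ge0// invr_ge0.
have -> : L `^ (al * i%:R + b - 1) = (8 * (1 + q)) ^+ i * L `^ (b - 1).
  have -> : al * i%:R + b - 1 = al * i%:R + (b - 1) by rewrite addrA.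
  have Ln0 : L != 0 by rewrite gt_eqF.
  rewrite (@powRD _ L (al * i%:R) (b - 1)) ?Ln0 ?implybT//.
  by rewrite (powRrM L al) La powR_mulrn// mulr_ge0// ltW.
have -> : L `^ (1 - b) = (L `^ (b - 1))^-1 by rewrite -powRN opprB.
have Lb : L `^ (b - 1) != 0 by rewrite gt_eqF// powR_gt0.
rewrite expRN le_eqVlt; apply/orP; left; apply/eqP.
have -> : (8 : R) = 2 * 4 by rewrite -natrM.
rewrite !exprMn exprVn.
by field; rewrite Lb !gt_eqF ?expR_gt0 ?exprn_gt0.
Qed.

Variables (al T : R).
Hypotheses (al0 : 0 < al) (al1 : al < 1) (T0 : 0 < T).

Let a : R := 1 - al.

Definition mlterm (i : nat) (x : R) : R := fker (al * i%:R + al) x.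

(** One constant for three estimates: [(i + 1) (i + 2)] bounds the factors brought down by two
    derivatives, [T^(al i)] the surplus power of [x], and [1 / a] makes up for the factor [a] in the
    derivative of the comparison function [x^(- a)]. *)
Definition mlcst (i : nat) : R :=
  (i.+1 * i.+2)%:R * (T `^ al) ^+ i / Gamma (al * i%:R + al) / a.

Let a0 : 0 < a. Proof. by rewrite subr_gt0. Qed.

Let ali i : 0 < al * i%:R + al.
Proof. by rewrite ltr_wpDl// mulr_ge0// ltW. Qed.

Lemma mlcst_ge0 i : 0 <= mlcst i.
Proof.
have := Gamma_gt0 (ali i) => G.
by rewrite /mlcst !mulr_ge0 ?invr_ge0 ?exprn_ge0 ?powR_ge0 ?(ltW G)// ltW.
Qed.

(** The exponent is [p = al i - a]. Derivatives of [x^p] and of a multiple of [x^(- a)] are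
    compared, using [|p| <= i + 1], [|p - 1| <= i + 2] and [x^(al i) <= T^(al i)]. *)
Lemma mlterm_bounds i :
  [/\ forall x : R, 0 < x -> x <= T -> `|mlterm i x| <= mlcst i * x `^ (- a),
      forall x y : R, 0 < x -> x <= y -> y <= T ->
        `|mlterm i x - mlterm i y| <= mlcst i * (x `^ (- a) - y `^ (- a)) &
      forall x y h : R, 0 < x -> x <= y -> 0 <= h -> y + h <= T ->
        `|(mlterm i x - mlterm i (x + h)) - (mlterm i y - mlterm i (y + h))| <=
        mlcst i * (shift_gap a h x - shift_gap a h y)].
Proof.
have G0 := Gamma_gt0 (ali i).
set G := Gamma (al * i%:R + al) in G0 *.
set p := al * i%:R - a.
have tE (x : R) : 0 < x -> mlterm i x = G^-1 * x `^ p.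
  by move=> x0; rewrite /mlterm fkerE// mulrC; congr (_ * _ `^ _);
    rewrite /p /a; ring.
have i0 : 0 <= i%:R :> R by [].
have ai : al * i%:R <= i%:R by rewrite ler_piMl// ltW.
have ai0 : 0 <= al * i%:R by rewrite mulr_ge0// ltW.
have a1 : a < 1 by rewrite /a; move: al0; lra.
have p1 : `|p| <= i%:R + 1.
  by rewrite ler_norml /p; apply/andP; split; move: a0 a1 ai ai0; lra.
have p2 : `|p - 1| <= i%:R + 2.
  by rewrite ler_norml /p; apply/andP; split; move: a0 a1 ai ai0; lra.
have xp (x q : R) : 0 < x -> x <= T -> x `^ (al * i%:R + q) <= (T `^ al) ^+ i * x `^ q.
  move=> x0 xT; rewrite powRD ?(gt_eqF x0) ?implybT// ler_wpM2r ?powR_ge0//.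
  rewrite -powR_mulrn ?powR_ge0// -powRrM.
  by rewrite ge0_ler_powR ?nnegrE ?(ltW x0) ?(ltW T0).
have Gi0 : 0 <= G^-1 by rewrite invr_ge0 ltW.
have k0 : 0 <= (T `^ al) ^+ i by rewrite exprn_ge0// powR_ge0.
have nE : (i.+1 * i.+2)%:R = (i%:R + 1) * (i%:R + 2) :> R.
  by rewrite natrM -!natr1; ring.
have cE : mlcst i = G^-1 * ((i%:R + 1) * (i%:R + 2) * (T `^ al) ^+ i / a).
  by rewrite /mlcst nE -/G; ring.
have n1 : 1 <= (i%:R + 1) * (i%:R + 2) / a.
  rewrite ler_pdivlMr// mul1r (le_trans (ltW a1))//.
  by rewrite -[leLHS]mulr1 ler_pM//; move: i0; lra.
split.
- move=> x x0 xT; rewrite tE// normrM (ger0_norm Gi0) ger0_norm ?powR_ge0//.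
  rewrite cE -[leRHS]mulrA ler_wpM2l//; apply: le_trans (xp x (- a) x0 xT) _.
  rewrite ler_wpM2r ?powR_ge0// mulrAC -[leLHS]mul1r.
  by rewrite ler_wpM2r.
- move=> x y x0 xy yT; have y0 := lt_le_trans x0 xy.
  rewrite !tE// -mulrBr normrM (ger0_norm Gi0) cE -[leRHS]mulrA ler_wpM2l//.
  rewrite mulrBr; set k := _ / a.
  apply: (@dominated_increment _ (fun r => r `^ p) (fun r => p * r `^ (p - 1))
    (k \*: (fun r => r `^ (- a))) (fun r => k * (- a * r `^ (- a - 1))) x y xy).
  + move=> r /andP[xr _]; apply: is_derive_powR; exact: lt_le_trans xr.
  + move=> r /andP[xr _].
    exact: (is_deriveZ k (is_derive_powR (- a) (lt_le_trans x0 xr))).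
  + move=> r /andP[xr ry]; have r0 := lt_le_trans x0 xr.
    rewrite normrM [`|_ `^ _|]ger0_norm ?powR_ge0//.
    have -> : - (k * (- a * r `^ (- a - 1))) =
        (i%:R + 1) * ((i%:R + 2) * ((T `^ al) ^+ i * r `^ (- a - 1))).
      by rewrite /k; field; rewrite gt_eqF.
    rewrite ler_pM// ?powR_ge0//.
    apply: (@le_trans _ _ ((T `^ al) ^+ i * r `^ (- a - 1))).
      by rewrite /p -addrA; apply: xp => //; exact: le_trans yT.
    by rewrite ler_peMl ?mulr_ge0 ?powR_ge0//; move: i0; lra.
- move=> x y h x0 xy h0 yhT; have y0 := lt_le_trans x0 xy.
  have xh0 : 0 < x + h by rewrite ltr_wpDr.
  have yh0 : 0 < y + h by rewrite ltr_wpDr.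
  rewrite !tE// -!mulrBr normrM (ger0_norm Gi0) cE -[leRHS]mulrA ler_wpM2l//.
  set k := _ / a; rewrite /shift_gap !mulrBr.
  apply: (@dominated_increment2 _ (fun r => r `^ p) (fun r => p * r `^ (p - 1))
    (fun r => p * ((p - 1) * r `^ (p - 1 - 1)))
    (k \*: (fun r => r `^ (- a))) (k \*: (fun r => - a * r `^ (- a - 1)))
    (fun r => k * (- a * ((- a - 1) * r `^ (- a - 1 - 1)))) x y h xy h0).
  + move=> r /andP[xr _]; apply: is_derive_powR; exact: lt_le_trans xr.
  + move=> r /andP[xr _].
    exact: (is_deriveZ p (is_derive_powR (p - 1) (lt_le_trans x0 xr))).
  + move=> r /andP[xr _].
    exact: (is_deriveZ k (is_derive_powR (- a) (lt_le_trans x0 xr))).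
  + move=> r /andP[xr _]; apply: (is_deriveZ k).
    exact: (is_deriveZ (- a) (is_derive_powR (- a - 1) (lt_le_trans x0 xr))).
  + move=> r /andP[xr ry]; have r0 := lt_le_trans x0 xr.
    rewrite !normrM [`|_ `^ _|]ger0_norm ?powR_ge0//.
    have -> : k * (- a * ((- a - 1) * r `^ (- a - 1 - 1))) =
        (i%:R + 1) * ((i%:R + 2) * ((a + 1) * ((T `^ al) ^+ i * r `^ (- a - 1 - 1)))).
      by rewrite /k; field; rewrite gt_eqF.
    rewrite ler_pM ?mulr_ge0 ?powR_ge0// ler_pM ?powR_ge0//.
    apply: (@le_trans _ _ ((T `^ al) ^+ i * r `^ (- a - 1 - 1))).
      have -> : p - 1 - 1 = al * i%:R + (- a - 1 - 1) by rewrite /p; ring.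
      by apply: xp => //; exact: le_trans yhT.
    by rewrite ler_peMl ?mulr_ge0 ?powR_ge0//; move: a0; lra.
Qed.

Lemma mlcst_growth (q : R) : 0 <= q ->
  exists2 M : R, 0 <= M & forall i, mlcst i * q ^+ i <= M * 2^-1 ^+ i.
Proof.
move=> q0; have Tq0 : 0 <= T `^ al * q by rewrite mulr_ge0 ?powR_ge0.
have [M M0 MG] := Gamma_growth al0 al0 Tq0.
exists (M / a) => [|i]; first by rewrite divr_ge0// ltW.
have -> : mlcst i * q ^+ i =
    (i.+1 * i.+2)%:R * (T `^ al * q) ^+ i / Gamma (al * i%:R + al) / a.
  by rewrite /mlcst exprMn; ring.
by rewrite [leRHS]mulrAC ler_wpM2r ?invr_ge0 ?(ltW a0).
Qed.

End fractional_kernel_bounds.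

(** * The operator-valued Mittag-Leffler kernel *)

Section mittag_leffler_kernel.
Context {R : realType} {H : completeNormedModType R}.
Variables (al T : R).
Hypotheses (al0 : 0 < al) (al1 : al < 1) (T0 : 0 < T).
Let a : R := 1 - al.

Definition mlker (A : bop H) (x : R) : bop H :=
  x `^ (al - 1) *: mittag_leffler al al A (x `^ al).

Definition mlpart (A : bop H) (n : nat) (x : R) : bop H :=
  series (fun i => mlterm al i x *: bpow A i) n.

Lemma ML_kernelE A t r : ML_kernel al A t r = mlker A (t - r).
Proof. by []. Qed.

(** To be used with [s] the scalar terms, their increments or their second differences, and [Z] the
    corresponding quantity for [x^(- a)]. *)
Lemma opseries_le (A : bop H) (M Z : R) (s : nat -> R) :
  (forall i, mlcst al T i * `|A| ^+ i <= M * 2^-1 ^+ i) -> 0 <= Z ->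
  (forall i, `|s i| <= mlcst al T i * Z) ->
  cvg (series (fun i => s i *: bpow A i) @ \oo) /\
  forall n, `|lim (series (fun i => s i *: bpow A i) @ \oo) -
     series (fun i => s i *: bpow A i) n| <= 2 * M * 2^-1 ^+ n * Z.
Proof.
move=> MA Z0 sZ.
have [|cv h] := @series_geometric_le R (bop H) (fun i => s i *: bpow A i) (M * Z).
  move=> i; rewrite normrZ.
  apply: le_trans (ler_pM _ _ (sZ i) (norm_bpow A i)) _ => //.
  by rewrite mulrAC [leRHS]mulrAC ler_wpM2r.
split=> // n; apply: le_trans (h n) _.
by rewrite le_eqVlt; apply/orP; left; apply/eqP; ring.
Qed.

(** Once [x^(al - 1)] is taken into the series, its scalar coefficients are fractional kernels, for
    which estimates near [0] are at hand. *)
Lemma mlker_lim A (x : R) : 0 < x -> x <= T ->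
  mlker A x = lim (series (fun i => mlterm al i x *: bpow A i) @ \oo).
Proof.
move=> x0 xT; have [M M0 MA] := mlcst_growth T al0 al1 (normr_ge0 A).
have tb i : `|mlterm al i x| <= mlcst al T i * x `^ (- a).
  by have [h _ _] := mlterm_bounds al0 al1 T0 i; exact: h.
have [cv _] := opseries_le MA (powR_ge0 x (- a)) tb.
set L := lim _ in cv *.
rewrite /mlker /mittag_leffler; pose u i := ((x `^ al) ^+ i / Gamma (al * i%:R + al)) *: bpow A i.
have xa : x `^ (al - 1) * x `^ a = 1.
  rewrite -powRD ?(gt_eqF x0) ?implybT// /a.
  have -> : al - 1 + (1 - al) = 0 by ring.
  by rewrite powRr0.
have uE : series u = fun n => x `^ a *: series (fun i => mlterm al i x *: bpow A i) n.
  apply/funext => n; rewrite /series/= scaler_sumr; apply: eq_bigr => i _.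
  rewrite scalerA; congr (_ *: _); rewrite /mlterm fkerE// mulrA.
  congr (_ / _); rewrite -powR_mulrn ?powR_ge0// -powRrM -powRD; last first.
    by rewrite (gt_eqF x0) implybT.
  by congr (_ `^ _); rewrite /a; ring.
have -> : lim (series u @ \oo) = x `^ a *: L.
  by apply/cvg_lim => //; rewrite uE; apply: cvgZr.
by rewrite scalerA xa scale1r.
Qed.

(* Stated for operators, so that one set of estimates serves for the action on
   vectors and for the compositions on the left and on the right. *)
Record kernel_estimates (C : R) (g : R -> bop H) : Prop := KernelEstimates {
  ke_le : forall x : R, 0 < x -> x <= T -> `|g x| <= C * x `^ (- a) ;
  ke_incr : forall x y : R, 0 < x -> x <= y -> y <= T ->
    `|g x - g y| <= C * (x `^ (- a) - y `^ (- a)) ;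
  ke_incr2 : forall x y h : R, 0 < x -> x <= y -> 0 <= h -> y + h <= T ->
    `|(g x - g (x + h)) - (g y - g (y + h))| <=
    C * (shift_gap a h x - shift_gap a h y) }.

Lemma volterra_kernel_estimates (E : completeNormedModType R)
    (act : bop H -> E -> E) (C : R) (g : R -> bop H) :
  (forall B, {morph act B : u v / u - v}) ->
  (forall u, {morph act^~ u : B B' / B - B'}) ->
  (forall B u, `|act B u| <= `|B| * `|u|) ->
  kernel_estimates C g -> volterra_kernel T a C (fun x => act (g x)).
Proof.
move=> actB actBl act_le [g1 g2 g3]; split.
- by move=> x; exact: actB.
- move=> x u x0 xT; apply: le_trans (act_le _ _) _.
  by rewrite ler_wpM2r// g1.
- move=> x y u x0 xy yT; rewrite -actBl; apply: le_trans (act_le _ _) _.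
  by rewrite ler_wpM2r// g2.
- move=> x y h u x0 xy h0 yh; rewrite -!actBl; apply: le_trans (act_le _ _) _.
  by rewrite ler_wpM2r// g3.
Qed.

(** The index [n] serves twice: [n = 0] gives the kernel itself, and [n] tending to infinity lets
    identities pass from the partial sums to the kernel. *)
Lemma mlker_estimates A : exists2 M : R, 0 <= M &
  forall n, kernel_estimates (2 * M * 2^-1 ^+ n) (fun x => mlker A x - mlpart A n x).
Proof.
have [M M0 MA] := mlcst_growth T al0 al1 (normr_ge0 A); exists M => // n.
have hb := mlterm_bounds al0 al1 T0.
pose S (s : nat -> R) := series (fun i => s i *: bpow A i).
have SB s1 s2 : S (fun i => s1 i - s2 i) = S s1 - S s2.
  rewrite /S; apply/funext => k; rewrite !fctE /series/= -sumrB.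
  by apply: eq_bigr => i _; rewrite scalerBl.
have mlE (x : R) : mlpart A n x = S (mlterm al ^~ x) n by [].
have cvgS (x : R) : 0 < x -> x <= T ->
    S (mlterm al ^~ x) @ \oo --> mlker A x.
  move=> x0 xT; rewrite mlker_lim//.
  have tb i : `|mlterm al i x| <= mlcst al T i * x `^ (- a).
    by have [h _ _] := hb i; exact: h.
  by have [] := opseries_le MA (powR_ge0 x (- a)) tb.
have key s L (Z : R) : 0 <= Z -> (forall i, `|s i| <= mlcst al T i * Z) ->
    S s @ \oo --> L -> `|L - S s n| <= 2 * M * 2^-1 ^+ n * Z.
  move=> Z0 sZ sL; have [_ /(_ n)] := opseries_le MA Z0 sZ.
  by rewrite (cvg_lim _ sL).
have phi0 (x y : R) : 0 < x -> x <= y -> 0 <= x `^ (- a) - y `^ (- a).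
  by move=> x0 xy; rewrite subr_ge0 powR_nonincreasing// oppr_le0 subr_ge0 ltW.
split.
- move=> x x0 xT; apply: key (cvgS x x0 xT); first exact: powR_ge0.
  by move=> i; have [h _ _] := hb i; exact: h.
- move=> x y x0 xy yT.
  have xT := le_trans xy yT; have y0 := lt_le_trans x0 xy.
  have -> : mlker A x - mlpart A n x - (mlker A y - mlpart A n y) =
     (mlker A x - mlker A y) - S (fun i => mlterm al i x - mlterm al i y) n.
    by rewrite SB !fctE !mlE; zmodule.
  apply: key; first exact: phi0.
  + by move=> i; have [_ h _] := hb i; exact: h.
  + by rewrite SB; apply: cvgB; exact: cvgS.
- move=> x y h x0 xy h0 yhT.
  have y0 := lt_le_trans x0 xy.
  have xh0 : 0 < x + h by rewrite ltr_wpDr.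
  have yh0 : 0 < y + h by rewrite ltr_wpDr.
  have xhT : x + h <= T by apply: le_trans yhT; rewrite lerD2r.
  have xT : x <= T by apply: le_trans xhT; rewrite lerDl.
  have yT : y <= T by apply: le_trans yhT; rewrite lerDl.
  pose s i := (mlterm al i x - mlterm al i (x + h)) -
    (mlterm al i y - mlterm al i (y + h)).
  have SE : S s = (S (mlterm al ^~ x) - S (mlterm al ^~ (x + h))) -
     (S (mlterm al ^~ y) - S (mlterm al ^~ (y + h))).
    by rewrite /s SB !SB.
  have -> : mlker A x - mlpart A n x - (mlker A (x + h) - mlpart A n (x + h)) -
    (mlker A y - mlpart A n y - (mlker A (y + h) - mlpart A n (y + h))) =
    ((mlker A x - mlker A (x + h)) - (mlker A y - mlker A (y + h))) - S s n.
    by rewrite SE !fctE !mlE; zmodule.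
  apply: key.
  (* Monotonicity of [shift_gap a h] is read off the first half of its profile, taken with [eta = 0]
     and the auxiliary exponent [a + 1]. *)
  + move: h0; rewrite le_eqVlt => /predU1P[<-|h0].
      by rewrite /shift_gap !addr0 !subrr.
    have a0 : 0 < a by rewrite subr_gt0.
    have a1 : a < 1 by rewrite gtrBl.
    have a01 : a + 0 < a + 1 by rewrite ltrD2l.
    by have [] := @profile_shift_gap R y a (a + 1) 0 h a0 a1 (lexx _) ler01 a01
      h0 x y x0 xy (lexx _).
  + by move=> i; have [_ _ hi] := hb i; exact: hi.
  + by rewrite SE; apply: cvgB; apply: cvgB; exact: cvgS.
Qed.

End mittag_leffler_kernel.

(** * Uniform grids *)

Section uniform_grid.
Context {R : realType}.
Variables (dl : R).
Hypothesis dl0 : 0 < dl.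

Let u (j : nat) : R := j%:R * dl.

Definition grid (n : nat) : seq R := mkseq (fun j => j.+1%:R * dl) n.

Lemma gridS n : grid n.+1 = grid n ++ [:: n.+1%:R * dl].
Proof. by rewrite /grid mkseqS cats1. Qed.

Lemma grid_last n : last 0 (grid n) = u n.
Proof.
by case: n => [|n]; rewrite /u ?mul0r// gridS last_cat.
Qed.

Lemma grid_path n x : u n < x -> path <%R 0 (grid n ++ [:: x]).
Proof.
elim: n x => [|n IH] x; first by rewrite /u mul0r /= andbT.
move=> nx; rewrite gridS cat_path /= last_cat/= nx andbT.
by rewrite IH// /u ltr_pM2r// ltr_nat.
Qed.

Lemma grid_partition n : itv_partition 0 (u n) (grid n).
Proof.
split; last by rewrite grid_last.
by case: n => // n; rewrite gridS grid_path// /u ltr_pM2r// ltr_nat.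
Qed.

Lemma grid_partition_at n x : u n < x -> itv_partition 0 x (grid n ++ [:: x]).
Proof. by move=> nx; split; [exact: grid_path|rewrite last_cat]. Qed.

Lemma grid_mesh_at n x : u n < x -> x <= u n.+1 -> mesh 0 (grid n ++ [:: x]) <= dl.
Proof.
have m1 (b c : R) : mesh b [:: c] = Num.max (c - b) 0.
  by rewrite /mesh /subintervals/= big_cons big_nil.
have uS m : u m.+1 = u m + dl by rewrite /u -natr1 mulrDl mul1r.
elim: n x => [|n IH] x nx xn.
  rewrite cat0s m1 ge_max (ltW dl0) andbT subr0 (le_trans xn)//.
  by rewrite uS /u mul0r add0r.
rewrite mesh_cat grid_last ge_max m1 ge_max (ltW dl0) andbT.
apply/andP; split.
  rewrite gridS; apply: (IH (u n.+1)); last exact: lexx.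
  by rewrite uS ltrDl.
by move: xn; rewrite !uS; move: (u n) => v; lra.
Qed.

Lemma grid_mesh n : mesh 0 (grid n) <= dl.
Proof.
case: n => [|n]; first by rewrite /mesh /subintervals/= big_nil ltW.
by rewrite gridS grid_mesh_at// /u ltr_pM2r// ltr_nat.
Qed.

Lemma ksum_grid (E : normedModType R) (k : R -> E -> E) (w : R -> E) n :
  ksum k w 0 (grid n) = \sum_(j < n) k (u j) (w (u j.+1) - w (u j)).
Proof.
elim: n => [|n IH]; first by rewrite ksum_nil big_ord0.
rewrite gridS ksum_cat IH grid_last ksum_cons ksum_nil addr0.
by rewrite big_ord_recr.
Qed.

Lemma grid_cell n x : 0 < x -> x <= u n ->
  exists2 k, (k < n)%N & u k < x <= u k.+1.
Proof.
move=> x0; elim: n => [|n IH] xn.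
  by move: xn; rewrite /u mul0r leNgt x0.
have [xn'|nx] := leP x (u n); last by exists n; rewrite ?nx.
by have [k kn xk] := IH xn'; exists k => //; exact: ltnW.
Qed.

End uniform_grid.

(** * Convolution integrals and tools for fractional integration *)

Section fractional_integral_of_young_integral.
Context {R : realType}.
Local Notation mu := (@lebesgue_measure R).

Lemma fker_conv_at (a b t u : R) : 0 < a -> 0 < b ->
  (\int[mu]_s (fker a (t - s) * fker b (s - u))%:E = (fker (a + b) (t - u))%:E)%E.
Proof.
move=> a0 b0; have -> : fker (a + b) (t - u) = fker (b + a) (t - u).
  by rewrite [a + b]addrC.
rewrite -(fker_conv (t - u) b0 a0) (ge0_integral_affine u ltr01).
- rewrite mul1e; apply: eq_integral => x _; congr EFin.
  by rewrite [LHS]mulrC; congr (fker _ _ * fker _ _); ring.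
- apply/measurable_EFinP; apply: measurable_funM.
    apply: measurableT_comp; first exact: measurable_fker.
    exact: measurable_funB.
  apply: measurableT_comp; first exact: measurable_fker.
  exact: measurable_funB.
- by move=> x; rewrite lee_fin mulr_ge0 ?fker_ge0.
Qed.

Lemma integrable_fker_conv (a b t u : R) : 0 < a -> 0 < b ->
  mu.-integrable [set: R] (fun s => (fker a (t - s) * fker b (s - u))%:E).
Proof.
move=> a0 b0; apply/integrableP; split.
  apply/measurable_EFinP; apply: measurable_funM.
    apply: measurableT_comp; first exact: measurable_fker.
    exact: measurable_funB.
  apply: measurableT_comp; first exact: measurable_fker.
  exact: measurable_funB.
apply: (@le_lt_trans _ _ (fker (a + b) (t - u))%:E); last exact: ltry.
rewrite -(fker_conv_at t u a0 b0); rewrite le_eqVlt; apply/orP; left; apply/eqP.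
apply: eq_integral => x _.
by rewrite gee0_abs// lee_fin mulr_ge0 ?fker_ge0.
Qed.

Lemma Rintegral_fker_conv (a b t u : R) : 0 < a -> 0 < b ->
  \int[mu]_s (fker a (t - s) * fker b (s - u)) = fker (a + b) (t - u).
Proof. by move=> a0 b0; rewrite /Rintegral fker_conv_at. Qed.

(** Comparison with the integral of [r^(al - 1)]: each term is at most the increment of [r^al / al]
    over the preceding unit interval, the integrand being nonincreasing. *)
Lemma sum_powR_le (al : R) n : 0 < al -> al <= 1 ->
  \sum_(m < n) m.+1%:R `^ (al - 1) <= n%:R `^ al / al.
Proof.
move=> al0 al1; elim: n => [|n IH].
  by rewrite big_ord0 divr_ge0 ?powR_ge0// ltW.
rewrite big_ord_recr/=; apply: le_trans (lerD IH (lexx _)) _.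
rewrite -lerBrDl -mulrBl ler_pdivlMr//.
have n1 : 0 < n.+1%:R :> R by [].
have [->|n0] := eqVneq n 0%N.
  by rewrite powR0 ?gt_eqF// subr0 !powR1 mul1r.
have n0' : 0 < n%:R :> R by rewrite ltr0n lt0n.
pose k := n.+1%:R `^ (al - 1) * al.
have nn : n%:R <= n.+1%:R :> R by rewrite ler_nat.
pose F : R -> R := (fun r => r `^ al) - (k \*: id).
have : F n%:R <= F n.+1%:R.
  apply: (@le_of_derive R F (fun r => al * r `^ (al - 1) - k *: 1) _ _ nn) =>
    r /andP[nr rn]; have r0 := lt_le_trans n0' nr.
    by apply: is_deriveB; exact: is_derive_powR.
  rewrite /GRing.scale/= mulr1 subr_ge0 /k mulrC ler_wpM2l ?(ltW al0)//.
  by apply: powR_nonincreasing => //; rewrite subr_le0.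
change (n%:R `^ al - k * n%:R <= n.+1%:R `^ al - k * n.+1%:R -> k <= n.+1%:R `^ al - n%:R `^ al).
have -> : k * n.+1%:R = k * n%:R + k by rewrite -natr1 mulrDr mulr1.
clear F; clearbody k; move: (n.+1%:R `^ al) (n%:R `^ al) (k * n%:R) => p q v.
lra.
Qed.

Lemma integrable_Rintegral_sum (F : nat -> R -> R) n :
  (forall j, mu.-integrable [set: R] (EFin \o F j)) ->
  mu.-integrable [set: R] (EFin \o (fun s => \sum_(j < n) F j s)) /\
  \int[mu]_s (\sum_(j < n) F j s) = \sum_(j < n) \int[mu]_s F j s.
Proof.
move=> Fi; elim: n => [|n [IH1 IH2]].
  have -> : (fun s => \sum_(j < 0) F j s) = cst 0.
    by apply/funext => s; rewrite big_ord0.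
  by rewrite big_ord0 Rintegral_cst// mul0r; split=> //; exact: integrable0.
have -> : (fun s => \sum_(j < n.+1) F j s) = (fun s => \sum_(j < n) F j s + F n s).
  by apply/funext => s; rewrite big_ord_recr.
split; first exact: integrableD IH1 (Fi n).
by rewrite RintegralD// big_ord_recr/= -IH2.
Qed.

(** A retraction onto [[0, T]]. Composed with it, a path that is Hölder on [[0, T]] becomes Hölder
    on the line, and its bounds carry no domain conditions. *)
Definition clamp (T r : R) : R := Num.max 0 (Num.min r T).

Lemma clamp_lipschitz (T r s : R) : `|clamp T r - clamp T s| <= `|r - s|.
Proof.
rewrite /clamp; have := ler_norm (r - s); have := ler_norm (s - r).
rewrite (distrC s r) => h1 h2; rewrite /Num.max /Num.min.
by case: (ltP r T) => rT; case: (ltP s T) => sT;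
  repeat (case: ifPn; rewrite -?leNgt => ?); rewrite ler_norml;
  apply/andP; split; lra.
Qed.

Lemma holder_measurable (T k M : R) (f : R -> R) : 0 <= T -> 0 < k ->
  (forall r s : R, 0 <= r -> r <= T -> 0 <= s -> s <= T ->
    `|f r - f s| <= M * `|r - s| `^ k) ->
  measurable_fun `[0, T] f.
Proof.
move=> T0 k0 fM.
pose cl (r : R) := clamp T r.
have cl0 r : 0 <= cl r by rewrite /cl /clamp le_max lexx.
have clT r : cl r <= T by rewrite /cl /clamp ge_max T0 ge_min lexx orbT.
have clL r s : `|cl r - cl s| <= `|r - s| by exact: clamp_lipschitz.
have fc : continuous (f \o cl).
  move=> r; apply/cvgrPdist_le => e e0.
  have [d d0 de] := small_powR k0 (normr_ge0 M) e0.
  suff : \forall s \near r, `|f (cl r) - f (cl s)| <= e by [].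
  exists d => //= s; rewrite /ball_/= => rs.
  apply: le_trans (fM _ _ _ _ _ _) _ => //.
  apply: le_trans (ltW de); apply: le_trans (ler_wpM2r (powR_ge0 _ _) (ler_norm M)) _.
  rewrite ler_wpM2l//.
  rewrite ge0_ler_powR ?nnegrE ?(ltW k0) ?(ltW d0)//.
  exact: le_trans (clL _ _) (ltW rs).
apply: (@eq_measurable_fun _ _ _ _ _ (f \o cl)).
  move=> r; rewrite inE/= in_itv/= => /andP[r0 rT]; congr f.
  by rewrite /cl /clamp min_l// max_r.
by apply: measurable_funTS; exact: continuous_measurable_fun.
Qed.

End fractional_integral_of_young_integral.

Lemma dominated_Rintegral d (X : measurableType d) (R : realType)
    (nu : {measure set X -> \bar R}) (D : set X) (f g : X -> R) : measurable D ->
  measurable_fun D f -> (forall x, D x -> `|f x| <= g x) ->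
  nu.-integrable D (EFin \o g) ->
  nu.-integrable D (EFin \o f) /\ `|\int[nu]_(x in D) f x| <= \int[nu]_(x in D) g x.
Proof.
move=> mD mf fg gi.
have fi : nu.-integrable D (EFin \o f).
  apply: le_integrable gi => //; first exact/measurable_EFinP.
  by move=> x Dx /=; rewrite lee_fin (le_trans (fg x Dx))// ler_norm.
split=> //; apply: le_trans (le_normr_Rintegral _ fi) _ => //.
by apply: le_Rintegral => //; exact: integrable_norm.
Qed.

(** The form in which error terms will be bounded: a product of two fractional kernels integrates to
    a third one. *)
Lemma dominated_fker_conv {R : realType} (a b c t u : R) (f : R -> R) :
  0 < a -> 0 < b -> measurable_fun [set: R] f ->
  (forall s, `|f s| <= c * (fker a (t - s) * fker b (s - u))) ->
  lebesgue_measure.-integrable [set: R] (EFin \o f) /\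
  `|\int[lebesgue_measure]_s f s| <= c * fker (a + b) (t - u).
Proof.
move=> a0 b0 mf fc; have ki := integrable_fker_conv t u a0 b0.
rewrite -(Rintegral_fker_conv t u a0 b0) -RintegralZl//.
apply: dominated_Rintegral => //.
exact: (integrableZl _ c ki).
Qed.

Lemma powRD_gt0 {R : realType} (x a b : R) : 0 < x -> x `^ (a + b) = x `^ a * x `^ b.
Proof. by move=> x0; rewrite powRD// (gt_eqF x0) implybT. Qed.

(** Here [x] stands for the mesh of a grid, and the left-hand side for the errors of all cells but
    the last. The powers recombine as [(n x)^al x^e x^(al - 1)], of which the first two factors are
    bounded through [T]. *)
Lemma fker_mesh_bound {R : realType} (al e T x : R) n : 0 < al -> 0 <= e -> 0 < x ->
  n%:R * x <= T -> x <= T ->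
  x `^ (al - 1) * (n%:R `^ al / al) / Gamma al * fker (1 + (e + al)) x <=
  T `^ al / al / Gamma al * (T `^ e / Gamma (1 + (e + al))) * x `^ (- (1 - al)).
Proof.
move=> al0 e0 x0 nxT xT; have b0 : 0 < 1 + (e + al) by rewrite ltr_pwDl// addr_ge0// ltW.
have Gb := Gamma_gt0 b0; have Ga := Gamma_gt0 al0.
have T0 := lt_le_trans x0 xT.
have nT : (n%:R * x) `^ al <= T `^ al.
  by rewrite ge0_ler_powR ?nnegrE ?(ltW al0) ?(ltW T0) ?(mulr_ge0 _ (ltW x0)).
have dT : x `^ e <= T `^ e by rewrite ge0_ler_powR ?nnegrE ?(ltW x0) ?(ltW T0).
have iv : 0 < al^-1 by rewrite invr_gt0.
have K0 : 0 <= al^-1 / Gamma al / Gamma (1 + (e + al)).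
  exact: divr_ge0 (divr_ge0 (ltW iv) (ltW Ga)) (ltW Gb).
have := ler_wpM2r (powR_ge0 x (- (1 - al)))
  (ler_wpM2r K0 (ler_pM (powR_ge0 _ _) (powR_ge0 _ _) nT dT)).
rewrite fkerE// powRM ?(ltW x0)//.
have -> : 1 + (e + al) - 1 = e + al by ring.
have -> : - (1 - al) = al - 1 by ring.
rewrite (powRD_gt0 e al x0) => H.
have e1 (p q r s g g' a' : R) : p * (q * a') * g * (s * r * g') =
  q * r * s * (a' * g * g') * p by ring.
have e2 (p u v g g' a' : R) : u * a' * g * (v * g') * p =
  u * v * (a' * g * g') * p by ring.
by rewrite [leLHS]e1 [leRHS]e2.
Qed.

(** * Fractional integration of scalar Young integrals *)

Section volterra_identity.
Context {R : realType}.
Local Notation mu := (@lebesgue_measure R).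
Variables (al gam T L : R) (i : nat) (w : R -> R).
Hypotheses (al0 : 0 < al) (al1 : al < 1) (T0 : 0 < T).
Hypotheses (algam : 1 - al < gam) (L0 : 0 <= L).
Hypothesis wL : forall r s, `|w r - w s| <= L * `|r - s| `^ gam.

Definition scalar_kernel (i : nat) (x u : R) : R := mlterm al i x * u.

Lemma scalar_volterra_kernel j :
  volterra_kernel T (1 - al) (mlcst al T j) (scalar_kernel j).
Proof.
have [h1 h2 h3] := mlterm_bounds al0 al1 T0 j; split.
- by move=> x u v; rewrite /scalar_kernel mulrBr.
- move=> x u x0 xT; rewrite normrM ler_wpM2r//; exact: h1.
- by move=> x y u x0 xy yT; rewrite -mulrBl normrM ler_wpM2r// h2.
- move=> x y h u x0 xy h0 yT; have := h3 x y h x0 xy h0 yT.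
  rewrite /scalar_kernel; move: (mlterm _ _ _) (mlterm _ _ _) (mlterm _ _ _)
    (mlterm _ _ _) => p q r s H.
  have -> : s * u - r * u - (q * u - p * u) = (s - r - (q - p)) * u by ring.
  by rewrite normrM ler_wpM2r.
Qed.

(** Formally the fractional integral of order [al j + al] of the differential of [w]. *)
Definition jint (j : nat) (t : R) : R := vint (scalar_kernel j) t w.

Let a : R := 1 - al.
Let a0 : 0 < a. Proof. by rewrite subr_gt0. Qed.
Let kap : R := (gam - a) / 2.
Let kap0 : 0 < kap. Proof. by rewrite divr_gt0// subr_gt0. Qed.

Lemma wholder t : holder_le t gam L w.
Proof. by move=> r r' *; exact: wL. Qed.

Definition jint_rate j : R := L * (mlcst al T j * (a / kap) * T `^ kap).

Lemma jint_rate_ge0 j : 0 <= jint_rate j.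
Proof.
rewrite /jint_rate mulr_ge0// mulr_ge0 ?powR_ge0// mulr_ge0 ?mlcst_ge0//.
by rewrite divr_ge0// ltW.
Qed.

Lemma jint_approx j (t D : R) (s : seq R) : t <= T -> 0 < D -> itv_partition 0 t s ->
  mesh 0 s <= D ->
  `|vsum (scalar_kernel j) t w s - jint j t| <= jint_rate j * D `^ kap.
Proof.
move=> tT D0 ps ms.
have := (vsum_vint_le a0 algam (mlcst_ge0 T al0 al1 j)
  (scalar_volterra_kernel j) L0 tT (@wholder t) D0 ps ms).
by [].
Qed.

Lemma jint0 j : jint j 0 = 0.
Proof.
have a1 : a < 1 by rewrite /a gtrBl.
have := vint_le a0 algam (mlcst_ge0 T al0 al1 j) (scalar_volterra_kernel j) L0
  (lexx 0) (ltW T0) (@wholder 0).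
by rewrite powR0 ?(gt_eqF (_ : 0 < gam - a)) ?subr_gt0// mulr0 normr_le0 => /eqP.
Qed.

Definition jint_bound j : R :=
  mlcst al T j * (1 + a / (gam - a)) * L * T `^ (gam - a).

Lemma jint_le j (t : R) : 0 <= t -> t <= T -> `|jint j t| <= jint_bound j.
Proof.
move=> t0 tT; have a1 : a < 1 by rewrite /a gtrBl.
have ga : 0 < gam - a by rewrite subr_gt0.
have := vint_le a0 algam (mlcst_ge0 T al0 al1 j) (scalar_volterra_kernel j) L0
  t0 tT (@wholder t).
move=> /le_trans; apply; apply: ler_wpM2l.
  rewrite mulr_ge0// mulr_ge0 ?mlcst_ge0// addr_ge0// divr_ge0 ?ltW//.
by rewrite ge0_ler_powR ?nnegrE ?(ltW ga) ?(ltW T0).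
Qed.

Lemma jint_measurable j (t : R) : 0 <= t -> t <= T -> measurable_fun `[0, t] (jint j).
Proof.
move=> t0 tT; have a1 : a < 1 by rewrite /a gtrBl.
(* An admissible Hölder exponent: at most [1], and small enough for [a + eta < gam]. *)
pose eta := Num.min kap 1.
have eta0 : 0 < eta by rewrite lt_min kap0 ltr01.
have eta1 : eta <= 1 by rewrite ge_min lexx orbT.
have aeta : a + eta < gam.
  have : eta <= kap by rewrite ge_min lexx.
  by move: algam; rewrite /kap -/a; move: a => x; lra.
have H (r s : R) : 0 <= r -> r <= s -> s <= t ->
    `|jint j s - jint j r| <= vint_holder_cst T a gam (mlcst al T j) eta * L * `|s - r| `^ eta.
  move=> r0 rs st; rewrite [`|s - r|]ger0_norm ?subr_ge0//.
  have := (vint_holder a0 a1 algam (mlcst_ge0 T al0 al1 j)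
    (scalar_volterra_kernel j) L0 r0 rs (le_trans st tT) eta0 eta1 aeta (@wholder s)).
  by [].
apply: (holder_measurable t0 eta0 (M := vint_holder_cst T a gam (mlcst al T j) eta * L)).
move=> r s r0 rt s0 st; have [rs|sr] := leP r s.
  by rewrite distrC [`|r - s|]distrC; exact: H.
by apply: H => //; exact: ltW.
Qed.

Lemma mlterm_ge0 j x : 0 <= mlterm al j x.
Proof. by apply: fker_ge0; rewrite ltr_wpDl// mulr_ge0// ltW. Qed.

Section one_grid.
Variables (t : R) (n : nat).
Hypotheses (t0 : 0 < t) (tT : t <= T).

Let dl : R := t / n.+1%:R.
Let u (j : nat) : R := j%:R * dl.
Let dl0 : 0 < dl. Proof. by rewrite divr_gt0. Qed.
Let uS j : u j.+1 = u j + dl.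
Proof. by rewrite /u -natr1 mulrDl mul1r. Qed.
Let uE : u n.+1 = t. Proof. by rewrite /u /dl mulrC divfK. Qed.
Let ali j : 0 < al * j%:R + al.
Proof. by rewrite ltr_wpDl// mulr_ge0// ltW. Qed.

(** Contribution of the [j]-th cell to [fker al (t - s)] times the [i]-th integral up to [s].
    Stopping the path at [s] makes [S s] a left-point sum over the grid points below [s], completed
    by [s]; later cells vanish with [fker] on nonpositive arguments. *)
Let h (j : nat) (s : R) : R :=
  fker al (t - s) * (mlterm al i (s - u j) * (w (Num.min (u j.+1) s) - w (u j))).

Let S (s : R) : R :=
  \sum_(j < n.+1) mlterm al i (s - u j) * (w (Num.min (u j.+1) s) - w (u j)).

Lemma grid_jint s : 0 < s -> s <= t ->
  `|S s - jint i s| <= jint_rate i * dl `^ kap.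
Proof.
move=> s0 st; have := @grid_cell _ dl n.+1 s s0; rewrite -/(u n.+1) uE.
move=> /(_ st)[k kn /andP[ks sk]].
have sT := le_trans st tT.
suff -> : S s = vsum (scalar_kernel i) s w (grid dl k ++ [:: s]).
  apply: jint_approx => //; first exact: grid_partition_at.
  exact: grid_mesh_at.
rewrite /vsum ksum_cat ksum_grid grid_last ksum_cons ksum_nil addr0 /S.
have lt0 j : (k < j)%N -> mlterm al i (s - u j) = 0.
  move=> kj; rewrite /mlterm fker_eq0// subr_le0 (le_trans sk)//.
  by rewrite /u ler_pM2r// ler_nat.
rewrite (bigID (fun j : 'I_n.+1 => (j <= k)%N))/= [X in _ + X]big1 ?addr0; last first.
  by move=> j; rewrite -ltnNge => /lt0 ->; rewrite mul0r.
rewrite -(big_ord_widen_cond _ (fun=> true) (fun j => mlterm al i (s - u j) *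
  (w (Num.min (u j.+1) s) - w (u j))) kn)/=.
rewrite big_ord_recr/=; congr (_ + _); last first.
  by rewrite /scalar_kernel -/(u k) -/(u k.+1) min_r.
apply: eq_bigr => j _; rewrite /scalar_kernel min_l//.
apply: (le_trans _ (ltW ks)); rewrite /u ler_pM2r// ler_nat.
exact: ltn_ord.
Qed.

Let wc : continuous w.
Proof.
move=> r; apply/cvgrPdist_le => e e0.
have g0 : 0 < gam by rewrite (lt_trans _ algam)// subr_gt0.
have [d d0 de] := small_powR g0 L0 e0.
suff : \forall s \near r, `|w r - w s| <= e by [].
exists d => //= s; rewrite /ball_/= => rs.
apply: le_trans (wL r s) _; apply: le_trans (ltW de).
by rewrite ler_wpM2l// ge0_ler_powR ?nnegrE ?(ltW g0) ?(ltW d0) ?(ltW rs).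
Qed.

Let mshift (b c : R) : measurable_fun [set: R] (fun s => fker b (s - c)).
Proof.
by apply: measurableT_comp; [exact: measurable_fker|exact: measurable_funB].
Qed.

Let mrefl (b : R) : measurable_fun [set: R] (fun s => fker b (t - s)).
Proof.
by apply: measurableT_comp; [exact: measurable_fker|exact: measurable_funB].
Qed.

Let mwmin (z c : R) : measurable_fun [set: R] (fun s => w (Num.min z s) - c).
Proof.
apply: measurable_funB => //; apply: measurableT_comp.
  exact: continuous_measurable_fun.
exact: measurable_minr.
Qed.

Let mh j : measurable_fun [set: R] (h j).
Proof.
apply: measurable_funM; first exact: mrefl.
apply: measurable_funM; first exact: mshift.
exact: (mwmin (u j.+1) (w (u j))).
Qed.

Let wdl r s : `|r - s| <= dl -> `|w r - w s| <= L * dl `^ gam.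
Proof.
have g0 : 0 < gam by rewrite (lt_trans _ algam)// subr_gt0.
move=> rs; apply: le_trans (wL r s) _; rewrite ler_wpM2l//.
by rewrite ge0_ler_powR ?nnegrE ?(ltW g0) ?(ltW dl0).
Qed.

Let normM3_le (p q r c : R) : 0 <= p -> 0 <= q -> `|r| <= c ->
  `|p * (q * r)| <= c * (p * q).
Proof.
by move=> p0 q0 rc; rewrite mulrA normrM ger0_norm ?mulr_ge0// mulrC ler_wpM2r ?mulr_ge0.
Qed.

Let h_le j s : `|h j s| <=
  L * dl `^ gam * (fker al (t - s) * fker (al * i%:R + al) (s - u j)).
Proof.
have [su|us] := leP (s - u j) 0.
  by rewrite /h /mlterm (fker_eq0 _ su) mul0r !mulr0 normr0.
apply: normM3_le; rewrite ?fker_ge0 ?mlterm_ge0//.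
apply: wdl; rewrite ger0_norm ?subr_ge0.
  by rewrite lerBlDl -uS ge_min lexx.
by rewrite le_min uS lerDl (ltW dl0) -subr_ge0 (ltW us).
Qed.

Let hi j : mu.-integrable [set: R] (EFin \o h j).
Proof. by have [] := dominated_fker_conv al0 (ali i) (mh j) (h_le j). Qed.

Let V : R := \sum_(j < n.+1) mlterm al i.+1 (t - u j) * (w (u j.+1) - w (u j)).

Lemma grid_jintS : `|V - jint i.+1 t| <= jint_rate i.+1 * dl `^ kap.
Proof.
have gp := grid_partition dl0 n.+1; rewrite -/(u n.+1) uE in gp.
have := jint_approx i.+1 tT dl0 gp (grid_mesh dl0 _).
by rewrite /vsum ksum_grid.
Qed.

(** What remains of [h j] when the stopped increment of [w] is replaced by the increment over the
    whole cell. The latter integrates exactly to a term of [V], by the semigroup property, and the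
    remainder lives on [s < u j.+1]. *)
Let tail (j : nat) (s : R) : R :=
  fker al (t - s) * (mlterm al i (s - u j) * (w (Num.min (u j.+1) s) - w (u j.+1))).

Let mtail j : measurable_fun [set: R] (tail j).
Proof.
apply: measurable_funM; first exact: mrefl.
apply: measurable_funM; first exact: mshift.
exact: (mwmin (u j.+1) (w (u j.+1))).
Qed.

Let tail_le j s : `|tail j s| <= (s < u j.+1)%R%:R *
  (L * dl `^ gam * (fker al (t - s) * fker (al * i%:R + al) (s - u j))).
Proof.
have [su|us] := ltP s (u j.+1); last first.
  have -> : tail j s = 0 by rewrite /tail (min_l us) subrr mulr0 mulr0.
  by rewrite normr0 mul0r.
have [su'|us] := leP (s - u j) 0.
  by rewrite /tail /mlterm (fker_eq0 _ su') mul0r !mulr0 normr0.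
rewrite mul1r; apply: normM3_le; rewrite ?fker_ge0 ?mlterm_ge0//.
apply: wdl; rewrite min_r ?(ltW su)// ler0_norm ?subr_le0 ?(ltW su)//.
rewrite opprB uS; move: us; move: (u j) => v; lra.
Qed.

Let h_tail j : \int[mu]_s h j s - mlterm al i.+1 (t - u j) * (w (u j.+1) - w (u j)) =
  \int[mu]_s tail j s.
Proof.
have e : al + (al * i%:R + al) = al * i.+1%:R + al.
  by rewrite -natr1; ring.
have ki := integrable_fker_conv t (u j) al0 (ali i).
rewrite /mlterm -e -(Rintegral_fker_conv t (u j) al0 (ali i)).
rewrite mulrC -RintegralZl// -RintegralB//; last exact: (integrableZl _ _ ki).
apply: eq_Rintegral => s _; rewrite /h /tail /mlterm.
move: (fker _ _) (fker _ _) (w _) (w _) (w _) => p q r r' r''; ring.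
Qed.

Let b : R := al * i%:R + al.

(** On the last cell [fker al (t - s)] is singular, so the full convolution is kept; it is evaluated
    at [t - u n], which is the mesh. *)
Let tail_last : `|\int[mu]_s tail n s| <= L * dl `^ gam * mlterm al i.+1 dl.
Proof.
have -> : mlterm al i.+1 dl = fker (al + b) (t - u n).
  by rewrite /mlterm /b; congr fker; rewrite -?natr1 -?uE ?uS; ring.
have [] // := @dominated_fker_conv R al b (L * dl `^ gam) t (u n) (tail n) al0 (ali i).
move=> s; apply: le_trans (tail_le n s) _; rewrite ler_piMl ?lern1 ?leq_b1//.
exact: mulr_ge0 (mulr_ge0 L0 (powR_ge0 _ _)) (mulr_ge0 (fker_ge0 _ al0) (fker_ge0 _ (ali i))).
Qed.

(** Before the last cell the singular factor is frozen at [u j.+1], and [fker 1 (u j.+1 - s)], equal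
    to [1] for [s < u j.+1], plays the indicator of the cell in the convolution. *)
Let tail_first j : (j < n)%N -> `|\int[mu]_s tail j s| <=
  L * dl `^ gam * fker al (t - u j.+1) * fker (1 + b) dl.
Proof.
move=> jn.
have et : u j.+1 - u j = dl by rewrite uS; ring.
have -> : fker (1 + b) dl = fker (1 + b) (u j.+1 - u j) by rewrite et.
have [] // := @dominated_fker_conv R 1 b (L * dl `^ gam * fker al (t - u j.+1))
  (u j.+1) (u j) (tail j) ltr01 (ali i).
move=> s; apply: le_trans (tail_le j s) _.
have Lf x : 0 <= L * dl `^ gam * fker al x.
  exact: mulr_ge0 (mulr_ge0 L0 (powR_ge0 _ _)) (fker_ge0 _ al0).
have [su|us] := ltP s (u j.+1); last first.
  rewrite mul0r.
  exact: mulr_ge0 (Lf _) (mulr_ge0 (fker_ge0 _ ltr01) (fker_ge0 _ (ali i))).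
have f1 : fker 1 (u j.+1 - s) = 1 by apply: fker1; rewrite subr_gt0.
rewrite mul1r f1 mul1r mulrA; apply: ler_wpM2r; first exact: fker_ge0 (ali i).
apply: ler_wpM2l; first exact: mulr_ge0 L0 (powR_ge0 _ _).
have ut : u j.+1 < t.
  by rewrite -uE /u ltr_pM2r// ltr_nat ltnS.
rewrite !fkerE ?subr_gt0// ?(lt_trans su)//.
rewrite ler_wpM2r ?invr_ge0 ?(ltW (Gamma_gt0 _))//.
apply: powR_nonincreasing; rewrite ?subr_gt0 ?subr_le0 ?(ltW al1)//.
by rewrite lerB// ltW.
Qed.

Definition fint_cst : R :=
  L * (T `^ al / al / Gamma al * (T `^ (al * i%:R) / Gamma (1 + b)) + mlcst al T i.+1).

Let sum_first : \sum_(j < n) fker al (t - u j.+1) <=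
  dl `^ (al - 1) * (n%:R `^ al / al) / Gamma al.
Proof.
rewrite (reindex_inj rev_ord_inj)/=.
rewrite (eq_bigr (fun j : 'I_n => dl `^ (al - 1) / Gamma al * j.+1%:R `^ (al - 1))).
  rewrite -mulr_sumr mulrAC ler_wpM2r ?invr_ge0 ?(ltW (Gamma_gt0 _))//.
  by rewrite ler_wpM2l ?powR_ge0// sum_powR_le// ltW.
move=> j _.
have -> : t - u (n - j.+1).+1 = j.+1%:R * dl.
  rewrite -uE /u -mulrBl -natrB ?ltnS ?leq_subr//; congr (_%:R * _).
  by rewrite subSS subKn ?ltn_ord.
by rewrite fkerE ?mulr_gt0// powRM ?(ltW dl0)//; ring.
Qed.

(** Summed over the cells, the oscillation [dl^gam] is multiplied by [dl^(- a)] at worst, and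
    [a < gam]. *)
Lemma grid_fint : `|\sum_(j < n.+1) \int[mu]_s h j s - V| <=
  fint_cst * dl `^ (gam - a).
Proof.
rewrite /V -sumrB (eq_bigr (fun j : 'I_n.+1 => \int[mu]_s tail j s)); last first.
  by move=> j _; exact: h_tail.
apply: le_trans (ler_norm_sum _ _ _) _; rewrite big_ord_recr/=.
apply: le_trans (lerD (ler_sum _ (fun j _ => tail_first (ltn_ord j))) tail_last) _.
rewrite -mulr_suml -mulr_sumr -mulrA -mulrDr.
have -> : fint_cst * dl `^ (gam - a) = L * dl `^ gam *
    ((T `^ al / al / Gamma al * (T `^ (al * i%:R) / Gamma (1 + b)) + mlcst al T i.+1) *
     dl `^ (- a)).
  rewrite (powRD_gt0 gam (- a) dl0) /fint_cst.
  move: (dl `^ gam) (dl `^ (- a)) (T `^ al / al / Gamma al) (_ / Gamma _)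
    (mlcst _ _ _) => p q r s v; ring.
rewrite ler_wpM2l ?mulr_ge0 ?powR_ge0// mulrDl.
have dlT : dl <= T.
  by apply: le_trans tT; rewrite /dl ler_pdivrMr// ler_peMr ?ler1n ?(ltW t0).
apply: lerD; last first.
  have [H _ _] := mlterm_bounds al0 al1 T0 i.+1.
  exact: le_trans (ler_norm _) (H _ dl0 dlT).
have b0 : 0 < 1 + b by rewrite addr_gt0// ali.
apply: le_trans (ler_wpM2r (fker_ge0 _ b0) sum_first) _.
have nT : n%:R * dl <= T.
  by apply: le_trans tT; rewrite -[leRHS]uE /u ler_pM2r// ler_nat.
exact: fker_mesh_bound al0 (mulr_ge0 (ltW al0) (ler0n _ _)) dl0 nT dlT.
Qed.

Let F (s : R) : R := fker al (t - s) * (jint i \_ `[0, t]) s.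

Lemma fint_integrable : mu.-integrable [set: R] (EFin \o F).
Proof.
have := @dominated_fker_conv R al 1 (jint_bound i) t 0 F al0 ltr01; case=> //.
  apply: measurable_funM; first exact: mrefl.
  apply/(measurable_restrictT (jint i)) => //.
  by apply: jint_measurable => //; exact: ltW.
move=> s; rewrite /F /patch mem_setE in_itv/= subr0.
have [s0|s0] := leP s 0.
  have [->|s0'] := eqVneq s 0; first by rewrite jint0 if_same (fker_eq0 1 (lexx 0)) !mulr0 normr0.
  have -> : (0 <= s) = false by apply/negbTE; rewrite -ltNge lt_neqAle s0'.
  by rewrite /= (fker_eq0 1 s0) !mulr0 normr0.
have [st|ts] := leP s t; last first.
  by rewrite (fker_eq0 al (_ : t - s <= 0)) ?subr_le0 ?(ltW ts)// !mul0r normr0 mulr0.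
rewrite (ltW s0) (fker1 s0) mulr1 normrM (ger0_norm (fker_ge0 _ al0)) mulrC.
by rewrite ler_wpM2r ?fker_ge0// jint_le// ?(ltW s0)// (le_trans st).
Qed.

(** The error of the grid sums is uniform in [s]; it is integrated against the kernel with [fker 1]
    as the constant [1] on positive times. *)
Lemma grid_fint_jint : `|\int[mu]_s F s - \sum_(j < n.+1) \int[mu]_s h j s| <=
  jint_rate i * dl `^ kap * fker (al + 1) t.
Proof.
have [si <-] := integrable_Rintegral_sum n.+1 hi.
rewrite -(RintegralB measurableT fint_integrable si).
rewrite -[t in fker _ t]subr0.
have := @dominated_fker_conv R al 1 (jint_rate i * dl `^ kap) t 0
  (fun s => F s - \sum_(j < n.+1) h j s) al0 ltr01; case=> //.
  apply: measurable_funB.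
    by have /measurable_int/measurable_EFinP := fint_integrable.
  by have /measurable_int/measurable_EFinP := si.
move=> s; have -> : \sum_(j < n.+1) h j s = fker al (t - s) * S s.
  by rewrite /S mulr_sumr.
rewrite /F -mulrBr /patch mem_setE in_itv/= subr0.
have c0 : 0 <= jint_rate i * dl `^ kap by rewrite mulr_ge0 ?jint_rate_ge0 ?powR_ge0.
have [s0|s0] := leP s 0.
  have -> : S s = 0.
    rewrite /S big1// => j _; rewrite /mlterm fker_eq0 ?mul0r//.
    by rewrite subr_le0 (le_trans s0)// /u mulr_ge0// ltW.
  have [->|s0'] := eqVneq s 0.
    by rewrite jint0 if_same !subr0 (fker_eq0 1 (lexx 0)) !mulr0 normr0.
  have -> : (0 <= s) = false by apply/negbTE; rewrite -ltNge lt_neqAle s0'.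
  by rewrite /= !subr0 (fker_eq0 1 s0) !mulr0 normr0.
have [st|ts] := leP s t; last first.
  by rewrite (fker_eq0 al (_ : t - s <= 0)) ?subr_le0 ?(ltW ts)// !mul0r normr0 mulr0.
rewrite (ltW s0) (fker1 s0) mulr1 normrM (ger0_norm (fker_ge0 _ al0)) mulrC.
by rewrite ler_wpM2r ?fker_ge0// distrC grid_jint.
Qed.

End one_grid.

Let ali j : 0 < al * j%:R + al.
Proof. by rewrite ltr_wpDl// mulr_ge0// ltW. Qed.

Lemma fint_cst_ge0 : 0 <= fint_cst.
Proof.
have Gb : 0 < Gamma (1 + (al * i%:R + al)).
  by apply: Gamma_gt0; rewrite addr_gt0// ali.
rewrite /fint_cst mulr_ge0// addr_ge0 ?mlcst_ge0// mulr_ge0//.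
  by rewrite !divr_ge0 ?powR_ge0 ?(ltW al0) ?(ltW (Gamma_gt0 _)).
by rewrite divr_ge0 ?powR_ge0 ?(ltW Gb).
Qed.

Lemma dl_gap x : 0 < x -> x <= T -> x `^ (gam - a) <= T `^ kap * x `^ kap.
Proof.
move=> x0 xT; have -> : gam - a = kap + kap by rewrite /kap -splitr.
rewrite powRD_gt0// ler_wpM2r ?powR_ge0//.
by rewrite ge0_ler_powR ?nnegrE ?(ltW kap0) ?(ltW x0) ?(ltW T0).
Qed.

(* Since [fker al] and [fker b] convolve to [fker (al + b)], fractional integration
   takes the i-th Young integral to the next one; on a uniform grid the two sides
   only differ by the oscillation of [w] on the cells. *)
Lemma fint_jint t : 0 <= t -> t <= T ->
  mu.-integrable [set: R]
    (EFin \o (fun s => fker al (t - s) * (jint i \_ `[0, t]) s)) /\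
  \int[mu]_s (fker al (t - s) * (jint i \_ `[0, t]) s) = jint i.+1 t.
Proof.
rewrite le_eqVlt => /predU1P[<- _|t0 tT].
  have -> : (fun s => fker al (0 - s) * (jint i \_ `[0, 0]) s) = cst 0.
    apply/funext => s; rewrite /patch mem_setE in_itv/=.
    case: ifPn; last by rewrite mulr0.
    by rewrite -eq_le => /eqP <-; rewrite jint0 mulr0.
  by rewrite Rintegral_cst// mul0r jint0; split=> //; exact: integrable0.
split; first exact: fint_integrable.
(* [M] collects three errors: the [i]-th integral against its grid sums, the cells cut at [s], and
   the next integral against its grid sum. Each is bounded by a constant times the power [kap] of
   the mesh, so the difference is zero. *)
set I := Rintegral _ _ _; pose M := jint_rate i * fker (al + 1) t +
  fint_cst * T `^ kap + jint_rate i.+1.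
have IM n : `|I - jint i.+1 t| <= M * (t / n.+1%:R) `^ kap.
  have h1 := grid_fint_jint n t0 tT; have h2 := grid_fint n t0 tT.
  have h3 := grid_jintS n t0 tT.
  have dT : t / n.+1%:R <= T.
    by apply: le_trans tT; rewrite ler_pdivrMr// ler_peMr ?ler1n ?(ltW t0).
  have d0 : 0 < t / n.+1%:R by rewrite divr_gt0.
  move: h1 h2 h3 dT d0; rewrite -/I /M; move: (t / n.+1%:R) => x h1 h2 h3 xT x0.
  set G := \sum_(j < n.+1) \int[mu]_s _ in h1 h2; set V := (\sum_(j < n.+1) _) in h2 h3.
  have := ler_wpM2l (fint_cst_ge0) (dl_gap x0 xT).
  have -> : I - jint i.+1 t = (I - G) + (G - V) + (V - jint i.+1 t) by ring.
  move=> h4; apply: le_trans (ler_normD _ _) _; rewrite mulrDl [in leRHS]mulrDl.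
  apply: lerD; last exact: h3.
  apply: le_trans (ler_normD _ _) _; apply: lerD; first by rewrite mulrAC.
  by apply: le_trans h2 _; apply: le_trans h4 _; rewrite mulrA.
apply/eqP; rewrite -subr_eq0 -normr_eq0; apply/negP => /negP ne.
have M0 : 0 <= M.
  rewrite !addr_ge0 ?jint_rate_ge0//; last by rewrite mulr_ge0 ?fint_cst_ge0 ?powR_ge0.
  by rewrite mulr_ge0 ?jint_rate_ge0// fker_ge0// addr_gt0.
have p0 : 0 < `|I - jint i.+1 t| by rewrite lt_neqAle eq_sym ne normr_ge0.
have [d d0 de] := small_powR kap0 M0 p0.
have := IM (Num.truncn (t / d)); rewrite leNgt => /negP; apply.
apply: le_lt_trans de; rewrite ler_wpM2l//.
rewrite ge0_ler_powR ?nnegrE ?(ltW kap0) ?(ltW d0) ?divr_ge0 ?(ltW t0)//.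
by rewrite ler_pdivrMr// mulrC -ler_pdivrMr// ltW// truncnS_gt.
Qed.

End volterra_identity.

(** * Bochner integrals tested against vectors *)

Section weak_bochner.
Context d (X : measurableType d) {R : realType}.
Variables (nu : {measure set X -> \bar R}) (D : set X).
Hypothesis mD : measurable D.

Lemma Rintegral_bigsum I (s : seq I) (F : I -> X -> R) :
  (forall i, nu.-integrable D (EFin \o F i)) ->
  nu.-integrable D (EFin \o (fun x => \sum_(i <- s) F i x)) /\
  \int[nu]_(x in D) (\sum_(i <- s) F i x) = \sum_(i <- s) \int[nu]_(x in D) F i x.
Proof.
move=> Fi; elim: s => [|i s [IH1 IH2]].
  have -> : (fun x => \sum_(i <- [::]) F i x) = cst 0.
    by apply/funext => x; rewrite big_nil.
  by rewrite big_nil Rintegral_cst// mul0r; split=> //; exact: integrable0.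
have -> : (fun x => \sum_(j <- i :: s) F j x) = (fun x => F i x + \sum_(j <- s) F j x).
  by apply/funext => x; rewrite big_cons.
split; first exact: (integrableD mD (Fi i) IH1).
by rewrite (RintegralD mD (Fi i) IH1) IH2 big_cons.
Qed.

Lemma Rintegral_indic_scale (E : set X) (c : R) : measurable E -> E `<=` D ->
  (nu E < +oo)%E ->
  nu.-integrable D (EFin \o (fun x => \1_E x * c)) /\
  \int[nu]_(x in D) (\1_E x * c) = fine (nu E) * c.
Proof.
move=> mE ED nuE.
have iE : nu.-integrable D (EFin \o \1_E).
  apply/integrableP; split; first exact/measurable_EFinP/measurable_indic.
  under eq_integral => x _ do rewrite gee0_abs ?lee_fin//.
  by rewrite integral_indic// setIidl.
split; first exact: (integrableZr mD c iE).
by rewrite (RintegralZr c mD iE) /Rintegral integral_indic// setIidl.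
Qed.

(** The integral of the norm of [f - f_n] dominates the tested difference, so the integrals of the
    tested simple functions approach both sides. [is_bochner] speaks of norms only, whence the
    hypothesis of measurability. *)
Lemma bochner_weak (H : hilbertType R) (f : X -> H) v g :
  is_bochner nu D f v -> measurable_fun D (fun x => inner (f x) g) ->
  nu.-integrable D (EFin \o (fun x => inner (f x) g)) /\
  \int[nu]_(x in D) inner (f x) g = inner v g.
Proof.
move=> [f_ [fm fi f0 fv]] mf.
pose s_ n x := inner (sf_eval (f_ n) x) g.
have sE n : s_ n = fun x => \sum_(i < sf_size (f_ n)) \1_(sf_set i) x * inner (sf_val i) g.
  apply/funext => x; rewrite /s_ /sf_eval inner_suml.
  by apply: eq_bigr => i _; rewrite innerZl.
have [si sI] : (forall n, nu.-integrable D (EFin \o s_ n)) /\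
    (forall n, \int[nu]_(x in D) s_ n x = inner (sf_integral nu (f_ n)) g).
  apply: all_and2 => n; rewrite sE.
  have H0 i := let: And3 a b c := fm n i in
    Rintegral_indic_scale (inner (sf_val i) g) a b c.
  have [h1 ->] := @Rintegral_bigsum _ (index_enum _) _ (fun i => (H0 i).1).
  split=> //; rewrite /sf_integral inner_suml; apply: eq_bigr => i _.
  by rewrite (H0 i).2 innerZl.
have dom n x : `|inner (f x) g - s_ n x| <= `|f x - sf_eval (f_ n) x| * `|g|.
  by rewrite /s_ -innerBl inner_le.
have nfi n := integrableZr mD `|g| (fi n).
have dI n := dominated_Rintegral mD
  (measurable_funB mf ((measurable_EFinP _ _).1 (measurable_int _ (si n))))
  (fun x _ => dom n x) (nfi n).
have fgi : nu.-integrable D (EFin \o (fun x => inner (f x) g)).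
  have := integrableD mD (dI 0%N).1 (si 0%N).
  apply: eq_integrable => // x _ /=.
  by rewrite -EFinD subrK.
split=> //; apply/eqP; rewrite -subr_eq0 -normr_le0.
have h1 : inner (sf_integral nu (f_ n)) g @[n --> \oo] --> inner v g.
  exact: inner_cvgl.
have h2 : \int[nu]_(x in D) inner (f x) g - inner (sf_integral nu (f_ n)) g
    @[n --> \oo] --> \int[nu]_(x in D) inner (f x) g - inner v g.
  by apply: cvgB => //; exact: cvg_cst.
have h3 : fine (\int[nu]_(x in D) `|f x - sf_eval (f_ n) x|%:E)%E * `|g| @[n --> \oo] --> (0 : R).
  rewrite -[X in _ --> X](mul0r `|g|); apply: cvgMr_tmp; exact: fine_cvg f0.
apply: (ler_cvg_to (cvg_norm h2) h3); apply: nearW => n.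
rewrite -sI -(RintegralB mD fgi (si n)); apply: le_trans (dI n).2 _.
by rewrite (RintegralZr _ mD (fi n)).
Qed.

End weak_bochner.

(** * Extension of Hölder paths to the line *)

Section clamped_paths.
Context {R : realType} {E : normedModType R}.
Variable T : R.
Hypothesis T0 : 0 <= T.

Lemma clamp_itv r : 0 <= clamp T r <= T.
Proof. by rewrite /clamp le_max lexx ge_max T0 ge_min lexx orbT. Qed.

Lemma clamp_id r : 0 <= r -> r <= T -> clamp T r = r.
Proof. by move=> r0 rT; rewrite /clamp min_l// max_r. Qed.

Lemma holder_clamp g (w : R -> E) : 0 < g -> holder_on T g w ->
  exists2 L, 0 <= L & forall r s, `|w (clamp T r) - w (clamp T s)| <= L * `|r - s| `^ g.
Proof.
move=> g0 [M wM]; exists `|M| => // r s.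
have /andP[r0 rT] := clamp_itv r; have /andP[s0 sT] := clamp_itv s.
apply: le_trans (wM _ _ _ _) _; rewrite ?in_itv/= ?r0 ?s0//.
apply: le_trans (ler_wpM2r (powR_ge0 _ _) (ler_norm M)) _.
rewrite ler_wpM2l// ge0_ler_powR ?nnegrE ?(ltW g0)//.
exact: clamp_lipschitz.
Qed.

End clamped_paths.

(** * The equation tested against vectors and its iteration *)

Section weak_solution.
Context {R : realType} {H : hilbertType R}.
Local Notation mu := (@lebesgue_measure R).
Variables (al gam kapp T : R) (A : bop H) (y : H) (w Y : R -> H).
Hypotheses (al0 : 0 < al) (al1 : al < 1) (T0 : 0 < T) (algam : 1 - al < gam).
Hypotheses (kapp0 : 0 < kapp) (wH : holder_on T gam w) (YH : holder_on T kapp Y).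
Hypothesis Ysol : solves_fOU_equation T al A y w Y.

Let B := adjoint A.
Let wc := w \o clamp T.
Let wi (h : H) (r : R) : R := inner (wc r) h.
Let yi (h : H) (r : R) : R := inner (Y r) h.

(** The point [0] is left out because the remainders will be bounded by fractional kernels at
    positive times only: [fker 1] vanishes at [0], the tested solution need not. *)
Definition fint (f : R -> R) (t : R) : R := \int[mu]_s (fker al (t - s) * (f \_ `]0, t]) s).

Definition fint_able (f : R -> R) (t : R) :=
  mu.-integrable [set: R] (EFin \o (fun s => fker al (t - s) * (f \_ `]0, t]) s)).

Lemma wi_holder h : exists2 L, 0 <= L &
  forall r s, `|wi h r - wi h s| <= L * `|r - s| `^ gam.
Proof.
have g0 : 0 < gam by rewrite (lt_trans _ algam)// subr_gt0.
have [L L0 wL] := holder_clamp (ltW T0) g0 wH; exists (L * `|h|); rewrite ?mulr_ge0// => r s.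
rewrite /wi -innerBl (le_trans (inner_le _ _))// mulrAC ler_wpM2r//; exact: wL.
Qed.

Lemma yi_holder h : exists2 L, 0 <= L & forall r s, 0 <= r -> r <= T -> 0 <= s -> s <= T ->
  `|yi h r - yi h s| <= L * `|r - s| `^ kapp.
Proof.
have [L L0 YL] := holder_clamp (ltW T0) kapp0 YH.
exists (L * `|h|); rewrite ?mulr_ge0// => r s r0 rT s0 sT.
rewrite /yi -innerBl (le_trans (inner_le _ _))// mulrAC ler_wpM2r//.
by have := YL r s; rewrite !clamp_id.
Qed.

Lemma fint_patch0 (f : R -> R) (t : R) : f 0 = 0 ->
  (fun s => fker al (t - s) * (f \_ `[0, t]) s) =
  (fun s => fker al (t - s) * (f \_ `]0, t]) s).
Proof.
move=> f0; apply/funext => s; congr (_ * _); rewrite /patch !mem_setE !in_itv/=.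
by have [->|s0] := eqVneq s 0; rewrite ?f0 ?ltxx ?if_same// lt_neqAle eq_sym s0.
Qed.

Lemma fint_jint_open h k t : 0 < t -> t <= T ->
  fint_able (jint al (wi h) k) t /\
  fint (jint al (wi h) k) t = jint al (wi h) k.+1 t.
Proof.
move=> t0 tT; have [L L0 wL] := wi_holder h.
have := fint_jint k al0 al1 T0 algam L0 wL (ltW t0) tT.
by rewrite fint_patch0// (jint0 al0 al1 T0 algam L0 wL).
Qed.

Lemma fint_fker (b t : R) : 0 < b ->
  fint_able (fker b) t /\ fint (fker b) t = fker (al + b) t.
Proof.
move=> b0; rewrite /fint_able /fint.
have -> : (fun s => fker al (t - s) * (fker b \_ `]0, t]) s) =
    (fun s => fker al (t - s) * fker b (s - 0)).
  apply/funext => s; rewrite /patch mem_setE in_itv/= subr0.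
  have [s0|s0] := leP s 0; first by rewrite (fker_eq0 b s0).
  have [st|ts] := leP s t => //=.
  by rewrite (fker_eq0 al (_ : t - s <= 0)) ?subr_le0 ?(ltW ts)// !mul0r.
split; first exact: (integrable_fker_conv t 0 al0 b0).
by rewrite Rintegral_fker_conv// subr0.
Qed.

Lemma fintD f g t : fint_able f t -> fint_able g t ->
  fint_able (fun s => f s + g s) t /\ fint (fun s => f s + g s) t = fint f t + fint g t.
Proof.
rewrite /fint_able /fint => fi gi.
have -> : (fun s => fker al (t - s) * ((fun r => f r + g r) \_ `]0, t]) s) =
   (fun s => fker al (t - s) * (f \_ `]0, t]) s + fker al (t - s) * (g \_ `]0, t]) s).
  by apply/funext => s; rewrite -mulrDr /patch; case: ifP; rewrite ?addr0.
split; first exact: (integrableD measurableT fi gi).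
by rewrite (RintegralD measurableT fi gi).
Qed.

Lemma fintZ c f t : fint_able f t ->
  fint_able (fun s => c * f s) t /\ fint (fun s => c * f s) t = c * fint f t.
Proof.
rewrite /fint_able /fint => fi.
have -> : (fun s => fker al (t - s) * ((fun r => c * f r) \_ `]0, t]) s) =
   (fun s => c * (fker al (t - s) * (f \_ `]0, t]) s)).
  by apply/funext => s; rewrite /patch; case: ifP => _; [exact: mulrCA|rewrite !mulr0].
split; first exact: (integrableZl measurableT c fi).
by rewrite (RintegralZl c measurableT fi).
Qed.

Lemma fint_sum n (F : nat -> R -> R) t : (forall k, fint_able (F k) t) ->
  fint_able (fun s => \sum_(k < n) F k s) t /\
  fint (fun s => \sum_(k < n) F k s) t = \sum_(k < n) fint (F k) t.
Proof.
move=> Fi; elim: n => [|n [IH1 IH2]].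
  have -> : (fun s => \sum_(k < 0) F k s) = (fun s => 0 * F 0%N s).
    by apply/funext => s; rewrite big_ord0 mul0r.
  by have [h1 h2] := fintZ 0 (Fi 0%N); rewrite h2 mul0r big_ord0.
have -> : (fun s => \sum_(k < n.+1) F k s) = (fun s => \sum_(k < n) F k s + F n s).
  by apply/funext => s; rewrite big_ord_recr.
by have [h1 h2] := fintD IH1 (Fi n); rewrite h2 IH2 big_ord_recr.
Qed.

(** Pairing moves [A] to the other side, so the fractional integral involves [B g] in place of [g].
    Up to the factor [Gamma al], the tested sums of the pathwise integral are the sums defining the
    Young integral of index [0]. *)
Lemma weak_equation g t : 0 < t -> t <= T ->
  fint_able (yi (B g)) t /\
  yi g t = inner y g * fker 1 t + fint (yi (B g)) t + jint al (wi g) 0 t.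
Proof.
move=> t0 tT; have [I [J [[I' bI ->] sJ eY]]] : exists I J,
    [/\ is_fractional_integral al Y t I,
      is_stieltjes_integral t (fun s => (t - s) `^ (al - 1)) w J &
      Y t = y + A I + (Gamma al)^-1 *: J].
  by apply: Ysol; rewrite in_itv/= (ltW t0).
have G0 := Gamma_gt0 al0.
pose kk s : R := (t - s) `^ (al - 1).
(* At [s = t] both sides are [0], by the values of [powR] and [fker] at [0]. *)
have kkE s : s <= t -> kk s = Gamma al * fker al (t - s).
  move=> st; rewrite /kk; have [ts|ts] := ltP s t.
    by rewrite fkerE ?subr_gt0// mulrC divfK// gt_eqF.
  have -> : s = t by apply/eqP; rewrite eq_le st.
  by rewrite subrr fker_eq0// mulr0 powR0// lt_eqF// subr_lt0.
have mk : measurable_fun `[0, t] kk.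
  apply: measurable_funTS.
  apply: (@measurableT_comp _ _ _ _ _ _ (fun x : R => x `^ (al - 1))) => //.
  exact: measurable_funB.
have my : measurable_fun `[0, t] (yi (B g)).
  have [L L0 yL] := yi_holder (B g).
  apply: (holder_measurable (ltW t0) kapp0 (M := L)) => r s r0 rt s0 st.
  by apply: yL => //; exact: le_trans tT.
have [bi bE] : mu.-integrable `[0, t] (EFin \o (fun s => inner (kk s *: Y s) (B g))) /\
  \int[mu]_(s in `[0, t]) inner (kk s *: Y s) (B g) = inner I' (B g).
  apply: bochner_weak => //; apply: (@eq_measurable_fun _ _ _ _ _ (kk \* yi (B g))).
    by move=> s _; rewrite innerZl.
  exact: measurable_funM.
have oc : `]0, t] `<=` (`[0, t] : set R) by move=> s /=; rewrite !in_itv/= => /andP[/ltW -> ->].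
have bi' : mu.-integrable `]0, t] (EFin \o (fun s => inner (kk s *: Y s) (B g))).
  by apply: integrableS bi.
rewrite -Rintegral_itv_obnd_cbnd// Rintegral_mkcond in bE.
have bi2 : mu.-integrable [set: R]
    (EFin \o ((fun s => inner (kk s *: Y s) (B g)) \_ `]0, t])).
  rewrite -restrict_EFin; exact/(integrable_mkcond _ _).1.
have fE : (fun s => inner (kk s *: Y s) (B g)) \_ `]0, t] =
    (fun s => Gamma al * (fker al (t - s) * (yi (B g) \_ `]0, t]) s)).
  apply/funext => s; rewrite /patch mem_setE in_itv/=.
  case: ifP => [/andP[s0 st]|_]; last by rewrite !mulr0.
  by rewrite innerZl kkE// mulrA.
rewrite fE in bi2 bE.
have fi : fint_able (yi (B g)) t.
  rewrite /fint_able.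
  have -> : (fun s => fker al (t - s) * (yi (B g) \_ `]0, t]) s) =
     (fun s => (Gamma al)^-1 * (Gamma al * (fker al (t - s) * (yi (B g) \_ `]0, t]) s))).
    by apply/funext => s; rewrite mulKf// gt_eqF.
  exact: (integrableZl measurableT (Gamma al)^-1 bi2).
split=> //.
rewrite {1}/yi eY !innerDl innerZl adjointE innerZl -/B -bE RintegralZl//.
rewrite -/(fint (yi (B g)) t) mulKf ?gt_eqF// fker1// mulr1; congr (_ + _).
have [L L0 wL] := wi_holder g.
have gp : holder_le t gam L (wi g) by move=> r s *; exact: wL.
have FF := fine_partitions_filter (ltW t0).
have a0 : 0 < 1 - al by rewrite subr_gt0.
have h1 := vsum_cvg a0 algam (mlcst_ge0 T al0 al1 0) (scalar_volterra_kernel al0 al1 T0 0)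
  L0 (ltW t0) tT gp.
have h2 : inner (stieltjes_sum kk w s) g @[s --> fine_partitions 0 t] --> inner J g.
  exact: inner_cvgl.
have h3 : Gamma al * vsum (scalar_kernel al 0) t (wi g) s @[s --> fine_partitions 0 t] -->
    Gamma al * jint al (wi g) 0 t by apply: cvgMl_tmp.
suff : inner J g = Gamma al * jint al (wi g) 0 t.
  by move=> ->; rewrite mulKf// gt_eqF.
apply: (cvg_unique _ h2); first exact: norm_hausdorff.
apply: cvg_trans h3; apply: near_eq_cvg; exists 1 => //= s [is_ _].
have [ps /eqP ls] := is_.
rewrite /vsum /ksum /stieltjes_sum inner_suml mulr_sumr !big_seq.
apply: eq_bigr => p pin.
have [p1 p12 p2] := subintervals_bounds ps pin; rewrite ls in p2.
rewrite innerZl kkE ?(le_trans (ltW p12))// /scalar_kernel /mlterm mulr0 add0r /wi /wc /=.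
by rewrite -innerBl !clamp_id ?mulrA ?(le_trans p2)// ?(le_trans (ltW p12)) ?(le_trans p2)
  ?(le_trans p1 (ltW p12)).
Qed.

Lemma Y_bound : exists2 M, 0 <= M & forall s, 0 <= s -> s <= T -> `|Y s| <= M.
Proof.
have [L L0 YL] := holder_clamp (ltW T0) kapp0 YH.
exists (`|Y 0| + L * T `^ kapp); first by rewrite addr_ge0// mulr_ge0 ?powR_ge0.
move=> s s0 sT; rewrite -lerBlDl (le_trans (lerB_dist _ _))//.
have := YL s 0; rewrite !clamp_id ?(ltW T0)// => /le_trans; apply; rewrite ler_wpM2l//.
by rewrite subr0 ger0_norm// ge0_ler_powR ?nnegrE ?(ltW kapp0) ?(ltW T0).
Qed.

Variable h : H.

Let hb i : H := bpow B i h.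

(** What [k] fractional integrations make of the data of the equation tested against [hb (i + k)].
    The shift by [i] is there because each iteration changes the starting vector. *)
Let term k i t : R :=
  inner y (hb (i + k)%N) * fker (al * k%:R + 1) t + jint al (wi (hb (i + k)%N)) k t.

(* Iterating the equation n times leaves a remainder that is n times fractionally
   integrated, hence of the order of [1 / Gamma (al n + 1)]. *)
Let rem n i t : R := yi (hb i) t - \sum_(k < n) term k i t.

Let al1k k : 0 < al * k%:R + 1. Proof. by rewrite ltr_wpDl// mulr_ge0// ltW. Qed.

Let term_fint k i t : 0 < t -> t <= T ->
  fint_able (term k i.+1) t /\ fint (term k i.+1) t = term k.+1 i t.
Proof.
move=> t0 tT; have [j1 j2] := fint_jint_open (hb (i.+1 + k)%N) k t0 tT.
have [f1 f2] := fint_fker t (al1k k).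
have [g1 g2] := fintZ (inner y (hb (i.+1 + k)%N)) f1.
have [k1 k2] := fintD g1 j1; split=> //.
rewrite k2 g2 f2 j2 /term addnS addSn; congr (_ * fker _ _ + _).
by rewrite -natr1; ring.
Qed.

Let rem_fint n i t : 0 < t -> t <= T ->
  fint_able (rem n i.+1) t /\ fint (rem n i.+1) t = rem n.+1 i t.
Proof.
move=> t0 tT; have [y1 y2] := weak_equation (hb i) t0 tT.
have [s1 s2] := fint_sum n (fun k => (term_fint k i t0 tT).1).
have [z1 z2] := fintZ (-1) s1; have [f1 f2] := fintD y1 z1.
have -> : rem n i.+1 = fun s => yi (B (hb i)) s + -1 * (\sum_(k < n) term k i.+1 s).
  by apply/funext => s; rewrite mulN1r.
split=> //; rewrite f2 z2 s2 /rem big_ord_recl y2 /term mulr0 add0r addn0.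
rewrite (eq_bigr (fun k : 'I_n => term k.+1 i t)); last first.
  by move=> k _; exact: (term_fint k i t0 tT).2.
rewrite /term; move: (\sum_(k < n) _) (fint _ _) (jint _ _ _ _) => p q r.
by rewrite !opprD; ring.
Qed.

Let fint_le f b c t : 0 < b -> fint_able f t ->
  (forall s, 0 < s -> s <= t -> `|f s| <= c * fker b s) ->
  `|fint f t| <= c * fker (al + b) t.
Proof.
move=> b0 fi fc; rewrite -[t in fker _ t]subr0.
have mf := (measurable_EFinP _ _).1 (measurable_int _ fi).
have [//|_ H1] := dominated_fker_conv (c := c) (t := t) (u := 0) al0 b0 mf.
move=> s; rewrite /patch mem_setE in_itv/= subr0.
have [s0|s0] := leP s 0; first by rewrite (fker_eq0 b s0) !mulr0 normr0.
have [st|ts] := leP s t => /=; last first.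
  by rewrite (fker_eq0 al (_ : t - s <= 0)) ?subr_le0 ?(ltW ts)// !mul0r normr0 mulr0.
rewrite normrM (ger0_norm (fker_ge0 _ al0)) mulrCA; apply: ler_wpM2l.
  exact: fker_ge0.
exact: fc.
exact: H1.
Qed.

Let rem_le : exists2 M, 0 <= M & forall n i t, 0 < t -> t <= T ->
  `|rem n i t| <= M * `|B| ^+ (n + i) * fker (al * n%:R + 1) t.
Proof.
have [M M0 YM] := Y_bound; exists (M * `|h|); first by rewrite mulr_ge0.
elim=> [|n IH] i t t0 tT.
  rewrite /rem big_ord0 subr0 mulr0 add0r fker1// mulr1 (le_trans (inner_le _ _))//.
  rewrite -mulrA; apply: ler_pM => //; first by apply: YM => //; exact: ltW.
  rewrite mulrC (le_trans (bop_norm_le _ _))// ler_wpM2r//; exact: norm_bpow.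
have [r1 <-] := rem_fint n i t0 tT.
have -> : al * n.+1%:R + 1 = al + (al * n%:R + 1) by rewrite -natr1; ring.
apply: fint_le => // s s0 st; rewrite addSnnS.
by apply: IH => //; exact: le_trans tT.
Qed.

Let rem_cvg t : 0 < t -> t <= T -> rem n 0 t @[n --> \oo] --> (0 : R).
Proof.
move=> t0 tT; have [M M0 rM] := rem_le.
have q0 : 0 <= `|B| * t `^ al by rewrite mulr_ge0 ?powR_ge0.
have [K K0 GK] := Gamma_growth al0 ltr01 q0.
have h1 : `|2^-1 : R| < 1 by rewrite ger0_norm ?invr_ge0// invf_lt1// ltr1n.
have h2 : M * K * 2^-1 ^+ n @[n --> \oo] --> (0 : R).
  by rewrite -[X in _ --> X](mulr0 (M * K)); apply: cvgMl_tmp; exact: cvg_expr.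
apply/norm_cvg0P; apply: (squeeze_cvgr _ (cvg_cst 0) h2); apply: nearW => n.
rewrite normr_ge0 /= (le_trans (rM n 0%N t t0 tT))// addn0 -!mulrA ler_wpM2l//.
apply: le_trans (GK n).
have -> : `|B| ^+ n * fker (al * n%:R + 1) t =
    (`|B| * t `^ al) ^+ n / Gamma (al * n%:R + 1).
  rewrite fkerE// addrK powRrM powR_mulrn ?powR_ge0// exprMn; ring.
rewrite -mulrA ler_peMl ?divr_ge0 ?exprn_ge0 ?(ltW (Gamma_gt0 _))//.
by rewrite ler1n.
Qed.

(** The process [X] along one driving path, extended by [clamp]. *)
Definition fOU_path t : H := vint (fun x (u : H) => mlker al A x u) t wc.

Let cvg_sum_ord (S : Type) (F : set_system S) {FF : Filter F} n
    (f : nat -> S -> R) (l : nat -> R) : (forall k, f k x @[x --> F] --> l k) ->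
  \sum_(k < n) f k x @[x --> F] --> \sum_(k < n) l k.
Proof.
move=> fl; elim: n => [|n IH].
  under eq_fun do rewrite big_ord0.
  by rewrite big_ord0; exact: cvg_cst.
under eq_fun do rewrite big_ord_recr.
by rewrite big_ord_recr; exact: cvgD.
Qed.

(** On each partition the kernel cut after [n] terms, tested against [h], yields the sum of the
    first [n] scalar sums. The discarded kernel has a constant of order [2^(- n)], uniformly in the
    partition, so the limits in the partition and in [n] may be interchanged. *)
Lemma fOU_path_weak t : 0 < t -> t <= T ->
  \sum_(k < n) jint al (wi (hb k)) k t @[n --> \oo] --> inner (fOU_path t) h.
Proof.
move=> t0 tT; have FF := fine_partitions_filter (ltW t0).
have g0 : 0 < gam by rewrite (lt_trans _ algam)// subr_gt0.
have a0 : 0 < 1 - al by rewrite subr_gt0.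
have [L L0 wL] := holder_clamp (ltW T0) g0 wH.
have wt : holder_le t gam L wc by move=> r s *; exact: wL.
have [M M0 ke] := mlker_estimates al0 al1 T0 A.
pose Cn n : R := 2 * M * 2^-1 ^+ n.
have C0 n : 0 <= Cn n by rewrite !mulr_ge0// exprn_ge0// invr_ge0.
have vk n : volterra_kernel T (1 - al) (Cn n)
    (fun x (u : H) => (mlker al A x - mlpart al A n x) u).
  apply: (volterra_kernel_estimates (act := fun (F : bop H) u => F u) _ _ _ (ke n)).
  - by move=> F u v; rewrite linearB.
  - by [].
  - by move=> F u; exact: bop_norm_le.
pose K : R := (1 + (1 - al) / (gam - (1 - al))) * L * t `^ (gam - (1 - al)).
have X0 : vsum (fun x (u : H) => mlker al A x u) t wc s @[s --> fine_partitions 0 t] -->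
    fOU_path t.
  have := vsum_cvg a0 algam (C0 0%N) (vk 0%N) L0 (ltW t0) tT wt.
  rewrite /fOU_path; suff -> : (fun x (u : H) => (mlker al A x - mlpart al A 0 x) u) =
    (fun x (u : H) => mlker al A x u) by [].
  by apply/funext => x; apply/funext => u; rewrite /mlpart /series/= big_geq// subr0.
have bound n : `|\sum_(k < n) jint al (wi (hb k)) k t - inner (fOU_path t) h| <=
    Cn n * K * `|h|.
  have c1 : \sum_(k < n) vsum (scalar_kernel al k) t (wi (hb k)) s -
      inner (vsum (fun x (u : H) => mlker al A x u) t wc s) h
      @[s --> fine_partitions 0 t] -->
      \sum_(k < n) jint al (wi (hb k)) k t - inner (fOU_path t) h.
    apply: cvgB; last exact: inner_cvgl.
    apply: (cvg_sum_ord _ (f := fun k => vsum (scalar_kernel al k) t (wi (hb k)))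
      (l := fun k => jint al (wi (hb k)) k t)) => k; have [L' L'0 wL'] := wi_holder (hb k).
    by apply: (vsum_cvg a0 algam (mlcst_ge0 T al0 al1 k)
      (scalar_volterra_kernel al0 al1 T0 k) L'0 (ltW t0) tT) => r s *; exact: wL'.
  apply: (cvgr_to_le (cvg_norm c1)); exists 1 => //= s [[ps /eqP ls] _].
  have -> : \sum_(k < n) vsum (scalar_kernel al k) t (wi (hb k)) s =
      inner (vsum (fun x (u : H) => mlpart al A n x u) t wc s) h.
    rewrite /vsum /ksum inner_suml exchange_big/=; apply: eq_bigr => p _.
    rewrite /mlpart /series/= big_mkord bop_sum inner_suml; apply: eq_bigr => k _.
    by rewrite /scalar_kernel innerZl bpow_adjoint innerBl.
  rewrite distrC -innerBl (le_trans (inner_le _ _))// ler_wpM2r//.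
  rewrite /vsum ksum_kernelB.
  have := vk_ksum_le a0 algam (C0 n) (vk n) L0 tT (lexx 0) wt ps ls.
  by rewrite subr0 /K !mulrA.
have h1 : `|2^-1 : R| < 1 by rewrite ger0_norm ?invr_ge0// invf_lt1// ltr1n.
have h2 : Cn n * K * `|h| @[n --> \oo] --> (0 : R).
  rewrite -[X in _ --> X](mul0r (K * `|h|)).
  under eq_fun do rewrite -mulrA.
  apply: cvgMr_tmp; rewrite -[X in _ --> X](mulr0 (2 * M)).
  by apply: cvgMl_tmp; exact: cvg_expr.
apply/cvgrPdist_le => e e0.
move/cvgrPdist_le : h2 => /(_ e e0) h3.
suff : \forall n \near \oo,
  `|inner (fOU_path t) h - \sum_(k < n) jint al (wi (hb k)) k t| <= e by [].
apply: filterS h3 => n /=; rewrite sub0r normrN => /(le_trans (ler_norm _)).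
by move=> H0; rewrite distrC; exact: le_trans (bound n) H0.
Qed.

Lemma fOU_mean_weak t : 0 < t -> t <= T ->
  \sum_(k < n) inner y (bpow B k h) * fker (al * k%:R + 1) t @[n --> \oo] -->
  inner (Y t - fOU_path t) h.
Proof.
move=> t0 tT; have h1 := rem_cvg t0 tT; have h2 := fOU_path_weak t0 tT.
have h3 : yi h t - rem n 0 t - \sum_(k < n) jint al (wi (hb k)) k t @[n --> \oo] -->
    yi h t - 0 - inner (fOU_path t) h.
  by apply: cvgB => //; apply: cvgB => //; exact: cvg_cst.
rewrite innerBl -[inner (Y t) h](subr0 (yi h t)); apply: cvg_trans h3.
apply: near_eq_cvg; apply: nearW => n.
rewrite /rem /term big_split/= /yi /hb/=.
under eq_bigr do rewrite add0n.
rewrite [X in _ - (_ - (_ + X))](_ : _ = \sum_(k < n) jint al (wi (bpow B k h)) k t)//.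
by ring.
Qed.

End weak_solution.

(** * The deterministic difference between the solution and the Young integral *)

Section fOU_mean.
Context {R : realType} {H : hilbertType R}.
Variables (al gam kapp T : R) (A : bop H) (y : H).
Hypotheses (al0 : 0 < al) (al1 : al < 1) (T0 : 0 < T) (algam : 1 - al < gam).
Hypothesis kapp0 : 0 < kapp.

Lemma fine_partitions0 (s : seq R) : itv_partition 0 0 s -> s = [::].
Proof. by move=> [ps /eqP]; exact: path_lt_last_nil. Qed.

Lemma fOU_path0 (w : R -> H) : fOU_path al T A w 0 = 0.
Proof.
have FF := fine_partitions_filter (lexx (0 : R)).
have h0 : (0 : H) @[_ --> fine_partitions (0 : R) 0] --> (0 : H) by exact: cvg_cst.
apply/cvg_lim => //; apply: cvg_trans h0; apply: near_eq_cvg.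
exists 1 => //= s [/fine_partitions0 -> _].
by rewrite /vsum ksum_nil.
Qed.

Lemma fOU_solution0 (w Y : R -> H) : solves_fOU_equation T al A y w Y -> Y 0 = y.
Proof.
move=> /(_ 0); rewrite in_itv/= lexx (ltW T0) => /(_ isT).
move=> [I [J [[I' bI ->] sJ ->]]].
have -> : J = 0.
  have FF := fine_partitions_filter (lexx (0 : R)).
  apply: (cvg_unique _ sJ); first exact: norm_hausdorff.
  have h0 : (0 : H) @[_ --> fine_partitions (0 : R) 0] --> (0 : H) by exact: cvg_cst.
  apply: cvg_trans h0; apply: near_eq_cvg.
  exists 1 => //= s [/fine_partitions0 -> _].
  by rewrite /stieltjes_sum /subintervals/= big_nil.
suff -> : I' = 0 by rewrite !scaler0 linear0 !addr0.
apply: inner_inj => h; rewrite inner0l.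
have mi : measurable_fun `[(0 : R), 0] (fun s : R => inner ((0 - s) `^ (al - 1) *: Y s) h).
  by rewrite set_itv1; exact: measurable_fun_set1.
have [|_ <-] := bochner_weak _ bI mi; first exact: measurable_itv.
rewrite (@eq_Rintegral _ _ _ _ _ (cst 0)) ?Rintegral_cst ?mul0r// => s.
rewrite inE/= in_itv/= -eq_le => /eqP <-.
by rewrite subr0 powR0 ?scale0r ?inner0l// lt_eqF// subr_lt0.
Qed.

(* [Y - X] is weakly the sum of the series of [fker (al k + 1) t *: A^k y], which
   does not depend on the driving path. *)
Lemma fOU_mean_eq (w1 w2 Y1 Y2 : R -> H) t : 0 <= t -> t <= T ->
  holder_on T gam w1 -> holder_on T gam w2 ->
  holder_on T kapp Y1 -> holder_on T kapp Y2 ->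
  solves_fOU_equation T al A y w1 Y1 -> solves_fOU_equation T al A y w2 Y2 ->
  Y1 t - fOU_path al T A w1 t = Y2 t - fOU_path al T A w2 t.
Proof.
rewrite le_eqVlt => /predU1P[<- _|t0 tT] h1 h2 k1 k2 s1 s2.
  by rewrite !fOU_path0 (fOU_solution0 s1) (fOU_solution0 s2).
apply: inner_inj => h.
have m1 := fOU_mean_weak al0 al1 T0 algam kapp0 h1 k1 s1 (h := h) t0 tT.
have m2 := fOU_mean_weak al0 al1 T0 algam kapp0 h2 k2 s2 (h := h) t0 tT.
by apply: (cvg_unique _ m1 m2); exact: norm_hausdorff.
Qed.

End fOU_mean.

Lemma shift_gap_nonincreasing {R : realType} (a h x y : R) :
  0 <= a -> 0 <= h -> 0 < x -> x <= y -> shift_gap a h y <= shift_gap a h x.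
Proof.
move=> a0 h0 x0 xy.
have := @dominated_increment2 R (cst 0) (cst 0) (cst 0) (fun r => r `^ (- a))
  (fun r => - a * r `^ (- a - 1)) (fun r => - a * ((- a - 1) * r `^ (- a - 1 - 1))) x y h xy h0.
move=> H; rewrite -subr_ge0; apply: le_trans (normr_ge0 _) (H _ _ _ _ _) => {H} r /andP[xr _].
all: have r0 := lt_le_trans x0 xr.
- exact: is_derive_powR.
- exact: (is_deriveZ (- a) (is_derive_powR (- a - 1) r0)).
- rewrite normr0 mulrA mulr_ge0 ?powR_ge0// mulrC mulr_le0// ?oppr_le0//; lra.
Qed.

(** * Iterated Young integrals in two variables *)

Section iterated_volterra_integral.
Context {R : realType} {E : completeNormedModType R}.

Lemma volterra_kernel_leW (T a C C' : R) (f : R -> E -> E) : 0 < a -> C <= C' ->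
  volterra_kernel T a C f -> volterra_kernel T a C' f.
Proof.
move=> a0 CC [k1 k2 k3 k4]; split=> //.
- move=> x u x0 xT; apply: le_trans (k2 x u x0 xT) _.
  by rewrite ler_wpM2r// ler_wpM2r// powR_ge0.
- move=> x y u x0 xy yT; apply: le_trans (k3 x y u x0 xy yT) _.
  rewrite ler_wpM2r// ler_wpM2r// subr_ge0 powR_nonincreasing//.
  by rewrite oppr_le0 ltW.
- move=> x y h u x0 xy h0 yhT; apply: le_trans (k4 x y h u x0 xy h0 yhT) _.
  by rewrite ler_wpM2r// ler_wpM2r// subr_ge0 shift_gap_nonincreasing// ltW.
Qed.

Implicit Types (Q : R -> R -> E).

Definition biholder (T b L : R) Q := forall r r' s s' : R,
  0 <= r <= T -> 0 <= r' <= T -> 0 <= s <= T -> 0 <= s' <= T ->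
  [/\ `|Q r s - Q r' s| <= L * `|r - r'| `^ b,
      `|Q r s - Q r s'| <= L * `|s - s'| `^ b &
      `|Q r s - Q r' s - (Q r s' - Q r' s')| <= L * (`|r - r'| `^ b * `|s - s'| `^ b)].

Variables (T a b C : R) (f g : R -> E -> E).
Hypotheses (a0 : 0 < a) (a1 : a < 1) (ab : a < b) (C0 : 0 <= C).
Hypotheses (fK : volterra_kernel T a C f) (gK : volterra_kernel T a C g).

Definition vint2 Q (t t' : R) : E := vint f t (fun r => vint g t' (Q r)).

Variables (L : R) (Q : R -> R -> E).
Hypotheses (T0 : 0 < T) (L0 : 0 <= L) (QL : biholder T b L Q).

Let in0 : 0 <= (0 : R) <= T. Proof. by rewrite lexx ltW. Qed.

Let row_holder (r t' : R) : 0 <= r <= T -> t' <= T -> holder_le t' b L (Q r).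
Proof.
move=> rT t'T s s' s0 st s'0 s't.
by have [] // := QL rT in0 (s := s) (s' := s');
  rewrite ?s0 ?s'0 /= ?(le_trans st) ?(le_trans s't).
Qed.

Let rowB_holder (r r' t' : R) : 0 <= r <= T -> 0 <= r' <= T -> t' <= T ->
  holder_le t' b (L * `|r - r'| `^ b) (fun s => Q r s - Q r' s).
Proof.
move=> rT rT' t'T s s' s0 st s'0 s't; rewrite -mulrA.
by have [] // := QL rT rT' (s := s) (s' := s');
  rewrite ?s0 ?s'0 /= ?(le_trans st) ?(le_trans s't).
Qed.

Let LrL (r r' : R) : 0 <= L * `|r - r'| `^ b. Proof. by rewrite mulr_ge0 ?powR_ge0. Qed.

Let vint_rowB (r r' t' : R) : 0 <= r <= T -> 0 <= r' <= T -> 0 <= t' -> t' <= T ->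
  vint g t' (Q r) - vint g t' (Q r') = vint g t' (fun s => Q r s - Q r' s).
Proof.
move=> rT rT' t'0 t'T.
by rewrite (vintB a0 ab C0 gK L0 L0 t'0 t'T (row_holder rT t'T) (row_holder rT' t'T)).
Qed.

Let K1 : R := C * (1 + a / (b - a)) * T `^ (b - a).
Let ba0 : 0 < b - a. Proof. by rewrite subr_gt0. Qed.
Let K10 : 0 <= K1.
Proof. by rewrite mulr_ge0 ?powR_ge0// mulr_ge0// addr_ge0// divr_ge0// ltW. Qed.

Let powT (t : R) : 0 <= t -> t <= T -> t `^ (b - a) <= T `^ (b - a).
Proof. by move=> t0 tT; rewrite ge0_ler_powR ?nnegrE ?(ltW ba0) ?(ltW T0). Qed.

Let K1_le (M t : R) : 0 <= M -> 0 <= t -> t <= T ->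
  C * (1 + a / (b - a)) * M * t `^ (b - a) <= K1 * M.
Proof.
move=> M0 t0 tT; rewrite /K1 [leRHS]mulrAC ler_wpM2l ?powT//.
by rewrite mulr_ge0// mulr_ge0// addr_ge0// divr_ge0// ltW.
Qed.

Let bar_itv (t r : R) : t <= T -> 0 <= r -> r <= t -> 0 <= r <= T.
Proof. by move=> tT -> rt; exact: le_trans tT. Qed.

(** By linearity the increment in [r] is the inner integral of a difference of rows, and rectangular
    increments make that difference Hölder with constant [L |r - r'|^b]. *)
Let col_holder (t t' : R) : t <= T -> 0 <= t' -> t' <= T ->
  holder_le t b (K1 * L) (fun r => vint g t' (Q r)).
Proof.
move=> tT t'0 t'T r r' r0 rt r'0 r't.
have [rT rT'] := (bar_itv tT r0 rt, bar_itv tT r'0 r't).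
rewrite vint_rowB// (le_trans (vint_le a0 ab C0 gK (LrL r r') t'0 t'T (rowB_holder rT rT' t'T)))//.
by rewrite -[leRHS]mulrA; exact: K1_le.
Qed.

Let K1L : 0 <= K1 * L. Proof. exact: mulr_ge0 K10 L0. Qed.

Let kap : R := (b - a) / 2.
Let K2 : R := C * (a / kap) * T `^ kap.
Let kap0 : 0 < kap. Proof. by rewrite divr_gt0. Qed.
Let K20 : 0 <= K2.
Proof. by rewrite mulr_ge0 ?powR_ge0// mulr_ge0// divr_ge0// ltW. Qed.

(** The inner sum is replaced by the inner integral, then the outer sum by the outer integral. In
    the first replacement a small error would not survive the singular outer kernel; but, as a
    function of [r], the error is Hölder of exponent [b] with a constant of order [D^kap], which the
    bound on left-point sums accepts. *)
Lemma vint2_cvg (t t' : R) : 0 <= t -> t <= T -> 0 <= t' -> t' <= T ->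
  vsum f t (fun r => vsum g t' (Q r) s.2) s.1
    @[s --> filter_prod (fine_partitions 0 t) (fine_partitions 0 t')] --> vint2 Q t t'.
Proof.
move=> t0 tT t'0 t'T.
have FF := fine_partitions_filter t0; have FF' := fine_partitions_filter t'0.
pose M : R := K1 * (L * K2) + K1 * L * K2.
have M0 : 0 <= M by rewrite addr_ge0// mulr_ge0// mulr_ge0.
have bound (D : R) (s s' : seq R) : 0 < D -> itv_partition 0 t s -> mesh 0 s <= D ->
    itv_partition 0 t' s' -> mesh 0 s' <= D ->
    `|vsum f t (fun r => vsum g t' (Q r) s') s - vint2 Q t t'| <= M * D `^ kap.
  move=> D0 ps ms ps' ms'.
  have -> : vsum f t (fun r => vsum g t' (Q r) s') s - vint2 Q t t' =
     (vsum f t (fun r => vsum g t' (Q r) s') s - vsum f t (fun r => vint g t' (Q r)) s) +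
     (vsum f t (fun r => vint g t' (Q r)) s - vint2 Q t t').
    by rewrite addrA subrK.
  apply: le_trans (ler_normD _ _) _; rewrite /M mulrDl; apply: lerD; last first.
    exact: (vsum_vint_le a0 ab C0 fK K1L tT (col_holder tT t'0 t'T) D0 ps ms).
  rewrite /vsum -ksumB; last by move=> u x y; exact: (vkB fK).
  have LK : 0 <= L * K2 * D `^ kap.
    exact: mulr_ge0 (mulr_ge0 L0 K20) (powR_ge0 _ _).
  have [pps /eqP lps] := ps.
  have := @vk_ksum_le _ _ T a b C a0 ab C0 f
     (fun r => ksum (fun u => g (t' - u)) (Q r) 0 s' - vint g t' (Q r))
     (L * K2 * D `^ kap) t 0 s fK LK tT (lexx 0) _ pps lps.
  rewrite subr0 => H0; apply: le_trans (H0 _) _; last first.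
    by apply: le_trans (K1_le LK t0 tT) _; rewrite mulrA.
  move=> r r' r0 rt r'0 r't.
  have [rT rT'] := (bar_itv tT r0 rt, bar_itv tT r'0 r't).
  have -> : ksum (fun u => g (t' - u)) (Q r) 0 s' - vint g t' (Q r) -
     (ksum (fun u => g (t' - u)) (Q r') 0 s' - vint g t' (Q r')) =
     vsum g t' (fun s => Q r s - Q r' s) s' - vint g t' (fun s => Q r s - Q r' s).
    rewrite -vint_rowB// /vsum ksumB; last by move=> u x y; exact: (vkB gK).
    by rewrite !opprD !opprK addrACA.
  have := vsum_vint_le a0 ab C0 gK (LrL r r') t'T (rowB_holder rT rT' t'T) D0 ps' ms'.
  rewrite -/kap -/K2; move=> /le_trans; apply.
  by rewrite le_eqVlt; apply/orP; left; apply/eqP; ring.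
apply/cvgrPdist_le => e e0.
have [D D0 De] := small_powR kap0 M0 e0.
exists ([set s | itv_partition 0 t s /\ mesh 0 s < D],
        [set s | itv_partition 0 t' s /\ mesh 0 s < D]) => /=.
  by split; exists D.
move=> [s s'] /= [[ps ms] [ps' ms']]; rewrite distrC.
by apply: le_trans (bound D s s' D0 ps (ltW ms) ps' (ltW ms')) (ltW De).
Qed.

Variable eta : R.
Hypotheses (eta0 : 0 < eta) (eta1 : eta <= 1) (aeb : a + eta < b).

Let K3 : R := vint_holder_cst T a b C eta.

Let K30 : 0 <= K3.
Proof.
have d0 : 0 < b - a - eta by move: aeb; lra.
rewrite /K3 /vint_holder_cst -mulrDl mulr_ge0 ?powR_ge0//.
by rewrite -mulrDr mulr_ge0// !addr_ge0// divr_ge0// ltW.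
Qed.

Let gap_holder (t s' t' : R) : t <= T -> 0 <= s' -> s' <= t' -> t' <= T ->
  holder_le t b (K3 * L * (t' - s') `^ eta)
    (fun r => vint g t' (Q r) - vint g s' (Q r)).
Proof.
move=> tT s'0 s't t'T r r' r0 rt r'0 r't.
have [rT rT'] := (bar_itv tT r0 rt, bar_itv tT r'0 r't).
have t'0 := le_trans s'0 s't; have s'T := le_trans s't t'T.
have -> : vint g t' (Q r) - vint g s' (Q r) - (vint g t' (Q r') - vint g s' (Q r')) =
   (vint g t' (Q r) - vint g t' (Q r')) - (vint g s' (Q r) - vint g s' (Q r')).
  by rewrite !opprD !opprK addrACA.
rewrite !vint_rowB//.
have := vint_holder a0 a1 ab C0 gK (LrL r r') s'0 s't t'T eta0 eta1 aeb (rowB_holder rT rT' t'T).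
move=> /le_trans; apply; rewrite -/K3.
by rewrite le_eqVlt; apply/orP; left; apply/eqP; ring.
Qed.

Let K3L (t : R) : 0 <= K3 * L * t `^ eta.
Proof. exact: mulr_ge0 (mulr_ge0 K30 L0) (powR_ge0 _ _). Qed.

Let vint2B (s' t' t : R) : 0 <= t -> t <= T -> 0 <= s' -> s' <= T -> 0 <= t' -> t' <= T ->
  vint2 Q t t' - vint2 Q t s' = vint f t (fun r => vint g t' (Q r) - vint g s' (Q r)).
Proof.
move=> t0 tT s'0 s'T t'0 t'T.
by rewrite (vintB a0 ab C0 fK K1L K1L t0 tT (col_holder tT t'0 t'T) (col_holder tT s'0 s'T)).
Qed.

(** Each estimate combines a bound on size or on increments in the outer variable with one in the
    inner variable; the three summands of [M] are the three combinations that occur. *)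
Lemma vint2_incr : exists2 M, 0 <= M &
  [/\ forall s t t' : R, 0 <= s -> s <= t -> t <= T -> 0 <= t' -> t' <= T ->
        `|vint2 Q t t' - vint2 Q s t'| <= M * (t - s) `^ eta,
      forall t s' t' : R, 0 <= t -> t <= T -> 0 <= s' -> s' <= t' -> t' <= T ->
        `|vint2 Q t t' - vint2 Q t s'| <= M * (t' - s') `^ eta &
      forall s t s' t' : R, 0 <= s -> s <= t -> t <= T -> 0 <= s' -> s' <= t' -> t' <= T ->
        `|vint2 Q t t' - vint2 Q t s' - (vint2 Q s t' - vint2 Q s s')| <=
        M * ((t - s) `^ eta * (t' - s') `^ eta)].
Proof.
pose M := K3 * (K1 * L) + K1 * (K3 * L) + K3 * (K3 * L).
have m1 : 0 <= K3 * (K1 * L) := mulr_ge0 K30 (mulr_ge0 K10 L0).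
have m2 : 0 <= K1 * (K3 * L) := mulr_ge0 K10 (mulr_ge0 K30 L0).
have m3 : 0 <= K3 * (K3 * L) := mulr_ge0 K30 (mulr_ge0 K30 L0).
exists M; first by rewrite !addr_ge0.
split.
- move=> s t t' s0 st tT t'0 t'T.
  have := vint_holder a0 a1 ab C0 fK K1L s0 st tT eta0 eta1 aeb (col_holder tT t'0 t'T).
  move=> /le_trans; apply; rewrite ler_wpM2r ?powR_ge0// /M -addrA lerDl addr_ge0//.
- move=> t s' t' t0 tT s'0 s't t'T.
  have t'0 := le_trans s'0 s't; have s'T := le_trans s't t'T.
  rewrite vint2B//.
  apply: le_trans (vint_le a0 ab C0 fK (K3L _) t0 tT (gap_holder tT s'0 s't t'T)) _.
  apply: le_trans (K1_le (K3L _) t0 tT) _.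
  rewrite mulrA ler_wpM2r ?powR_ge0// /M addrAC lerDr addr_ge0//.
- move=> s t s' t' s0 st tT s'0 s't t'T.
  have t'0 := le_trans s'0 s't; have s'T := le_trans s't t'T.
  have sT := le_trans st tT; have t0 := le_trans s0 st.
  rewrite !vint2B//.
  have := vint_holder a0 a1 ab C0 fK (K3L _) s0 st tT eta0 eta1 aeb (gap_holder tT s'0 s't t'T).
  move=> /le_trans; apply; rewrite -/K3.
  have -> : K3 * (K3 * L * (t' - s') `^ eta) * (t - s) `^ eta =
    K3 * (K3 * L) * ((t - s) `^ eta * (t' - s') `^ eta) by ring.
  by rewrite ler_wpM2r ?mulr_ge0 ?powR_ge0// /M lerDr addr_ge0.
Qed.

End iterated_volterra_integral.

(** * The regularity class and two-parameter Hölder bounds *)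

Section regularity_class.
Context {R : realType} {H : hilbertType R}.
Variables (T b : R) (Q : R -> R -> bop H).
Hypothesis T0 : 0 < T.

Let i0 : (0 : R) \in `[0, T]. Proof. by rewrite in_itv/= lexx ltW. Qed.
Let iT : T \in `[0, T]. Proof. by rewrite in_itv/= lexx ltW. Qed.

(** A finite sum bounds its terms once these are nonnegative, and a supremum of nonnegative
    quotients is nonnegative only if some quotient exists; the pair [0 < T] supplies one for each
    supremum. *)
Lemma Qclass_bound : Qclass T b Q -> exists2 L, 0 <= L &
  [/\ forall z, holder_quotients1 T b Q z -> z <= L,
      forall z, holder_quotients2 T b Q z -> z <= L &
      forall z, holder_quotients12 T b Q z -> z <= L].
Proof.
have ge0 (S : set R) z : S z -> 0 <= z -> (0 <= ereal_sup (EFin @` S))%E.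
  move=> Sz z0; apply: (@le_trans _ _ z%:E); first by rewrite lee_fin.
  by apply: ereal_sup_ubound; exists z.
rewrite /Qclass/= /Qnorm.
have p1 := ge0 (holder_quotients1 T b Q) _
  (ex_intro _ 0 (ex_intro _ T (ex_intro _ 0 (And5 i0 iT i0 T0 erefl)))).
have p2 := ge0 (holder_quotients2 T b Q) _
  (ex_intro _ 0 (ex_intro _ 0 (ex_intro _ T (And5 i0 i0 iT T0 erefl)))).
have p3 := ge0 (holder_quotients12 T b Q) _
  (ex_intro _ 0 (ex_intro _ T (ex_intro _ 0 (ex_intro _ T (And5 (conj i0 iT) (conj i0 iT) T0 T0 erefl))))).
have {}p1 := p1 (divr_ge0 (normr_ge0 _) (powR_ge0 _ _)).
have {}p2 := p2 (divr_ge0 (normr_ge0 _) (powR_ge0 _ _)).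
have {}p3 := p3 (divr_ge0 (normr_ge0 _) (powR_ge0 _ _)).
have ub (S : set R) (M : R) : (ereal_sup (EFin @` S) <= M%:E)%E -> forall z, S z -> z <= M.
  by move=> SM z Sz; rewrite -lee_fin (le_trans _ SM)// ereal_sup_ubound//; exists z.
move: p1 p2 p3 (ub (holder_quotients1 T b Q)) (ub (holder_quotients2 T b Q))
  (ub (holder_quotients12 T b Q)).
move: (ereal_sup _) (ereal_sup _) (ereal_sup _).
move=> [x| |] [y| |] [z| |] //=; rewrite !lee_fin => x0 y0 z0 h1 h2 h3 _.
exists (x + y + z); first by rewrite !addr_ge0.
split=> v vS.
- by apply: h1 vS; rewrite lee_fin; lra.
- by apply: h2 vS; rewrite lee_fin; lra.
- by apply: h3 vS; rewrite lee_fin; lra.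
Qed.

Lemma Qclass_biholder : 0 < b -> Qclass T b Q -> exists2 L, 0 <= L & biholder T b L Q.
Proof.
move=> b0 /Qclass_bound[L L0 [q1 q2 q12]]; exists L => //.
have b0' : b != 0 by rewrite gt_eqF.
have h1 (r r' s : R) : 0 <= r <= T -> 0 <= r' <= T -> 0 <= s <= T -> r' < r ->
    `|Q r s - Q r' s| <= L * `|r - r'| `^ b.
  move=> rT rT' sT rr; rewrite -ler_pdivrMr; last first.
    by rewrite powR_gt0// normr_gt0 subr_eq0 gt_eqF.
  by apply: q1; exists r', r, s; split; rewrite ?in_itv.
have h2 (r s s' : R) : 0 <= r <= T -> 0 <= s <= T -> 0 <= s' <= T -> s' < s ->
    `|Q r s - Q r s'| <= L * `|s - s'| `^ b.
  move=> rT sT sT' ss; rewrite -ler_pdivrMr; last first.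
    by rewrite powR_gt0// normr_gt0 subr_eq0 gt_eqF.
  by apply: q2; exists r, s', s; split; rewrite ?in_itv.
have h3 (r r' s s' : R) : 0 <= r <= T -> 0 <= r' <= T -> 0 <= s <= T -> 0 <= s' <= T ->
    r' < r -> s' < s ->
    `|Q r s - Q r' s - (Q r s' - Q r' s')| <= L * (`|r - r'| `^ b * `|s - s'| `^ b).
  move=> rT rT' sT sT' rr ss; rewrite -ler_pdivrMr; last first.
    by rewrite mulr_gt0// powR_gt0// normr_gt0 subr_eq0 gt_eqF.
  apply: q12; exists r', r, s', s; split; rewrite ?in_itv//=.
  rewrite powRM//; congr (`|_| / _); rewrite /rect_incr opprB addrA.
  by rewrite addrAC; congr (_ + _); rewrite -!addrA; congr (_ + _); rewrite addrC.
move=> r r' s s' rT rT' sT sT'; split.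
- have [->|/lt_total/orP[lt|lt]] := eqVneq r r'.
  + by rewrite !subrr !normr0 mulr_ge0 ?powR_ge0.
  + by rewrite distrC [`|r - r'|]distrC; exact: h1.
  + exact: h1.
- have [->|/lt_total/orP[lt|lt]] := eqVneq s s'.
  + by rewrite !subrr !normr0 mulr_ge0 ?powR_ge0.
  + by rewrite distrC [`|s - s'|]distrC; exact: h2.
  + exact: h2.
- have [->|/lt_total/orP[lr|lr]] := eqVneq r r'.
  + by rewrite !subrr normr0 !mulr_ge0 ?powR_ge0.
  + have [->|/lt_total/orP[ls|ls]] := eqVneq s s'.
    * by rewrite !subrr normr0 !mulr_ge0 ?powR_ge0.
    * have := h3 r' r s' s rT' rT sT' sT lr ls.
      rewrite [`|r' - r|]distrC [`|s' - s|]distrC; congr (`|_| <= _).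
      by rewrite !opprB !addrA; zmodule.
    * have -> : Q r s - Q r' s - (Q r s' - Q r' s') =
        - (Q r' s - Q r s - (Q r' s' - Q r s')) by zmodule.
      by rewrite normrN [`|r - r'|]distrC; exact: h3.
  + have [->|/lt_total/orP[ls|ls]] := eqVneq s s'.
    * by rewrite !subrr normr0 !mulr_ge0 ?powR_ge0.
    * have -> : Q r s - Q r' s - (Q r s' - Q r' s') =
        - (Q r s' - Q r' s' - (Q r s - Q r' s)) by zmodule.
      by rewrite normrN [`|s - s'|]distrC; exact: h3.
    * exact: h3.
Qed.

Lemma le_Qclass (M : R) : 0 <= M ->
  [/\ forall s t t' : R, 0 <= s -> s <= t -> t <= T -> 0 <= t' -> t' <= T ->
        `|Q t t' - Q s t'| <= M * (t - s) `^ b,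
      forall t s' t' : R, 0 <= t -> t <= T -> 0 <= s' -> s' <= t' -> t' <= T ->
        `|Q t t' - Q t s'| <= M * (t' - s') `^ b &
      forall s t s' t' : R, 0 <= s -> s <= t -> t <= T -> 0 <= s' -> s' <= t' -> t' <= T ->
        `|Q t t' - Q t s' - (Q s t' - Q s s')| <=
        M * ((t - s) `^ b * (t' - s') `^ b)] -> Qclass T b Q.
Proof.
move=> M0 [h1 h2 h3]; rewrite /Qclass/= /Qnorm.
have fin (S : set R) : (forall z, S z -> z <= M) -> (ereal_sup (EFin @` S) <= M%:E)%E.
  by move=> SM; apply: ge_ereal_sup => _ [z Sz <-]; rewrite lee_fin SM.
apply: (@le_lt_trans _ _ (M%:E + M%:E + M%:E)%E); last by rewrite -!EFinD ltry.
apply: leeD; [apply: leeD|]; apply: fin => z.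
- move=> [s [t [t' []]]]; rewrite !in_itv/= => /andP[s0 sT] /andP[t0 tT] /andP[t'0 t'T] st ->.
  rewrite ler_pdivrMr ?powR_gt0 ?normr_gt0 ?subr_eq0 ?gt_eqF//.
  by rewrite gtr0_norm ?subr_gt0//; apply: h1 => //; exact: ltW.
- move=> [t [s' [t' []]]]; rewrite !in_itv/= => /andP[t0 tT] /andP[s0 sT] /andP[t'0 t'T] st ->.
  rewrite ler_pdivrMr ?powR_gt0 ?normr_gt0 ?subr_eq0 ?gt_eqF//.
  by rewrite gtr0_norm ?subr_gt0//; apply: h2 => //; exact: ltW.
- move=> [s [t [s' [t' [[]]]]]]; rewrite !in_itv/= => /andP[s0 sT] /andP[t0 tT].
  move=> [/andP[s'0 s'T] /andP[t'0 t'T]] st st' ->.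
  rewrite ler_pdivrMr ?powR_gt0 ?mulr_gt0 ?normr_gt0 ?subr_eq0 ?gt_eqF//.
  rewrite !gtr0_norm ?subr_gt0// powRM ?subr_ge0 ?(ltW st) ?(ltW st')//.
  have := h3 s t s' t' s0 (ltW st) tT s'0 (ltW st') t'T.
  by rewrite /rect_incr; congr (`|_| <= _); zmodule.
Qed.

End regularity_class.

(** * The covariance as a double integral of operators *)

Section covariance_integral.
Context {R : realType} {H : hilbertType R}.
Variables (al T : R) (A : bop H).
Hypotheses (al0 : 0 < al) (al1 : al < 1) (T0 : 0 < T).

Let f (x : R) (U : bop H) : bop H := bcomp (mlker al A x) U.
Let g (x : R) (U : bop H) : bop H := bcomp U (mlker al (adjoint A) x).

Definition covint (Q : R -> R -> bop H) (t t' : R) : bop H := vint2 f g Q t t'.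

Lemma covariance_kernels : exists2 C, 0 <= C &
  volterra_kernel T (1 - al) C f /\ volterra_kernel T (1 - al) C g.
Proof.
have [M M0 ke] := mlker_estimates al0 al1 T0 A.
have [M' M'0 ke'] := mlker_estimates al0 al1 T0 (adjoint A).
have part0 (B : bop H) x : mlker al B x - mlpart al B 0 x = mlker al B x.
  by rewrite /mlpart /series/= big_geq// subr0.
have C1 : 0 <= 2 * M * 2^-1 ^+ 0 by rewrite expr0 mulr1 mulr_ge0.
have C2 : 0 <= 2 * M' * 2^-1 ^+ 0 by rewrite expr0 mulr1 mulr_ge0.
have vf : volterra_kernel T (1 - al) (2 * M * 2^-1 ^+ 0) f.
  have -> : f = fun x => bcomp (mlker al A x - mlpart al A 0 x).
    by apply/funext => x; rewrite part0.
  apply: (volterra_kernel_estimates _ _ _ (ke 0%N)).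
  - by move=> B U V; rewrite bcompBr.
  - by move=> U B B'; rewrite bcompBl.
  - by move=> B U; exact: norm_bcomp.
have vg : volterra_kernel T (1 - al) (2 * M' * 2^-1 ^+ 0) g.
  have -> : g = fun x => (fun B U => bcomp U B)
      (mlker al (adjoint A) x - mlpart al (adjoint A) 0 x).
    by apply/funext => x; rewrite part0.
  apply: (volterra_kernel_estimates (act := fun B U => bcomp U B) _ _ _ (ke' 0%N)).
  - by move=> B U V; rewrite bcompBl.
  - by move=> U B B'; rewrite bcompBr.
  - by move=> B U; rewrite mulrC; exact: norm_bcomp.
pose C : R := 2 * M * 2^-1 ^+ 0 + 2 * M' * 2^-1 ^+ 0.
have a0 : 0 < 1 - al by rewrite subr_gt0.
exists C; first exact: addr_ge0.
by split; [apply: volterra_kernel_leW vf|apply: volterra_kernel_leW vg];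
  rewrite ?lerDl ?lerDr.
Qed.

Lemma bcomp_sumr (F : bop H) I (s : seq I) (Z : I -> bop H) :
  bcomp F (\sum_(i <- s) Z i) = \sum_(i <- s) bcomp F (Z i).
Proof.
apply: bopP => x; rewrite bop_sum/= bop_sum linear_sum/=.
by apply: eq_bigr.
Qed.

(** Left composition in the first variable and right composition in the second make the double sum
    an iterated left-point sum, to which the results on [vint2] apply. *)
Lemma double_sum_vsum (Q : R -> R -> bop H) t t' s s' :
  double_sum (ML_kernel al A t) Q (ML_kernel al (adjoint A) t') s s' =
  vsum f t (fun r => vsum g t' (Q r) s') s.
Proof.
rewrite /double_sum /vsum /ksum; apply: eq_bigr => p _.
rewrite /f ML_kernelE -sumrB bcomp_sumr; apply: eq_bigr => q _.
congr bcomp; rewrite /g ML_kernelE -bcompBl; congr (bcomp _ _).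
by rewrite /rect_incr; zmodule.
Qed.

Variables (b : R) (Q : R -> R -> bop H).
Hypotheses (alb : 1 - al < b) (Qb : Qclass T b Q).

Let a0 : 0 < 1 - al. Proof. by rewrite subr_gt0. Qed.
Let a1 : 1 - al < 1. Proof. by rewrite gtrBl. Qed.
Let b0 : 0 < b. Proof. exact: lt_trans a0 alb. Qed.

Lemma covint_double_integral t t' : 0 <= t <= T -> 0 <= t' <= T ->
  is_double_integral t t' (ML_kernel al A t) Q (ML_kernel al (adjoint A) t')
    (covint Q t t').
Proof.
move=> /andP[t0 tT] /andP[t'0 t'T].
have [C C0 [vf vg]] := covariance_kernels; have [L L0 QL] := Qclass_biholder T0 b0 Qb.
have := vint2_cvg a0 alb C0 vf vg T0 L0 QL t0 tT t'0 t'T.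
rewrite /is_double_integral; set h := fun _ => _.
suff -> : h = fun s => double_sum (ML_kernel al A t) Q (ML_kernel al (adjoint A) t') s.1 s.2
  by [].
by apply/funext => s; rewrite double_sum_vsum.
Qed.

Lemma covint_Qclass eta : 0 < eta -> eta <= 1 -> 1 - al + eta < b ->
  Qclass T eta (covint Q).
Proof.
move=> e0 e1 aeb.
have [C C0 [vf vg]] := covariance_kernels; have [L L0 QL] := Qclass_biholder T0 b0 Qb.
have [M M0 h] := vint2_incr a0 a1 alb C0 vf vg T0 L0 QL e0 e1 aeb.
exact: le_Qclass M0 h.
Qed.

End covariance_integral.

(** * Square integrable variables and limits of second moments *)

Section square_integrable_limits.
Context d (Omega : measurableType d) {R : realType} (P : probability Omega R).
Implicit Types X Y Z : Omega -> R.

Definition L2 X := measurable_fun [set: Omega] X /\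
  P.-integrable [set: Omega] (EFin \o (fun w => X w ^+ 2)).

Lemma le_integrableT (f g : Omega -> R) : measurable_fun [set: Omega] f ->
  (forall w, `|f w| <= g w) -> P.-integrable [set: Omega] (EFin \o g) ->
  P.-integrable [set: Omega] (EFin \o f).
Proof.
by move=> mf fg gi; have [] := dominated_Rintegral measurableT mf (fun w _ => fg w) gi.
Qed.

Lemma L2M X Y : L2 X -> L2 Y -> P.-integrable [set: Omega] (EFin \o (fun w => X w * Y w)).
Proof.
move=> [mX iX] [mY iY]; apply: (@le_integrableT _ (fun w => X w ^+ 2 + Y w ^+ 2)).
- exact: measurable_funM.
- move=> w; rewrite ler_norml; move: (X w) (Y w) => x y.
  have h1 := sqr_ge0 (x + y); have h2 := sqr_ge0 (x - y).
  by apply/andP; split; nra.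
- exact: (integrableD measurableT iX iY).
Qed.

Lemma L2D X Y : L2 X -> L2 Y -> L2 (fun w => X w + Y w).
Proof.
move=> X2 Y2; split; first by apply: measurable_funD; [exact: X2.1|exact: Y2.1].
apply: (@le_integrableT _ (fun w => 2 * (X w ^+ 2 + Y w ^+ 2))).
- by apply: measurable_funX; apply: measurable_funD; [exact: X2.1|exact: Y2.1].
- move=> w; rewrite ger0_norm ?sqr_ge0//; have := sqr_ge0 (X w - Y w).
  by move: (X w) (Y w) => x y; nra.
- exact: (integrableZl measurableT 2 (integrableD measurableT X2.2 Y2.2)).
Qed.

Lemma L2Z c X : L2 X -> L2 (fun w => c * X w).
Proof.
move=> X2; split; first by apply: measurable_funM => //; exact: X2.1.
have := integrableZl measurableT (c ^+ 2) X2.2; apply: eq_integrable => // w _ /=.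
by rewrite -EFinM exprMn.
Qed.

Lemma L2B X Y : L2 X -> L2 Y -> L2 (fun w => X w - Y w).
Proof.
move=> X2 Y2; have := L2D X2 (L2Z (-1) Y2).
by under eq_fun do rewrite mulN1r.
Qed.

Lemma L2_integrable X : L2 X -> P.-integrable [set: Omega] (EFin \o X).
Proof.
move=> [mX iX]; apply: (@le_integrableT _ (fun w => X w ^+ 2 + 1)) => //.
  move=> w; rewrite ler_norml; apply/andP; split.
    by have := sqr_ge0 (X w + 1); move: (X w) => x; nra.
  by have := sqr_ge0 (X w - 1); move: (X w) => x; nra.
have i1 : P.-integrable [set: Omega] (EFin \o cst 1).
  exact: finite_measure_integrable_cst.
exact: (integrableD measurableT iX i1).
Qed.

Lemma fatou_le (f_ : nat -> Omega -> R) (f : Omega -> R) (M : \bar R) :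
  (forall n, measurable_fun [set: Omega] (f_ n)) -> (forall n w, 0 <= f_ n w) ->
  (forall w, f_ n w @[n --> \oo] --> f w) ->
  (forall n, \int[P]_w (f_ n w)%:E <= M)%E -> (\int[P]_w (f w)%:E <= M)%E.
Proof.
move=> mf f0 ff fM.
have := @fatou _ _ _ P _ measurableT (fun n w => (f_ n w)%:E).
move=> /(_ (fun n => (measurable_EFinP _ _).2 (mf n))) /(_ (fun n w _ => f0 n w)).
rewrite (_ : (\int[P]_w limn_einf _)%E = \int[P]_w (f w)%:E)%E; last first.
  apply: eq_integral => w _; apply: (cvg_limn_einf_sup _).1.
  by apply: cvg_EFin; [exact: nearW|exact: ff].
move=> /le_trans; apply; rewrite limn_einf_lim; apply: lime_le; first exact: is_cvg_einfs.
apply: nearW => n; apply: le_trans (fM n); apply: ereal_inf_lbound.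
by exists n => //=.
Qed.

(** If all mixed moments tend to [c], then [E (Z_n - Z_m)^2] tends to [c - 2 c + c = 0]; Fatou in
    [m] then bounds [E (Z_n - Z)^2]. *)
Lemma L2_cvg (Z_ : nat -> Omega -> R) (Z : Omega -> R) (c : R) :
  (forall n, L2 (Z_ n)) -> (forall w, Z_ n w @[n --> \oo] --> Z w) ->
  (forall e, 0 < e -> exists N, forall n m, (N <= n)%N -> (N <= m)%N ->
     `|\int[P]_w (Z_ n w * Z_ m w) - c| <= e) ->
  [/\ L2 Z, \int[P]_w (Z w ^+ 2) = c &
      (forall n, \int[P]_w Z_ n w = 0) -> \int[P]_w Z w = 0].
Proof.
move=> Z2 ZZ Zc.
have mZ : measurable_fun [set: Omega] Z.
  by apply: (measurable_fun_cvg (h := Z_)) => [n|w _]; [exact: (Z2 n).1|exact: ZZ].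
have diff e : 0 < e -> exists N, forall n, (N <= n)%N ->
    (\int[P]_w ((Z_ n w - Z w) ^+ 2)%:E <= e%:E)%E /\
    `|\int[P]_w (Z_ n w ^+ 2) - c| <= e.
  move=> e0; have e4 : 0 < e / 4 by rewrite divr_gt0.
  have [N HN] := Zc _ e4; exists N => n Nn; split; last first.
    have := HN n n Nn Nn; under eq_Rintegral do rewrite -expr2.
    by move=> h; lra.
  apply: (@fatou_le (fun m w => (Z_ n w - Z_ (m + N)%N w) ^+ 2)
    (fun w => (Z_ n w - Z w) ^+ 2)).
  - move=> m; apply: measurable_funX; apply: measurable_funB; exact: (Z2 _).1.
  - by move=> m w; exact: sqr_ge0.
  - move=> w; have h : Z_ n w - Z_ (m + N)%N w @[m --> \oo] --> Z_ n w - Z w.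
      apply: cvgB; first exact: cvg_cst.
      by have := ZZ w; rewrite -(cvg_shiftn N).
    under eq_fun do rewrite expr2.
    by rewrite expr2; exact: cvgM.
  move=> m; have Nm : (N <= m + N)%N by rewrite leq_addl.
  have i1 := L2M (Z2 n) (Z2 n); have i2 := L2M (Z2 n) (Z2 (m + N)%N).
  have i3 := L2M (Z2 (m + N)%N) (Z2 (m + N)%N).
  have -> : (fun w => ((Z_ n w - Z_ (m + N)%N w) ^+ 2)%:E) =
     EFin \o (fun w => (Z_ n w * Z_ n w + Z_ (m + N)%N w * Z_ (m + N)%N w) -
       2 * (Z_ n w * Z_ (m + N)%N w)).
    by apply/funext => w /=; congr EFin; ring.
  have i4 := integrableD measurableT i1 i3.
  have i5 := integrableZl measurableT 2 i2.
  rewrite -[leLHS]fineK; last by apply: integrable_fin_num => //; exact: (integrableB measurableT i4 i5).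
  rewrite lee_fin -/(Rintegral _ _ _) (RintegralB measurableT i4 i5).
  rewrite (RintegralD measurableT i1 i3) (RintegralZl 2 measurableT i2).
  have := HN n n Nn Nn; have := HN n _ Nn Nm; have := HN _ _ Nm Nm.
  rewrite !ler_norml; move: (Rintegral _ _ _) (Rintegral _ _ _) (Rintegral _ _ _) => p q r.
  by move=> /andP[h1 h2] /andP[h3 h4] /andP[h5 h6]; lra.
have dL2 e : 0 < e -> exists N, forall n, (N <= n)%N ->
    [/\ L2 (fun w => Z_ n w - Z w), \int[P]_w (Z_ n w - Z w) ^+ 2 <= e &
       `|\int[P]_w (Z_ n w ^+ 2) - c| <= e].
  move=> e0; have [N HN] := diff _ e0; exists N => n /HN[h1 h2].
  have mm : measurable_fun [set: Omega] (fun w => (Z_ n w - Z w) ^+ 2).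
    by apply: measurable_funX; apply: measurable_funB => //; exact: (Z2 n).1.
  have i1 : P.-integrable [set: Omega] (EFin \o (fun w => (Z_ n w - Z w) ^+ 2)).
    apply/integrableP; split; first exact/measurable_EFinP.
    apply: (@le_lt_trans _ _ e%:E); last exact: ltry.
    apply: le_trans h1; rewrite le_eqVlt; apply/orP; left; apply/eqP.
    by apply: eq_integral => w _; rewrite gee0_abs// lee_fin sqr_ge0.
  split=> //.
    by split=> //; apply: measurable_funB => //; exact: (Z2 n).1.
  rewrite -lee_fin; apply: le_trans h1; rewrite /Rintegral fineK//.
  by apply: integrable_fin_num.
have Zn2 : L2 Z.
  have [N /(_ N (leqnn N))[h1 _ _]] := dL2 1 ltr01.
  have := L2B (Z2 N) h1; congr L2.
  by apply/funext => w; rewrite opprB addrC subrK.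
split=> //.
- apply/eqP; rewrite -subr_eq0 -normr_le0; apply/ler_addgt0Pr => e e0; rewrite add0r.
  (* [dl] is the weight in the inequality for the cross term [2 y (y - x)]: it makes [dl E Z_N^2] at
     most [e / 4], and [e'] is then so small that [(1 + 1 / dl) e'] is at most [e / 2]. *)
  pose dl := Num.min 1 (e / (4 * (`|c| + 2))).
  have c2 : 0 < 4 * (`|c| + 2) by rewrite mulr_gt0// ltr_wpDl.
  have dl0 : 0 < dl by rewrite lt_min ltr01 divr_gt0.
  have dl1 : dl <= 1 by rewrite ge_min lexx.
  have dlc : dl * (`|c| + 2) <= e / 4.
    have : dl <= e / (4 * (`|c| + 2)) by rewrite ge_min lexx orbT.
    rewrite ler_pdivlMr// => h; rewrite ler_pdivlMr//; clearbody dl; lra.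
  pose e' := Num.min 1 (e / 4 * dl).
  have e'0 : 0 < e' by rewrite lt_min ltr01 mulr_gt0// divr_gt0.
  have e'1 : e' <= 1 by rewrite ge_min lexx.
  have e'd : e' <= e / 4 * dl by rewrite ge_min lexx orbT.
  clearbody e'; clearbody dl.
  have [N /(_ N (leqnn N))[h1 h2 h3]] := dL2 _ e'0.
  have zz w : `|Z w ^+ 2 - Z_ N w ^+ 2| <=
      (1 + dl^-1) * (Z_ N w - Z w) ^+ 2 + dl * Z_ N w ^+ 2.
    move: (Z w) (Z_ N w) => x y.
    have -> : x ^+ 2 - y ^+ 2 = (y - x) ^+ 2 - 2 * (y * (y - x)) by ring.
    have h : `|2 * (y * (y - x))| <= dl^-1 * (y - x) ^+ 2 + dl * y ^+ 2.
      have q1 := sqr_ge0 ((y - x) / dl - y); have q2 := sqr_ge0 ((y - x) / dl + y).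
      have e1 : (y - x) = (y - x) / dl * dl by rewrite divfK// gt_eqF.
      have e2 : dl^-1 * (y - x) ^+ 2 = ((y - x) / dl) ^+ 2 * dl.
        by field; rewrite gt_eqF.
      rewrite e2 [in X in `|X|]e1; move: ((y - x) / dl) q1 q2 => v q1 q2.
      have p1 := mulr_ge0 (ltW dl0) q1; have p2 := mulr_ge0 (ltW dl0) q2.
      by rewrite ler_norml; apply/andP; split; nra.
    apply: le_trans (ler_normB _ _) _.
    have -> : (1 + dl^-1) * (y - x) ^+ 2 + dl * y ^+ 2 =
      (y - x) ^+ 2 + (dl^-1 * (y - x) ^+ 2 + dl * y ^+ 2) by ring.
    by rewrite ger0_norm ?sqr_ge0// lerD2l.
  have i1 := integrableZl measurableT (1 + dl^-1) h1.2.
  have i2 := integrableZl measurableT dl (Z2 N).2.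
  have i3 := integrableD measurableT i1 i2.
  have m3 : measurable_fun [set: Omega] (fun w => Z w ^+ 2 - Z_ N w ^+ 2).
    by apply: measurable_funB; apply: measurable_funX => //; exact: (Z2 N).1.
  have [_] := dominated_Rintegral measurableT m3 (fun w _ => zz w) i3.
  rewrite (RintegralB measurableT Zn2.2 (Z2 N).2) (RintegralD measurableT i1 i2).
  rewrite (RintegralZl _ measurableT h1.2) (RintegralZl _ measurableT (Z2 N).2).
  move: h2 h3; move: (Rintegral _ _ _) (Rintegral _ _ _) (Rintegral _ _ _) => r q p h2 h3 h4.
  have t1 : (1 + dl^-1) * p <= e / 2.
    have t2 : (1 + dl^-1) * e' <= e / 2.
      apply: le_trans (ler_wpM2l _ e'd) _; first by rewrite addr_ge0// invr_ge0 ltW.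
      have -> : (1 + dl^-1) * (e / 4 * dl) = e / 4 * dl + e / 4 * (dl^-1 * dl) by ring.
      rewrite mulVf ?gt_eqF// mulr1; nra.
    have D1 : 0 <= 1 + dl^-1 by rewrite addr_ge0// invr_ge0 ltW.
    exact: le_trans (ler_wpM2l D1 h2) t2.
  have t3 : dl * q <= e / 4.
    apply: le_trans dlc; rewrite ler_wpM2l ?(ltW dl0)//.
    have := ler_norm (q - c); have := ler_norm c; lra.
  have t4 : e' <= e / 4 by nra.
  have -> : r - c = (r - q) + (q - c) by ring.
  apply: le_trans (ler_normD _ _) _; lra.
- move=> Z0; apply/eqP; rewrite -normr_le0; apply/ler_addgt0Pr => e e0; rewrite add0r.
  have e2 : 0 < e ^+ 2 by rewrite exprn_gt0.
  have [N /(_ N (leqnn N))[h1 h2 h3]] := dL2 _ e2.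
  (* The arithmetic-geometric inequality for [|x|] and [e]. *)
  have zz w : `|Z_ N w - Z w| <= (2 * e)^-1 * ((Z_ N w - Z w) ^+ 2 + e ^+ 2).
    rewrite mulrC ler_pdivlMr ?mulr_gt0//; move: (_ - _) => x.
    by rewrite -[x ^+ 2]real_normK ?num_real//; have := sqr_ge0 (`|x| - e); nra.
  have ic : P.-integrable [set: Omega] (EFin \o cst (e ^+ 2)).
    exact: finite_measure_integrable_cst.
  have i1 := integrableD measurableT h1.2 ic.
  have i2 := integrableZl measurableT (2 * e)^-1 i1.
  have [i3] := dominated_Rintegral measurableT h1.1 (fun w _ => zz w) i2.
  rewrite (RintegralB measurableT (L2_integrable (Z2 N)) (L2_integrable Zn2)) Z0 sub0r normrN.
  move=> /le_trans; apply.
  rewrite (RintegralZl _ measurableT i1) (RintegralD measurableT h1.2 ic) Rintegral_cst//.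
  have P1 : fine (P [set: Omega]) = 1 by rewrite probability_setT.
  rewrite [X in _ + _ * X]P1 mulr1 mulrC ler_pdivrMr ?mulr_gt0//.
  by move: h2; move: (Rintegral _ _ _) => p; nra.
Qed.

End square_integrable_limits.
(** Polarization: the limits of second moments for [X], [Y] and [X + Y]. *)
Lemma L2_cvgM d (Omega : measurableType d) (R : realType) (P : probability Omega R)
    (X_ Y_ : nat -> Omega -> R) (X Y : Omega -> R) (a b c : R) :
  (forall n, L2 P (X_ n)) -> (forall n, L2 P (Y_ n)) ->
  (forall w, X_ n w @[n --> \oo] --> X w) -> (forall w, Y_ n w @[n --> \oo] --> Y w) ->
  (forall e, 0 < e -> exists N, forall n m, (N <= n)%N -> (N <= m)%N ->
     `|\int[P]_w (X_ n w * X_ m w) - a| <= e) ->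
  (forall e, 0 < e -> exists N, forall n m, (N <= n)%N -> (N <= m)%N ->
     `|\int[P]_w (Y_ n w * Y_ m w) - b| <= e) ->
  (forall e, 0 < e -> exists N, forall n m, (N <= n)%N -> (N <= m)%N ->
     `|\int[P]_w (X_ n w * Y_ m w) - c| <= e) ->
  \int[P]_w (X w * Y w) = c.
Proof.
move=> X2 Y2 XX YY Xa Yb XYc.
have [x1 x2 _] := L2_cvg X2 XX Xa; have [y1 y2 _] := L2_cvg Y2 YY Yb.
have [|||z1 z2 _] := @L2_cvg _ _ _ P (fun n w => X_ n w + Y_ n w)
  (fun w => X w + Y w) (a + 2 * c + b).
- by move=> n; exact: L2D.
- by move=> w; exact: cvgD.
- move=> e e0; have e4 : 0 < e / 4 by rewrite divr_gt0.
  have [N1 H1] := Xa _ e4; have [N2 H2] := Yb _ e4; have [N3 H3] := XYc _ e4.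
  exists (maxn N1 (maxn N2 N3)) => n k.
  rewrite !geq_max => /and3P[n1 n2 n3] /and3P[k1 k2 k3].
  have i1 := L2M (X2 n) (X2 k); have i2 := L2M (X2 n) (Y2 k).
  have i3 := L2M (X2 k) (Y2 n); have i4 := L2M (Y2 n) (Y2 k).
  have -> : (fun w => (X_ n w + Y_ n w) * (X_ k w + Y_ k w)) =
    (fun w => (X_ n w * X_ k w + X_ n w * Y_ k w) + (X_ k w * Y_ n w + Y_ n w * Y_ k w)).
    by apply/funext => w; ring.
  rewrite (RintegralD measurableT (integrableD measurableT i1 i2) (integrableD measurableT i3 i4)).
  rewrite (RintegralD measurableT i1 i2) (RintegralD measurableT i3 i4).
  move: (H1 n k n1 k1) (H2 n k n2 k2) (H3 n k n3 k3) (H3 k n k3 n3).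
  rewrite !ler_norml.
  move: (Rintegral _ _ _) (Rintegral _ _ _) (Rintegral _ _ _) (Rintegral _ _ _) => p q r v.
  by move=> /andP[? ?] /andP[? ?] /andP[? ?] /andP[? ?]; apply/andP; split; lra.
have ii := L2M x1 y1; have i2 := integrableZl measurableT 2 ii.
move: z2 x2 y2.
have -> : (fun w => (X w + Y w) ^+ 2) =
    (fun w => X w ^+ 2 + 2 * (X w * Y w) + Y w ^+ 2).
  by apply/funext => w; ring.
rewrite (RintegralD measurableT (integrableD measurableT x1.2 i2) y1.2).
rewrite (RintegralD measurableT x1.2 i2) (RintegralZl 2 measurableT ii).
move: (Rintegral _ _ _) (Rintegral _ _ _) (Rintegral _ _ _) => p q r; lra.
Qed.

(** * Gram-Schmidt systems and the Bessel and Parseval relations *)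

Section orthogonal_projections.
Context {R : realType} {H : hilbertType R}.
Variable dn : nat -> H.

Definition proj_sum (s : seq H) (x : H) : H := \sum_(e <- s) inner x e *: e.

(** A vector depending on the previous ones adds a zero vector, because a zero residual stays zero
    under scaling; the system is orthonormal up to such vectors. *)
Fixpoint gram_schmidt (n : nat) : seq H :=
  if n is n'.+1 then
    let r := dn n' - proj_sum (gram_schmidt n') (dn n') in
    rcons (gram_schmidt n') (`|r|^-1 *: r)
  else [::].

Lemma proj_sum_rcons s e x : proj_sum (rcons s e) x = proj_sum s x + inner x e *: e.
Proof. by rewrite /proj_sum -cats1 big_cat big_seq1. Qed.

Lemma proj_sum_sym s x z : inner (proj_sum s x) z = inner x (proj_sum s z).
Proof.
rewrite /proj_sum inner_suml [RHS]innerC inner_suml; apply: eq_bigr => e _.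
by rewrite !innerZl (innerC e z) (innerC e x) mulrC.
Qed.

Lemma proj_sumB s x z : proj_sum s (x - z) = proj_sum s x - proj_sum s z.
Proof.
by rewrite /proj_sum -sumrB; apply: eq_bigr => e _; rewrite innerBl scalerBl.
Qed.

Lemma proj_sumD s x z : proj_sum s (x + z) = proj_sum s x + proj_sum s z.
Proof.
by rewrite /proj_sum -big_split; apply: eq_bigr => e _; rewrite innerDl scalerDl.
Qed.

Lemma proj_sumZ s k x : proj_sum s (k *: x) = k *: proj_sum s x.
Proof.
by rewrite /proj_sum scaler_sumr; apply: eq_bigr => e _; rewrite innerZl scalerA.
Qed.

Let res n := dn n - proj_sum (gram_schmidt n) (dn n).
Let en n := `|res n|^-1 *: res n.

Let gsS n x : proj_sum (gram_schmidt n.+1) x =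
  proj_sum (gram_schmidt n) x + inner x (en n) *: en n.
Proof. exact: proj_sum_rcons. Qed.

Let en_unit n : inner (en n) (en n) *: en n = en n.
Proof.
rewrite -inner_normE /en; have [->|r0] := eqVneq (res n) 0; first by rewrite !scaler0.
by rewrite normrZ normfV normr_id mulVf ?normr_eq0// expr1n scale1r.
Qed.

Let gs_idem n : (forall x, proj_sum (gram_schmidt n) (proj_sum (gram_schmidt n) x) =
   proj_sum (gram_schmidt n) x).
Proof.
elim: n => [|n IH] x; first by rewrite /proj_sum !big_nil.
have e0 : proj_sum (gram_schmidt n) (en n) = 0.
  by rewrite /en proj_sumZ proj_sumB IH subrr scaler0.
rewrite !gsS proj_sumD IH proj_sumZ e0 scaler0 addr0 innerDl innerZl.
by rewrite proj_sum_sym e0 inner0r add0r -scalerA en_unit.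
Qed.

(** The partial sum is symmetric and idempotent, hence an orthogonal projection, and Pythagoras
    applies even when some vectors of the system vanish. *)
Lemma gram_schmidt_bessel n x :
  `|x| ^+ 2 - \sum_(e <- gram_schmidt n) inner x e ^+ 2 =
  `|x - proj_sum (gram_schmidt n) x| ^+ 2.
Proof.
set p := proj_sum _ x.
have -> : \sum_(e <- gram_schmidt n) inner x e ^+ 2 = inner p x.
  rewrite /p /proj_sum inner_suml; apply: eq_bigr => e _.
  by rewrite innerZl (innerC e x) expr2.
have pp : inner p p = inner p x by rewrite {1}/p proj_sum_sym gs_idem innerC.
rewrite !inner_normE innerBl !innerBr pp (innerC x p); ring.
Qed.

Lemma gram_schmidt_span n k : (k < n)%N -> proj_sum (gram_schmidt n) (dn k) = dn k.
Proof.
elim: n => // n IH; rewrite ltnS leq_eqVlt => /predU1P[->|kn].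
  rewrite gsS /en; have [r0|r0] := eqVneq (res n) 0.
    by rewrite r0 !scaler0 addr0; apply/esym/eqP; rewrite -subr_eq0; apply/eqP.
  have e0 : inner (proj_sum (gram_schmidt n) (dn n)) (res n) = 0.
    by rewrite proj_sum_sym /res proj_sumB gs_idem subrr inner0r.
  have -> : inner (dn n) (`|res n|^-1 *: res n) = `|res n|.
    rewrite innerZr -[dn n](subrK (proj_sum (gram_schmidt n) (dn n))) innerDl e0 addr0.
    by rewrite -/(res n) -inner_normE expr2 mulKf// normr_eq0.
  by rewrite scalerA mulfV ?normr_eq0// scale1r /res addrC subrK.
rewrite gsS IH// -{2}(IH kn) proj_sum_sym.
by rewrite /en proj_sumZ proj_sumB gs_idem subrr scaler0 inner0r scale0r addr0.
Qed.

(** For [n > k] the projection fixes [dn k], so the residual of [x] is that of [x - dn k] and no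
    longer than it. Distances below [1] let the norm bound its own square. *)
Lemma gram_schmidt_cvg x : (forall e, 0 < e -> exists k, `|x - dn k| < e) ->
  \sum_(e <- gram_schmidt n) inner x e ^+ 2 @[n --> \oo] --> `|x| ^+ 2.
Proof.
move=> dx; apply/cvgrPdist_le => e e0.
have [k xk] := dx (Num.min 1 e) ltac:(by rewrite lt_min ltr01).
suff : \forall n \near \oo, `| `|x| ^+ 2 - \sum_(f <- gram_schmidt n) inner x f ^+ 2| <= e by [].
exists k.+1 => // n /= kn; rewrite gram_schmidt_bessel ger0_norm ?sqr_ge0//.
have -> : x - proj_sum (gram_schmidt n) x =
    (x - dn k) - proj_sum (gram_schmidt n) (x - dn k).
  by rewrite proj_sumB (gram_schmidt_span kn) opprB addrA subrK.
have [x1 xe] : `|x - dn k| <= 1 /\ `|x - dn k| <= e.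
  by split; apply: ltW; apply: lt_le_trans xk _; rewrite ge_min lexx ?orbT.
apply: (@le_trans _ _ (`|x - dn k| ^+ 2)).
  rewrite -gram_schmidt_bessel gerBl sumr_ge0// => f _; exact: sqr_ge0.
by apply: le_trans xe; rewrite expr2 ler_piMl.
Qed.

Lemma gram_schmidt_le n x : \sum_(e <- gram_schmidt n) inner x e ^+ 2 <= `|x| ^+ 2.
Proof. by rewrite -subr_ge0 gram_schmidt_bessel sqr_ge0. Qed.

End orthogonal_projections.

Lemma separable_sequence {R : realType} {H : hilbertType R} : separable_space H ->
  exists dn : nat -> H, forall x e, 0 < e -> exists k, `|x - dn k| < e.
Proof.
move=> [D /countable_injP[f fi] dD].
(* The value [0] only fills the indices that code no point of [D]. *)
exists (fun n => xget 0 [set x | D x /\ f x = n]) => x e e0.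
have [y [xy Dy]] : (ball x e `&` D) !=set0.
  by apply: dD; [exists x; exact: ballxx|exact: ball_open].
exists (f y); case: xgetP => [z _ [Dz fz]|/(_ y)]; last by case.
have -> : z = y by apply: fi; rewrite ?inE.
by move: xy; rewrite -ball_normE.
Qed.

(** * A lower bound for truncated second moments of Gaussian variables *)

Section gaussian_lower_bound.
Context d (Omega : measurableType d) {R : realType} (P : probability Omega R).
Local Notation mu := (@lebesgue_measure R).

(** The density and the Radon-Nikodym derivative have the same integral over every measurable set,
    hence agree almost everywhere. *)
Lemma integral_normal_prob (m s : R) (f : R -> \bar R) : measurable_fun setT f ->
  (\int[normal_prob m s]_x `|f x| < +oo)%E ->
  (\int[normal_prob m s]_x f x = \int[mu]_x (f x * (normal_pdf m s x)%:E))%E.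
Proof.
move=> mf finf.
rewrite -(Radon_Nikodym_change_of_variables (normal_prob_dominates m s))//=; last first.
  by apply/integrableP; split.
apply: ae_eq_integral => //.
- apply: emeasurable_funM => //; apply: (measurable_int mu).
  by apply: Radon_Nikodym_integrable; exact: normal_prob_dominates.
- apply: emeasurable_funM => //=; apply/measurableT_comp => //=.
  exact: measurable_normal_pdf.
- apply: ae_eqe_mul2l => /=.
  rewrite Radon_NikodymE//=; first exact: normal_prob_dominates.
  move=> abmu; case: cid => /= h [h1 h2 h3].
  apply: integral_ae_eq => //=.
  + apply/measurableT_comp => //; exact: measurable_normal_pdf.
  + by move=> E E01 mE; rewrite -h3.
Qed.

Let mpdf (m s : R) : measurable_fun setT (fun x : measurableTypeR R => (normal_pdf m s x)%:E).
Proof. by apply/measurable_EFinP; exact: measurable_normal_pdf. Qed.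

Lemma normal_peak_double (s : R) : s != 0 ->
  normal_peak s = 2 * normal_peak (2 * s).
Proof.
move=> s0; rewrite /normal_peak.
have -> : (2 * s) ^+ 2 * pi *+ 2 = 2 ^+ 2 * (s ^+ 2 * pi *+ 2) :> R by ring.
by rewrite sqrtrM ?sqr_ge0// sqrtr_sqr ger0_norm// invfM mulrA divff// mul1r.
Qed.

(** The square is traded for a density of twice the deviation, whose integral is [1]. With
    [u = (x - m)^2 / (8 s^2)] the exponentials are [exp (- 4 u)] and [exp (- u)], and
    [u exp (- 3 u) <= 1]; the ratio [2] of the peaks turns [8] into [16]. *)
Lemma normal_pdf_moment2 (m s x : R) : s != 0 ->
  (x - m) ^+ 2 * normal_pdf m s x <= 16 * s ^+ 2 * normal_pdf m (2 * s) x.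
Proof.
move=> s0; have s20 : 2 * s != 0 by rewrite mulf_neq0// pnatr_eq0.
rewrite !normal_pdfE// /normal_fun.
set u := (x - m) ^+ 2 / (8 * s ^+ 2).
have ss : 0 < s ^+ 2 by rewrite exprn_even_gt0.
have ue : (x - m) ^+ 2 = 8 * s ^+ 2 * u.
  by rewrite /u mulrC divfK// mulf_neq0// ?pnatr_eq0// gt_eqF.
have u0 : 0 <= u by rewrite divr_ge0 ?sqr_ge0// mulr_ge0// ltW.
clearbody u.
have -> : - (x - m) ^+ 2 / (s ^+ 2 *+ 2) = - u + - (3 * u).
  by rewrite ue; field.
have -> : - (x - m) ^+ 2 / ((2 * s) ^+ 2 *+ 2) = - u.
  by rewrite ue; field.
rewrite expRD ue.
have h1 : u * expR (- (3 * u)) <= 1.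
  rewrite expRN ler_pdivrMr ?expR_gt0// mul1r.
  apply: le_trans (expR_ge1Dx (3 * u)); lra.
have h2 := normal_peak_double s0.
have p0 := expR_ge0 (- u).
have k0 := normal_peak_ge0 s.
have -> : 8 * s ^+ 2 * u * (normal_peak s * (expR (- u) * expR (- (3 * u)))) =
   8 * s ^+ 2 * expR (- u) * normal_peak s * (u * expR (- (3 * u))) by ring.
have -> : 16 * s ^+ 2 * (normal_peak (2 * s) * expR (- u)) =
   8 * s ^+ 2 * expR (- u) * (2 * normal_peak (2 * s)) by ring.
have q0 : 0 <= 8 * s ^+ 2 * expR (- u) by rewrite mulr_ge0// mulr_ge0// ltW.
apply: (@le_trans _ _ (8 * s ^+ 2 * expR (- u) * normal_peak s)).
  by rewrite ler_piMr// mulr_ge0.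
by rewrite ler_wpM2l// -h2.
Qed.

(** Bounds the probability of an interval of length [|s|]; it amounts to [4 <= 2 pi]. *)
Lemma normal_peak_norm (s : R) : s != 0 -> normal_peak s * `|s| <= 2^-1.
Proof.
move=> s0; rewrite /normal_peak mulrC ler_pdivrMr; last first.
  by rewrite sqrtr_gt0 mulrn_wgt0// mulr_gt0 ?pi_gt0// exprn_even_gt0.
suff : 2 * `|s| <= Num.sqrt (s ^+ 2 * pi *+ 2) by lra.
have -> : 2 * `|s| = Num.sqrt ((2 * s) ^+ 2) by rewrite sqrtr_sqr normrM ger0_norm.
apply: ler_wsqrtr; have := pi_ge2 R; have := sqr_ge0 s.
by rewrite exprMn; move: (s ^+ 2) pi => x y; nra.
Qed.

(* For the law of mean [m] and deviation [s] one has [E (X - m)^2 <= 16 s^2], hence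
   [E X^2 <= 16 s^2] because [E X = 0], while [|X| < |s| / 2] has probability at
   most [1 / 2]. *)
Lemma gaussian_lower_bound (X : Omega -> R) : L2 P X -> is_gaussian_rv P X ->
  \int[P]_w X w = 0 ->
  128^-1 * \int[P]_w (X w ^+ 2) <= \int[P]_w Num.min (X w ^+ 2) (\int[P]_w (X w ^+ 2)).
Proof.
move=> X2 [mX law] X0; set v := \int[P]_w (X w ^+ 2).
have v0 : 0 <= v by apply: Rintegral_ge0 => w _; exact: sqr_ge0.
have mmin : measurable_fun [set: Omega] (fun w => Num.min (X w ^+ 2) v).
  by apply: measurable_minr => //; exact: measurable_funX.
have imin : P.-integrable [set: Omega] (EFin \o (fun w => Num.min (X w ^+ 2) v)).
  apply: (le_integrableT mmin _ X2.2) => w.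
  by rewrite ger0_norm ?le_min ?sqr_ge0// ge_min lexx.
pose X' : Omega -> measurableTypeR R := X.
have mX' : measurable_fun [set: Omega] X' by exact: mX.
have pushE (f : measurableTypeR R -> \bar R) : measurable_fun setT f ->
    (forall x, 0 <= f x)%E -> (\int[P]_w f (X w) = \int[pushforward P X']_x f x)%E.
  by move=> mf f0; rewrite (ge0_integral_pushforward mX').
case: law => [[m lawm]|[m [s [s0 laws]]]].
  have fE (f : R -> R) : measurable_fun setT f -> (forall x, 0 <= f x) ->
      \int[P]_w f (X w) = f m.
    move=> mf f0; rewrite /Rintegral (pushE (fun x => (f x)%:E)).
    - rewrite (eq_measure_integral (dirac (m : measurableTypeR R))) => [|A mA _]; last exact: lawm.
      by rewrite integral_dirac ?diracT ?mul1e//; exact/measurable_EFinP.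
    - exact/measurable_EFinP.
    - by move=> x; rewrite lee_fin.
  have vE : v = m ^+ 2.
    by rewrite /v (fE (fun x => x ^+ 2))// => x; exact: sqr_ge0.
  rewrite (fE (fun x => Num.min (x ^+ 2) v)); last first.
  - by move=> x; rewrite le_min sqr_ge0.
  - by apply: measurable_minr.
  by rewrite -vE minxx; lra.
have mom : \int[P]_w ((X w - m) ^+ 2) <= 16 * s ^+ 2.
  have mq : measurable_fun [set: measurableTypeR R] (fun x : measurableTypeR R => (x - m) ^+ 2).
    by apply: measurable_funX; exact: measurable_funB.
  have i1 : L2 P (fun w => X w - m).
    apply: L2B => //; split; first exact: measurable_cst.
    exact: finite_measure_integrable_cst.
  have e1 : (\int[P]_w ((X w - m) ^+ 2)%:E = \int[normal_prob m s]_x ((x - m) ^+ 2)%:E)%E.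
    rewrite (pushE (fun x => ((x - m) ^+ 2)%:E)).
    - by rewrite (eq_measure_integral (normal_prob m s)) => [//|A mA _]; exact: laws.
    - exact/measurable_EFinP.
    - by move=> x; rewrite lee_fin sqr_ge0.
  have fin : (\int[P]_w ((X w - m) ^+ 2)%:E)%E \is a fin_num.
    exact: (integrable_fin_num measurableT i1.2).
  have fin' : (\int[P]_w ((X w - m) ^+ 2)%:E < +oo)%E.
    by rewrite -ge0_fin_numE// integral_ge0// => w _; rewrite lee_fin sqr_ge0.
  rewrite -lee_fin /Rintegral fineK//.
  rewrite e1 integral_normal_prob; last 2 first.
  - exact/measurable_EFinP.
  - apply: le_lt_trans fin'; rewrite e1 le_eqVlt; apply/orP; left; apply/eqP.
    by apply: eq_integral => x _; rewrite gee0_abs// lee_fin sqr_ge0.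
  apply: (@le_trans _ _ (\int[mu]_x ((16 * s ^+ 2)%:E * (normal_pdf m (2 * s) x)%:E))%E).
    apply: ge0_le_integral => //=.
    + by move=> x _; rewrite mule_ge0// lee_fin ?sqr_ge0// normal_pdf_ge0.
    + apply: emeasurable_funM; first exact/measurable_EFinP.
      exact: mpdf.
    + by apply: emeasurable_funM => //; exact: mpdf.
    + by move=> x _; rewrite -!EFinM lee_fin normal_pdf_moment2.
  rewrite ge0_integralZl//; first by rewrite integral_normal_pdf mule1.
  - by move=> x _; rewrite lee_fin normal_pdf_ge0.
  - by rewrite lee_fin mulr_ge0// sqr_ge0.
have vs : v <= 16 * s ^+ 2.
  apply: le_trans mom; have i1 := integrableZl measurableT (2 * m) (L2_integrable X2).
  have i2 : P.-integrable [set: Omega] (EFin \o cst (m ^+ 2)).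
    exact: finite_measure_integrable_cst.
  have -> : (fun w => (X w - m) ^+ 2) = (fun w => (X w ^+ 2 - 2 * m * X w) + cst (m ^+ 2) w).
    by apply/funext => w /=; ring.
  rewrite (RintegralD measurableT (integrableB measurableT X2.2 i1) i2).
  rewrite (RintegralB measurableT X2.2 i1) (RintegralZl _ measurableT (L2_integrable X2)) X0.
  rewrite mulr0 subr0 Rintegral_cst// lerDl mulr_ge0 ?sqr_ge0// fine_ge0//.
pose F := X @^-1` `]- (`|s| / 2), `|s| / 2[.
have sp : 0 < `|s| by rewrite normr_gt0.
have mF : measurable F by rewrite -[F]setTI; exact: mX.
have PF : fine (P F) <= 2^-1.
  have -> : P F = normal_prob m s `]- (`|s| / 2), `|s| / 2[ by rewrite -laws.
  rewrite -lee_fin fineK; last exact: fin_num_measure.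
  rewrite /normal_prob.
  apply: (@le_trans _ _ (\int[mu]_(x in `](- (`|s| / 2))%R, (`|s| / 2)%R[) (normal_peak s)%:E)%E).
    apply: ge0_le_integral => //=.
    + by move=> x _; rewrite lee_fin normal_pdf_ge0.
    + by apply: measurable_funTS; exact: mpdf.
    + by move=> x _; rewrite lee_fin normal_pdf_ub.
  rewrite integral_cst//= lebesgue_measure_itv/= lte_fin.
  rewrite ifT; last by rewrite (lt_trans (y := 0)) ?oppr_lt0 ?divr_gt0.
  by rewrite -EFinB -EFinM lee_fin opprK -splitr normal_peak_norm.
(* Off [F] one has [X^2 >= s^2 / 4 >= v / 64]; as [F] has probability at most [1 / 2], the
   expectation is at least [v / 128]. *)
have point w : v / 32 / 2 - v / 32 / 2 * \1_F w <= Num.min (X w ^+ 2) v.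
  rewrite indicE; case: (boolP (w \in F)) => wF /=.
    by rewrite mulr1 subrr le_min sqr_ge0.
  rewrite mulr0 subr0 le_min; apply/andP; split; last by lra.
  have : `|s| / 2 <= `|X w|.
    rewrite leNgt; apply/negP => h; move/negP: wF; apply; rewrite inE /F/= in_itv/=.
    by rewrite -ltr_norml.
  move=> h; have h2 : (`|s| / 2) ^+ 2 <= `|X w| ^+ 2.
    by rewrite ler_sqr ?nnegrE ?divr_ge0.
  rewrite real_normK ?num_real// in h2; apply: le_trans h2.
  by rewrite expr_div_n real_normK ?num_real//; lra.
have iF : P.-integrable [set: Omega] (EFin \o \1_F) by exact: integrable_indic.
have ic : P.-integrable [set: Omega] (EFin \o cst (v / 32 / 2)).
  exact: finite_measure_integrable_cst.
have iF' := integrableZl measurableT (v / 32 / 2) iF.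
have := le_Rintegral measurableT (integrableB measurableT ic iF') imin (fun w _ => point w).
rewrite (RintegralB measurableT ic iF') (RintegralZl _ measurableT iF) Rintegral_cst//.
have -> : \int[P]_x \1_F x = fine (P F) by rewrite /Rintegral integral_indic// setIT.
have -> : fine (P setT) = 1 by rewrite probability_setT.
by move=> /(le_trans _); apply; move: (fine _) PF => q PF; clearbody v; nra.
Qed.

End gaussian_lower_bound.

(** * Measurability of Hilbert-valued variables *)

Section hilbert_random_variables.
Context d (Omega : measurableType d) {R : realType} {H : hilbertType R}.

Definition open_measurable_fun (X : Omega -> H) :=
  forall U : set H, open U -> measurable (X @^-1` U).

Lemma open_measurable_comp (X : Omega -> H) (phi : H -> R) :
  open_measurable_fun X -> continuous phi -> measurable_fun [set: Omega] (phi \o X).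
Proof.
move=> mX cphi; apply: (measurability (RGenOpens.G (R := R))).
  exact: RGenOpens.measurableE.
move=> _ [_ [x [y ->]] <-]; rewrite setTI.
apply: (mX (phi @^-1` `]x, y[)); apply: open_comp; last exact: interval_open.
by move=> z _; exact: cphi.
Qed.

Lemma inner_continuous (g : H) : continuous (fun x : H => inner x g).
Proof. by move=> x; apply: inner_cvgl; exact: cvg_id. Qed.

Lemma open_measurable_inner (X : Omega -> H) g : open_measurable_fun X ->
  measurable_fun [set: Omega] (fun w => inner (X w) g).
Proof. by move=> mX; apply: (open_measurable_comp (phi := fun x => inner x g) mX);
  exact: inner_continuous. Qed.

Lemma open_measurable_dist (X : Omega -> H) c : open_measurable_fun X ->
  measurable_fun [set: Omega] (fun w => `|X w - c|).
Proof.
move=> mX; apply: (open_measurable_comp (phi := fun x => `|x - c|) mX) => x.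
by apply: cvg_norm; apply: cvgB; [exact: cvg_id|exact: cvg_cst].
Qed.

End hilbert_random_variables.

(** * The adjoint of the Mittag-Leffler kernel *)

Section mlker_adjoint.
Context {R : realType} {H : hilbertType R}.

(** Partial sums are adjoint to each other term by term, and the remainders of both series,
    estimated on [[0, x]], tend to [0]. *)
Lemma mlker_adjoint (al : R) (A : bop H) (x : R) (u h : H) :
  0 < al -> al < 1 -> 0 < x ->
  inner (mlker al A x u) h = inner u (mlker al (adjoint A) x h).
Proof.
move=> al0 al1 x0.
have [M M0 ke] := mlker_estimates al0 al1 x0 A.
have [M' M'0 ke'] := mlker_estimates al0 al1 x0 (adjoint A).
pose K : R := 2 * (M + M') * x `^ (- (1 - al)) * `|u| * `|h|.
have bound n : `|inner (mlker al A x u) h - inner u (mlker al (adjoint A) x h)| <=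
    K * 2^-1 ^+ n.
  have pe : inner (mlpart al A n x u) h = inner u (mlpart al (adjoint A) n x h).
    rewrite /mlpart /series/= !bop_sum inner_suml innerC inner_suml.
    by apply: eq_bigr => i _; rewrite !innerZl bpow_adjoint innerC.
  have -> : inner (mlker al A x u) h - inner u (mlker al (adjoint A) x h) =
    inner ((mlker al A x - mlpart al A n x) u) h -
    inner u ((mlker al (adjoint A) x - mlpart al (adjoint A) n x) h).
    by rewrite bopB innerBl bopB innerBr pe; ring.
  apply: le_trans (ler_normB _ _) _.
  have e1 := ke_le (ke n) x0 (lexx x); have e2 := ke_le (ke' n) x0 (lexx x).
  apply: (@le_trans _ _ (2 * M * 2^-1 ^+ n * x `^ (- (1 - al)) * `|u| * `|h| +
    `|u| * (2 * M' * 2^-1 ^+ n * x `^ (- (1 - al)) * `|h|))); last first.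
    by rewrite le_eqVlt; apply/orP; left; apply/eqP; rewrite /K; ring.
  apply: lerD.
    apply: le_trans (inner_le _ _) _; rewrite ler_wpM2r//.
    by apply: le_trans (bop_norm_le _ _) _; rewrite ler_wpM2r.
  apply: le_trans (inner_le _ _) _; rewrite ler_wpM2l//.
  by apply: le_trans (bop_norm_le _ _) _; rewrite ler_wpM2r.
apply/eqP; rewrite -subr_eq0 -normr_le0.
have h1 : `|2^-1 : R| < 1 by rewrite ger0_norm ?invr_ge0// invf_lt1// ltr1n.
have h2 : K * 2^-1 ^+ n @[n --> \oo] --> (0 : R).
  by rewrite -[X in _ --> X](mulr0 K); apply: cvgMl_tmp; exact: cvg_expr.
by apply: (cvgr_to_ge h2); apply: nearW.
Qed.

End mlker_adjoint.

(** * Sequences of partitions *)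

Section partition_sequence.
Context {R : realType}.

(** Fatou and dominated convergence are used along sequences, whereas the pathwise integrals are
    limits along a filter. *)
Lemma partition_sequence_exists (t : R) : 0 <= t -> exists s : nat -> seq R,
  forall n, itv_partition 0 t (s n) /\ mesh 0 (s n) < n.+1%:R^-1.
Proof.
move=> t0; have /choice[s sP] : forall n : nat, exists s : seq R,
    itv_partition 0 t s /\ mesh 0 s < n.+1%:R^-1.
  by move=> n; apply: fine_partition_exists => //; rewrite invr_gt0.
by exists s.
Qed.

Lemma partition_sequence_cvg (t : R) (s : nat -> seq R) :
  (forall n, itv_partition 0 t (s n) /\ mesh 0 (s n) < n.+1%:R^-1) ->
  s @ \oo --> fine_partitions 0 t.
Proof.
move=> st U [e /= e0 eU].
have := near_infty_natSinv_lt (PosNum e0); apply: filterS => n /= ne.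
by apply: eU; have [p m] := st n; split=> //; exact: lt_trans ne.
Qed.

End partition_sequence.

(** * Limits of Gaussian variables and integrability of the squared norm *)

Lemma Rdominated_cvg d (Omega : measurableType d) (R : realType) (P : probability Omega R)
    (f_ : nat -> Omega -> R) (f g : Omega -> R) :
  (forall n, measurable_fun [set: Omega] (f_ n)) ->
  (forall w, f_ n w @[n --> \oo] --> f w) -> (forall n w, `|f_ n w| <= g w) ->
  P.-integrable [set: Omega] (EFin \o g) ->
  \int[P]_w f_ n w @[n --> \oo] --> \int[P]_w f w.
Proof.
move=> mf ff fg gi.
have mlim : measurable_fun [set: Omega] f.
  by apply: (measurable_fun_cvg (h := f_)) => [n|w _]; [exact: mf|exact: ff].
have fi : P.-integrable [set: Omega] (EFin \o f).
  apply: (le_integrableT mlim _ gi) => w.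
  by apply: (cvgr_to_le (cvg_norm (ff w))); apply: nearW => n; exact: fg.
have h := @dominated_cvg _ _ _ P setT measurableT (fun n w => (f_ n w)%:E) (EFin \o f) (EFin \o g)
  (fun n => (measurable_EFinP _ _).2 (mf n)) _ (fun _ _ => erefl) gi _.
apply: fine_cvg; rewrite fineK; last exact: (integrable_fin_num measurableT fi).
apply: h => [w _|n w _]; last by rewrite /= lee_fin.
by apply: cvg_EFin; [exact: nearW|exact: ff].
Qed.

(** No law of the limit is identified. The minimum is Lipschitz in each argument, so truncation at
    [v n] is replaced by truncation at [c] at the cost of [|v n - c|], and dominated convergence
    applies with the bound [c]. *)
Lemma gaussian_limit_lower_bound d (Omega : measurableType d) (R : realType)
    (P : probability Omega R) (X_ : nat -> Omega -> R) (X : Omega -> R) (c : R) :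
  (forall n, L2 P (X_ n)) -> (forall n, is_gaussian_rv P (X_ n)) ->
  (forall n, \int[P]_w X_ n w = 0) -> (forall w, X_ n w @[n --> \oo] --> X w) ->
  (forall e, 0 < e -> exists N, forall n m, (N <= n)%N -> (N <= m)%N ->
     `|\int[P]_w (X_ n w * X_ m w) - c| <= e) ->
  128^-1 * c <= \int[P]_w Num.min (X w ^+ 2) c.
Proof.
move=> X2 Xg X0 XX Xc.
pose v n := \int[P]_w (X_ n w ^+ 2).
have vc : v n @[n --> \oo] --> c.
  apply/cvgrPdist_le => e e0; have [N HN] := Xc _ e0.
  exists N => // n /= Nn; have := HN n n Nn Nn; rewrite distrC /v.
  by under eq_Rintegral do rewrite -expr2.
have v0 n : 0 <= v n by apply: Rintegral_ge0 => w _; exact: sqr_ge0.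
have c0 : 0 <= c by apply: (cvgr_to_ge vc); apply: nearW.
have min_lip (x y z : R) : `|Num.min x z - Num.min y z| <= `|x - y|.
  have := ler_norm (x - y); have := ler_norm (y - x); rewrite (distrC y x) => h1 h2.
  by rewrite /Num.min; case: (ltP x z) => xz; case: (ltP y z) => yz;
    rewrite ler_norml; apply/andP; split; lra.
pose f_ n w := Num.min (X_ n w ^+ 2) c.
have mf n : measurable_fun [set: Omega] (f_ n).
  by apply: measurable_minr => //; apply: measurable_funX; exact: (X2 n).1.
have fc n w : `|f_ n w| <= c.
  by rewrite ger0_norm ?le_min ?sqr_ge0 ?c0// ge_min lexx orbT.
have ic (k : R) : P.-integrable [set: Omega] (EFin \o cst k).
  exact: finite_measure_integrable_cst.
have fi n : P.-integrable [set: Omega] (EFin \o f_ n) by exact: (le_integrableT (mf n) (fc n) (ic c)).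
have ff w : f_ n w @[n --> \oo] --> Num.min (X w ^+ 2) c.
  have h : X_ n w ^+ 2 @[n --> \oo] --> X w ^+ 2.
    by under eq_fun do rewrite expr2; rewrite expr2; exact: cvgM (XX w) (XX w).
  apply/cvgrPdist_le => e e0; move/cvgrPdist_le : h => /(_ e e0).
  by apply: filterS => n; exact: le_trans (min_lip _ _ _).
have fl := Rdominated_cvg mf ff fc (ic c).
have l1 : 128^-1 * v n @[n --> \oo] --> 128^-1 * c by apply: cvgMl_tmp.
have l2 : \int[P]_w f_ n w + `|v n - c| @[n --> \oo] --> \int[P]_w Num.min (X w ^+ 2) c + `|c - c|.
  by apply: cvgD => //; apply: cvg_norm; apply: cvgB => //; exact: cvg_cst.
rewrite subrr normr0 addr0 in l2.
apply: (ler_cvg_to l1 l2); apply: nearW => n.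
apply: le_trans (gaussian_lower_bound (X2 n) (Xg n) (X0 n)) _; rewrite -/(v n).
have mv : measurable_fun [set: Omega] (fun w => Num.min (X_ n w ^+ 2) (v n)).
  by apply: measurable_minr => //; apply: measurable_funX; exact: (X2 n).1.
have iv : P.-integrable [set: Omega] (EFin \o (fun w => Num.min (X_ n w ^+ 2) (v n))).
  apply: (le_integrableT mv _ (ic (v n))) => w.
  by rewrite ger0_norm ?le_min ?sqr_ge0 ?v0// ge_min lexx orbT.
have pw w : Num.min (X_ n w ^+ 2) (v n) <= f_ n w + cst (`|v n - c|) w.
  rewrite -lerBlDl; apply: le_trans (ler_norm _) _.
  by rewrite /f_ !(minC (X_ n w ^+ 2)); exact: min_lip.
have := le_Rintegral measurableT iv (integrableD measurableT (fi n) (ic `|v n - c|)) (fun w _ => pw w).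
rewrite (RintegralD measurableT (fi n) (ic _)) Rintegral_cst//.
have -> : fine (P [set: Omega]) = 1 by rewrite probability_setT.
by rewrite mulr1.
Qed.

(* With [A] the expectation of a partial Bessel sum [S], the bound gives
   [A / 128 <= E (min S A) <= k + A E (min (|X|^2 / k) 1)], and for [k] large the
   last expectation is at most [1 / 256]. *)
Lemma square_integrable_of_lower_bound d (Omega : measurableType d) (R : realType)
    (P : probability Omega R) (H : hilbertType R) (X : Omega -> H) :
  separable_space H -> (forall h, L2 P (fun w => inner (X w) h)) ->
  (forall h, 128^-1 * \int[P]_w (inner (X w) h ^+ 2) <=
     \int[P]_w Num.min (inner (X w) h ^+ 2) (\int[P]_w (inner (X w) h ^+ 2))) ->
  measurable_fun [set: Omega] (fun w => `|X w| ^+ 2) /\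
  (\int[P]_w (`|X w| ^+ 2)%:E < +oo)%E.
Proof.
move=> Hs X2 Xb; have [dn dnP] := separable_sequence Hs.
pose gs := gram_schmidt dn.
pose S n w : R := \sum_(e <- gs n) inner (X w) e ^+ 2.
have SX w : S n w @[n --> \oo] --> `|X w| ^+ 2 by apply: gram_schmidt_cvg; exact: dnP.
have sI n := Rintegral_bigsum measurableT (gs n) (fun e => (X2 e).2).
have mS n : measurable_fun [set: Omega] (S n).
  by apply/measurable_EFinP; exact: measurable_int (sI n).1.
have mX : measurable_fun [set: Omega] (fun w => `|X w| ^+ 2).
  by apply: (measurable_fun_cvg (h := S)) => [n|w _]; [exact: mS|exact: SX].
split=> //.
have ic (k : R) : P.-integrable [set: Omega] (EFin \o cst k).
  exact: finite_measure_integrable_cst.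
pose g n w : R := Num.min (n.+1%:R^-1 * `|X w| ^+ 2) 1.
have g0 n w : 0 <= g n w by rewrite le_min ler01 andbT mulr_ge0 ?sqr_ge0.
have g1 n w : `|g n w| <= 1 by rewrite ger0_norm// ge_min lexx orbT.
have mg n : measurable_fun [set: Omega] (g n).
  by apply: measurable_minr => //; exact: measurable_funM.
have gi n : P.-integrable [set: Omega] (EFin \o g n) by exact: (le_integrableT (mg n) (g1 n) (ic 1)).
have gc w : g n w @[n --> \oo] --> (0 : R).
  have h : n.+1%:R^-1 * `|X w| ^+ 2 @[n --> \oo] --> (0 : R).
    by rewrite -[X in _ --> X](mul0r (`|X w| ^+ 2)); apply: cvgMr_tmp; exact: cvg_harmonic.
  apply: (squeeze_cvgr _ (cvg_cst 0) h); apply: nearW => n.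
  by rewrite g0 /= ge_min lexx.
have := Rdominated_cvg mg gc g1 (ic 1); rewrite Rintegral_cst// mul0r => /cvgrPdist_le.
(* Half of [1 / 128]: the term [A n * E (g k)] is absorbed by the left-hand side, and
   [A n / 256 <= k + 1] remains. *)
have e0 : 0 < (256^-1 : R) by rewrite invr_gt0.
move=> /(_ _ e0)[k _ /(_ k (leqnn k))]; rewrite sub0r normrN => /(le_trans (ler_norm _)) gk.
pose A n := \int[P]_w S n w.
have AE n : A n = \sum_(e <- gs n) \int[P]_w (inner (X w) e ^+ 2) := (sI n).2.
have A0 n : 0 <= A n.
  by apply: Rintegral_ge0 => w _; rewrite sumr_ge0// => e _; exact: sqr_ge0.
have Ak n : A n <= 256 * k.+1%:R.
  pose F e w := Num.min (inner (X w) e ^+ 2) (\int[P]_w (inner (X w) e ^+ 2)).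
  have a0 e : 0 <= \int[P]_w (inner (X w) e ^+ 2).
    by apply: Rintegral_ge0 => w _; exact: sqr_ge0.
  have mF e : measurable_fun [set: Omega] (F e).
    by apply: measurable_minr => //; apply: measurable_funX; exact: (X2 e).1.
  have iF e : P.-integrable [set: Omega] (EFin \o F e).
    apply: (le_integrableT (mF e) _ (X2 e).2) => w.
    by rewrite ger0_norm ?le_min ?sqr_ge0 ?a0// ge_min lexx.
  have [i1 e1] := Rintegral_bigsum measurableT (gs n) iF.
  have ig := integrableZl measurableT (A n) (gi k).
  have i2 := integrableD measurableT (ic k.+1%:R) ig.
  (* Either [|X|^2 <= k + 1], which bounds the Bessel sum, or [g k = 1] and the truncation levels
     add up to [A n]. *)
  have pw w : \sum_(e <- gs n) F e w <= cst k.+1%:R w + A n * g k w.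
    have h1 : \sum_(e <- gs n) F e w <= `|X w| ^+ 2.
      apply: le_trans (gram_schmidt_le dn n (X w)); apply: ler_sum => e _.
      by rewrite ge_min lexx.
    have h2 : \sum_(e <- gs n) F e w <= A n.
      by rewrite AE; apply: ler_sum => e _; rewrite ge_min lexx orbT.
    have k0 : 0 < (k.+1%:R : R) by [].
    rewrite /g /=; have [xk|kx] := leP (k.+1%:R^-1 * `|X w| ^+ 2) 1.
      apply: le_trans h1 _; rewrite -[X in X <= _]addr0 lerD ?mulr_ge0 ?sqr_ge0//.
      by rewrite -[leRHS]mulr1 -ler_pdivrMl.
    by rewrite mulr1; apply: le_trans h2 _; rewrite lerDr ltW.
  have := le_Rintegral measurableT i1 i2 (fun w _ => pw w).
  rewrite e1 (RintegralD measurableT (ic _) ig) (RintegralZl _ measurableT (gi k)) Rintegral_cst//.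
  have -> : fine (P [set: Omega]) = 1 by rewrite probability_setT.
  have h3 : 128^-1 * A n <= \sum_(e <- gs n) \int[P]_w F e w.
    by rewrite AE mulr_sumr; apply: ler_sum => e _; exact: Xb.
  move=> /(le_trans h3); have := ler_wpM2l (A0 n) gk; rewrite mulr1.
  by move: (A n) (A n * _) (k.+1%:R) => x y z; lra.
apply: (@le_lt_trans _ _ (256 * k.+1%:R)%:E); last exact: ltry.
apply: (fatou_le mS _ SX) => [n w|n]; first by rewrite sumr_ge0// => e _; exact: sqr_ge0.
have := Ak n; rewrite -lee_fin => /(le_trans _); apply.
by rewrite /A /Rintegral fineK//; exact: (integrable_fin_num measurableT (sI n).1).
Qed.

#[local] Opaque covint fOU_path mlker.

(** * Moments of the Young integral of the Mittag-Leffler kernel *)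

Section covariance_of_path.
Context d (Omega : measurableType d) {R : realType} {H : hilbertType R}.
Variables (P : probability Omega R) (T gam al b : R) (A : bop H).
Hypotheses (al0 : 0 < al) (al1 : al < 1) (T0 : 0 < T) (algam : 1 - al < gam).
Hypothesis alb : 1 - al < b.
Variables (W : R -> Omega -> H) (Q : R -> R -> bop H).
Hypotheses (W_mean : has_mean P T W (fun=> 0)) (W_holder : forall w, holder_on T gam (W^~ w)).
Hypotheses (W_cov : is_covariance_operator P T W Q) (Qb : Qclass T b Q).

Let B := adjoint A.
Let cl := clamp T.

Let cl_in r : cl r \in `[0, T].
Proof. by rewrite in_itv/=; exact: clamp_itv (ltW T0) r. Qed.

Let W_L2 r g : L2 P (fun w => inner (W (cl r) w) g).
Proof.
have [[Wp W2] _] := W_cov.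
have mW : measurable_fun [set: Omega] (fun w => inner (W (cl r) w) g).
  by apply: open_measurable_inner => U oU; exact: Wp.
split=> //; apply: (@le_integrableT _ _ _ P _ (fun w => `|g| ^+ 2 * `|W (cl r) w| ^+ 2)).
- exact: measurable_funX.
- move=> w; rewrite ger0_norm ?sqr_ge0// -real_normK ?num_real// -exprMn mulrC.
  by rewrite ler_sqr ?nnegrE// ?mulr_ge0// inner_le.
- have mn : measurable_fun [set: Omega] (fun w => `|W (cl r) w| ^+ 2).
    apply: measurable_funX; have := @open_measurable_dist _ _ _ _ (W (cl r)) 0.
    by under eq_fun do rewrite subr0; apply => U oU; exact: Wp.
  have i1 : P.-integrable [set: Omega] (EFin \o (fun w => `|W (cl r) w| ^+ 2)).
    apply/integrableP; split; first exact/measurable_EFinP.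
    apply: le_lt_trans (W2 (cl r) (cl_in r)); rewrite le_eqVlt; apply/orP; left; apply/eqP.
    by apply: eq_integral => w _; rewrite gee0_abs// lee_fin sqr_ge0.
  exact: (integrableZl measurableT (`|g| ^+ 2) i1).
Qed.

Let W_mean0 r g : \int[P]_w inner (W (cl r) w) g = 0.
Proof.
have [_ ->] := bochner_weak measurableT (W_mean (cl_in r)) (W_L2 r g).1.
by rewrite inner0l.
Qed.

Let W_covE r s g h : \int[P]_w (inner (W (cl s) w) g * inner (W (cl r) w) h) =
  inner (Q (cl r) (cl s) g) h.
Proof.
have [_ [m mm cE]] := W_cov.
(* The covariance operator comes with a mean of its own, which weak uniqueness identifies with
   [0]. *)
have m0 u : m (cl u) = 0.
  apply: inner_inj => k; rewrite inner0l -(W_mean0 u k).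
  by have [_ ->] := bochner_weak measurableT (mm _ (cl_in u)) (W_L2 u k).1.
have := cE _ _ (cl_in r) (cl_in s) g h; rewrite unlock !m0.
under eq_integral do rewrite !subr0.
by rewrite /Rintegral => <-.
Qed.

Let D (q : R * R) (w : Omega) : H := W (cl q.2) w - W (cl q.1) w.

Let D_L2 q g : L2 P (fun w => inner (D q w) g).
Proof.
have := L2B (W_L2 q.2 g) (W_L2 q.1 g).
by under eq_fun do rewrite -innerBl.
Qed.

Let D_mean q g : \int[P]_w inner (D q w) g = 0.
Proof.
under eq_Rintegral do rewrite innerBl.
rewrite (RintegralB measurableT (L2_integrable (W_L2 _ _)) (L2_integrable (W_L2 _ _))).
by rewrite !W_mean0 subrr.
Qed.

Let D_cov p q g h : \int[P]_w (inner (D q w) g * inner (D p w) h) =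
  inner (rect_incr (fun r s => Q (cl r) (cl s)) p.1 q.1 p.2 q.2 g) h.
Proof.
have i u v := L2M (W_L2 u g) (W_L2 v h).
have -> : (fun w => inner (D q w) g * inner (D p w) h) = (fun w =>
   (inner (W (cl q.2) w) g * inner (W (cl p.2) w) h -
    inner (W (cl q.1) w) g * inner (W (cl p.2) w) h) -
   (inner (W (cl q.2) w) g * inner (W (cl p.1) w) h -
    inner (W (cl q.1) w) g * inner (W (cl p.1) w) h)).
  by apply/funext => w; rewrite !innerBl; ring.
rewrite (RintegralB measurableT (integrableB measurableT (i _ _) (i _ _))
  (integrableB measurableT (i _ _) (i _ _))).
rewrite !(RintegralB measurableT (i _ _) (i _ _)) !W_covE.
set F := fun _ => _; have -> : (rect_incr F p.1 q.1 p.2 q.2 : bop H) g =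
  F p.2 q.2 g - F p.2 q.1 g - F p.1 q.2 g + F p.1 q.1 g by [].
by rewrite innerDl !innerBl; ring.
Qed.

(** The left-point sums for [X] tested against [h], with the kernel moved onto [h]: a combination of
    scalar increments with deterministic coefficients, hence centred and Gaussian. *)
Let xi (t : R) (h : H) (s : seq R) (w : Omega) : R :=
  \sum_(p <- subintervals 0 s) inner (D p w) (mlker al B (t - p.1) h).

Let xiE t h s w : 0 <= t -> t <= T -> itv_partition 0 t s ->
  xi t h s w = inner (vsum (fun x (u : H) => mlker al A x u) t (W^~ w \o cl) s) h.
Proof.
move=> t0 tT [ps /eqP ls]; rewrite /vsum /ksum inner_suml /xi !big_seq.
apply: eq_bigr => p pin; have [p1 p12 p2] := subintervals_bounds ps pin.
by rewrite mlker_adjoint// subr_gt0 (lt_le_trans p12)// -ls.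
Qed.

Let xi_L2 t h s : L2 P (xi t h s).
Proof.
rewrite /xi; elim: (subintervals 0 s) => [|p l IH].
  under eq_fun do rewrite big_nil.
  by split; [exact: measurable_cst|rewrite expr0n/=; exact: integrable0].
by under eq_fun do rewrite big_cons; apply: L2D.
Qed.

Let xi_mean t h s : \int[P]_w xi t h s w = 0.
Proof.
rewrite /xi; have [_ ->] := Rintegral_bigsum measurableT (subintervals 0 s)
  (fun p => L2_integrable (D_L2 p (mlker al B (t - p.1) h))).
by rewrite big1// => p _; exact: D_mean.
Qed.

(** Bilinearity over the cells. The order of factors follows the convention for covariance
    operators: the time [t], first argument of [Q], goes with [h], and [t'] with [g]. *)
Let xi_cov (t t' : R) g h (s s' : seq R) : 0 <= t -> t <= T -> 0 <= t' -> t' <= T ->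
  itv_partition 0 t s -> itv_partition 0 t' s' ->
  \int[P]_w (xi t' g s' w * xi t h s w) =
  inner (double_sum (ML_kernel al A t) Q (ML_kernel al B t') s s' g) h.
Proof.
move=> t0 tT t'0 t'T [ps /eqP ls] [ps' /eqP ls'].
have i p q := L2M (D_L2 q (mlker al B (t' - q.1) g)) (D_L2 p (mlker al B (t - p.1) h)).
have -> : (fun w => xi t' g s' w * xi t h s w) = (fun w =>
   \sum_(p <- subintervals 0 s) \sum_(q <- subintervals 0 s')
     (inner (D q w) (mlker al B (t' - q.1) g) * inner (D p w) (mlker al B (t - p.1) h))).
  apply/funext => w; rewrite /xi mulr_sumr; apply: eq_bigr => p _.
  by rewrite mulr_suml.
have j p := Rintegral_bigsum measurableT (subintervals 0 s') (i p).
have [_ ->] := Rintegral_bigsum measurableT (subintervals 0 s) (fun p => (j p).1).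
rewrite /double_sum bop_sum inner_suml !big_seq; apply: eq_bigr => p pin.
rewrite (j p).2 bop_sum inner_suml !big_seq; apply: eq_bigr => q qin.
have [p1 p12 p2] := subintervals_bounds ps pin; rewrite ls in p2.
have [q1 q12 q2] := subintervals_bounds ps' qin; rewrite ls' in q2.
rewrite !ML_kernelE D_cov /= mlker_adjoint ?subr_gt0 ?(lt_le_trans p12)//.
have [p20 p2T] := (le_trans p1 (ltW p12), le_trans p2 tT).
have [q20 q2T] := (le_trans q1 (ltW q12), le_trans q2 t'T).
have [p1T q1T] := (le_trans (ltW p12) p2T, le_trans (ltW q12) q2T).
by rewrite /rect_incr /cl !clamp_id.
Qed.

Let X t w : H := fOU_path al T A (W^~ w) t.

Let X_cvg (t : R) w : 0 <= t -> t <= T ->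
  vsum (fun x (u : H) => mlker al A x u) t (W^~ w \o cl) s @[s --> fine_partitions 0 t] --> X t w.
Proof.
move=> t0 tT; have g0 : 0 < gam by rewrite (lt_trans _ algam)// subr_gt0.
have a0 : 0 < 1 - al by rewrite subr_gt0.
have [L L0 wL] := holder_clamp (ltW T0) g0 (W_holder w).
have wt : holder_le t gam L (W^~ w \o cl) by move=> r s *; exact: wL.
have [M M0 ke] := mlker_estimates al0 al1 T0 A.
have C0 : 0 <= 2 * M * 2^-1 ^+ 0 by rewrite expr0 mulr1 mulr_ge0.
have vk : volterra_kernel T (1 - al) (2 * M * 2^-1 ^+ 0) (fun x (u : H) => mlker al A x u).
  have -> : (fun x (u : H) => mlker al A x u) =
     fun x (u : H) => (mlker al A x - mlpart al A 0 x) u.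
    by apply/funext => x; rewrite /mlpart /series/= big_geq// subr0.
  apply: (volterra_kernel_estimates (act := fun (F : bop H) u => F u) _ _ _ (ke 0%N)) => //.
  - by move=> F u v; rewrite linearB.
  - by move=> F u; exact: bop_norm_le.
exact: (vsum_cvg a0 algam C0 vk L0 t0 tT wt).
Qed.

(** Convergence along the product filter allows different indices for the two partitions, as the
    [L^2] criterion requires. *)
Let xi_limit (t t' : R) (s s' : nat -> seq R) : 0 <= t -> t <= T -> 0 <= t' -> t' <= T ->
  (forall n, itv_partition 0 t (s n) /\ mesh 0 (s n) < n.+1%:R^-1) ->
  (forall n, itv_partition 0 t' (s' n) /\ mesh 0 (s' n) < n.+1%:R^-1) ->
  forall g h e, 0 < e -> exists N, forall n m, (N <= n)%N -> (N <= m)%N ->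
  `|\int[P]_w (xi t' g (s' n) w * xi t h (s m) w) - inner (covint al A Q t t' g) h| <= e.
Proof.
move=> t0 tT t'0 t'T sP s'P g h e e0.
have gh : 0 < `|g| * `|h| + 1 by rewrite ltr_wpDl// mulr_ge0.
have tin : 0 <= t <= T by rewrite t0.
have t'in : 0 <= t' <= T by rewrite t'0.
have := covint_double_integral (A := A) al0 al1 T0 alb Qb tin t'in.
have FF := fine_partitions_filter t0; have FF' := fine_partitions_filter t'0.
rewrite /is_double_integral => /cvgrPdist_le H0.
have [[U V] /= [FU FV] UV] := H0 _ (divr_gt0 e0 gh).
have [N1 _ H1] := partition_sequence_cvg sP FU.
have [N2 _ H2] := partition_sequence_cvg s'P FV.
exists (maxn N1 N2) => n m; rewrite !geq_max => /andP[n1 n2] /andP[m1 m2].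
rewrite (xi_cov _ _ t0 tT t'0 t'T (sP m).1 (s'P n).1) -innerBl -bopB.
pose F := double_sum (ML_kernel al A t) Q (ML_kernel al B t') (s m) (s' n) -
  covint al A Q t t'.
have h1 : `|F| <= e / (`|g| * `|h| + 1).
  by rewrite distrC; exact: UV (s m, s' n) (conj (H1 m m1) (H2 n n2)).
apply: le_trans (inner_le _ _) _.
apply: (@le_trans _ _ (`|F| * (`|g| * `|h|))).
  by rewrite mulrA ler_wpM2r//; exact: (bop_norm_le F g).
apply: (@le_trans _ _ (`|F| * (`|g| * `|h| + 1))); first by rewrite ler_wpM2l// lerDl.
by rewrite -ler_pdivlMr.
Qed.

Lemma fOU_path_L2 (t : R) h : 0 <= t -> t <= T ->
  L2 P (fun w => inner (X t w) h) /\ \int[P]_w inner (X t w) h = 0.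
Proof.
move=> t0 tT; have [s sP] := partition_sequence_exists t0.
have [|||h1 _ h2] := @L2_cvg _ _ _ P (fun n => xi t h (s n))
  (fun w => inner (X t w) h) (inner (covint al A Q t t h) h).
- by move=> n; exact: xi_L2.
- move=> w; under eq_fun do rewrite (xiE _ _ t0 tT (sP _).1).
  have c0 := cvg_comp _ _ (partition_sequence_cvg sP) (X_cvg (w := w) t0 tT).
  by apply: inner_cvgl; exact: c0.
- exact: (xi_limit t0 tT t0 tT sP sP).
- by split=> //; apply: h2 => n; exact: xi_mean.
Qed.

Lemma fOU_path_cov (t t' : R) g h : 0 <= t -> t <= T -> 0 <= t' -> t' <= T ->
  \int[P]_w (inner (X t' w) g * inner (X t w) h) = inner (covint al A Q t t' g) h.
Proof.
move=> t0 tT t'0 t'T.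
have [s sP] := partition_sequence_exists t0.
have [s' s'P] := partition_sequence_exists t'0.
have c (t1 : R) (k : H) (s1 : nat -> seq R) w : 0 <= t1 -> t1 <= T ->
    (forall n, itv_partition 0 t1 (s1 n) /\ mesh 0 (s1 n) < n.+1%:R^-1) ->
    xi t1 k (s1 n) w @[n --> \oo] --> inner (X t1 w) k.
  move=> a1 a2 s1P; under eq_fun do rewrite (xiE _ _ a1 a2 (s1P _).1).
  have c0 := cvg_comp _ _ (partition_sequence_cvg s1P) (X_cvg (w := w) a1 a2).
  by apply: inner_cvgl; exact: c0.
apply: (@L2_cvgM _ _ _ P (fun n => xi t' g (s' n)) (fun n => xi t h (s n))).
- by move=> n; exact: xi_L2.
- by move=> n; exact: xi_L2.
- by move=> w; exact: c.
- by move=> w; exact: c.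
- exact: (xi_limit t'0 t'T t'0 t'T s'P s'P).
- exact: (xi_limit t0 tT t0 tT sP sP).
- exact: (xi_limit t0 tT t'0 t'T sP s'P).
Qed.

Hypothesis W_gauss : is_gaussian_process P T W.

Let xi_gauss t h s : is_gaussian_rv P (xi t h s).
Proof.
pose k (p : R * R) := mlker al B (t - p.1) h.
(* Gaussianity is stated for values of [W], so each increment gives two entries, with opposite
   vectors at the two ends of the cell. *)
pose r := [seq (p.2, k p) | p <- subintervals 0 s] ++
  [seq (p.1, - k p) | p <- subintervals 0 s].
have := W_gauss.2 (size r) (fun i => cl (nth (0, 0) r i).1) (fun i => (nth (0, 0) r i).2)
  (fun i => cl_in _).
congr is_gaussian_rv; apply/funext => w.
rewrite -(big_mkord xpredT (fun i => inner (W (cl (nth (0, 0) r i).1) w) (nth (0, 0) r i).2)).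
rewrite -(big_nth (0, 0) xpredT (fun q => inner (W (cl q.1) w) q.2)).
rewrite /r big_cat/= !big_map -big_split /xi /=; apply: eq_bigr => p _.
have -> : - k p = -1 *: k p by rewrite scaleN1r.
by rewrite (innerZr (-1)) /D innerBl mulN1r.
Qed.

Lemma fOU_path_square_integrable (t : R) : separable_space H -> 0 <= t -> t <= T ->
  measurable_fun [set: Omega] (fun w => `|X t w| ^+ 2) /\
  (\int[P]_w (`|X t w| ^+ 2)%:E < +oo)%E.
Proof.
move=> Hs t0 tT; apply: square_integrable_of_lower_bound => // h.
  by have [] := fOU_path_L2 h t0 tT.
have [s sP] := partition_sequence_exists t0.
have c w : xi t h (s n) w @[n --> \oo] --> inner (X t w) h.
  under eq_fun do rewrite (xiE _ _ t0 tT (sP _).1).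
  have c0 := cvg_comp _ _ (partition_sequence_cvg sP) (X_cvg (w := w) t0 tT).
  by apply: inner_cvgl; exact: c0.
have l := xi_limit t0 tT t0 tT sP sP h h.
have [_ -> _] := L2_cvg (fun n => xi_L2 t h (s n)) c l.
exact: (gaussian_limit_lower_bound (fun n => xi_L2 t h (s n)) (fun n => xi_gauss t h (s n))
  (fun n => xi_mean t h (s n)) c l).
Qed.

End covariance_of_path.

(** * Bochner integrability from separability *)

Section bochner_existence.
Context d (Omega : measurableType d) {R : realType} {H : hilbertType R}.
Variables (P : probability Omega R) (X : Omega -> H).
Hypotheses (Hs : separable_space H) (mX : open_measurable_fun X).
Hypothesis iX : P.-integrable [set: Omega] (EFin \o (fun w => `|X w|)).

(** [X] is approximated by the nearest of finitely many points of a dense sequence, ties going to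
    the smallest index. The point [0] is put in front, so that [|X - f_n| <= |X|] and dominated
    convergence applies. *)
Lemma bochner_exists : exists v, is_bochner P setT X v.
Proof.
have [dn dnP] := separable_sequence Hs.
pose c (k : nat) : H := if k is k'.+1 then dn k' else 0.
pose r k w := `|X w - c k|.
have mr k : measurable_fun [set: Omega] (r k) by exact: open_measurable_dist.
pose E n (k : 'I_n.+1) : set Omega := [set w |
  forall j : 'I_n.+1, r k w <= r j w /\ ((j < k)%N -> r k w < r j w)].
have mE n k : measurable (E n k).
  have -> : E n k = \bigcap_(j in [set: 'I_n.+1])
      ([set w | r k w <= r j w] `&` (if (j < k)%N then [set w | r k w < r j w] else setT)).
    apply/seteqP; split=> w /=.
      by move=> Ew j _; have [h1 h2] := Ew j; split=> //; case: ifP => // /h2.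
    by move=> Ew j; have [h1 h2] := Ew j I; split=> // jk; rewrite jk in h2.
  apply: fin_bigcap_measurable => // j _; apply: measurableI.
    by rewrite -[X in measurable X]setTI; exact: measurable_fun_ler.
  by case: ifP => // _; rewrite -[X in measurable X]setTI; exact: measurable_fun_ltr.
pose f_ n : simple_function Omega := SimpleFunction (E n) (fun k => c k).
have cover n w : exists k : 'I_n.+1, E n k w.
  have [k0 k0P] : exists k : 'I_n.+1, forall j : 'I_n.+1, r k w <= r j w.
    have [k _ kP] := @arg_minP _ _ _ (ord0 : 'I_n.+1) xpredT (fun i : 'I_n.+1 => r i w) isT.
    by exists k => j; exact: kP.
  pose Qm (m : nat) := [exists k : 'I_n.+1, (k == m :> nat) && [forall j : 'I_n.+1, r k w <= r j w]].
  have Q0 : exists m, Qm m.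
    by exists k0; apply/existsP; exists k0; rewrite eqxx; apply/forallP.
  case: (ex_minnP Q0) => m /existsP[k /andP[/eqP km /forallP kP]] mmin.
  exists k => j; split; first exact: kP.
  move=> jk; rewrite ltNge; apply/negP => rjk.
  have : Qm j.
    apply/existsP; exists j; rewrite eqxx /=; apply/forallP => i.
    exact: le_trans rjk (kP i).
  by move=> /mmin; rewrite -km leqNgt jk.
have disj n w (k k' : 'I_n.+1) : E n k w -> E n k' w -> k = k'.
  move=> Ek Ek'; apply/val_inj/eqP; rewrite eqn_leq; apply/andP; split; rewrite leqNgt; apply/negP => kk.
    by have := (Ek k').2 kk; rewrite ltNge (Ek' k).1.
  by have := (Ek' k).2 kk; rewrite ltNge (Ek k').1.
have evalE n w (k : 'I_n.+1) : E n k w -> sf_eval (f_ n) w = c k.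
  move=> Ek; rewrite /sf_eval (bigD1 k)//= big1 ?addr0 => [|j jk].
    by rewrite indicE mem_set// scale1r.
  rewrite indicE memNset ?scale0r// => Ej; move/eqP : jk; apply; exact: disj Ej Ek.
have best n w (j : 'I_n.+1) : `|X w - sf_eval (f_ n) w| <= r j w.
  by have [k Ek] := cover n w; rewrite (evalE n w k Ek); exact: (Ek j).1.
have le_norm n w : `|X w - sf_eval (f_ n) w| <= `|X w|.
  by apply: le_trans (best n w ord0) _; rewrite /r subr0.
have cvg0 w : `|X w - sf_eval (f_ n) w| @[n --> \oo] --> (0 : R).
  apply/cvgrPdist_le => e e0; have [k ke] := dnP (X w) e e0.
  exists k.+1 => // n /= kn; rewrite sub0r normrN normr_id.
  by apply: le_trans (ltW ke); exact: (best n w (Ordinal (kn : k.+1 < n.+1)%N)).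
have evalX n : (fun w => `|X w - sf_eval (f_ n) w|) =
    (fun w => \sum_(k < n.+1) \1_(E n k) w * r k w).
  apply/funext => w; have [k Ek] := cover n w; rewrite (evalE n w k Ek) (bigD1 k)//= big1 ?addr0.
    by rewrite indicE mem_set// mul1r.
  move=> j jk; rewrite indicE memNset ?mul0r// => Ej; move/eqP : jk; apply; exact: disj Ej Ek.
have mdist n : measurable_fun [set: Omega] (fun w => `|X w - sf_eval (f_ n) w|).
  rewrite evalX; apply: measurable_sum => k; exact: measurable_funM.
have idist n : P.-integrable [set: Omega] (EFin \o (fun w => `|X w - sf_eval (f_ n) w|)).
  by apply: (le_integrableT (mdist n) _ iX) => w; rewrite normr_id.
have Icvg : \int[P]_w `|X w - sf_eval (f_ n) w| @[n --> \oo] --> (0 : R).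
  have := Rdominated_cvg mdist cvg0 (fun n w => _) iX.
  by rewrite Rintegral_cst// mul0r; apply => n w; rewrite normr_id.
have fm n (k : 'I_n.+1) : [/\ measurable (E n k), E n k `<=` setT & (P (E n k) < +oo)%E].
  by split=> //; rewrite ltey_eq fin_num_measure.
pose v n := sf_integral P (f_ n).
have vE n g : P.-integrable [set: Omega] (EFin \o (fun w => inner (sf_eval (f_ n) w) g)) /\
    \int[P]_w inner (sf_eval (f_ n) w) g = inner (v n) g.
  have -> : (fun w => inner (sf_eval (f_ n) w) g) =
      (fun w => \sum_(k < n.+1) \1_(E n k) w * inner (c k) g).
    by apply/funext => w; rewrite /sf_eval inner_suml; apply: eq_bigr => k _; rewrite innerZl.
  have h k := let: And3 a b e := fm n k in Rintegral_indic_scale measurableT (inner (c k) g) a b e.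
  have [h1 ->] := Rintegral_bigsum measurableT (index_enum _) (fun k => (h k).1).
  split=> //; rewrite /v /sf_integral inner_suml; apply: eq_bigr => k _.
  by rewrite (h k).2 innerZl.
have vB n m : `|v n - v m| <= \int[P]_w `|X w - sf_eval (f_ n) w| +
    \int[P]_w `|X w - sf_eval (f_ m) w|.
  (* The difference of the two integrals is tested against itself, which reduces its norm to a
     scalar integral. *)
  set D := v n - v m; have [->|D0] := eqVneq D 0.
    by rewrite normr0 addr_ge0//; apply: Rintegral_ge0 => w _.
  have Dp : 0 < `|D| by rewrite normr_gt0.
  rewrite -(ler_pM2r Dp) -expr2 inner_normE {1}/D innerBl -(vE n D).2 -(vE m D).2.
  rewrite -(RintegralB measurableT (vE n D).1 (vE m D).1).
  have i1 := integrableD measurableT (idist n) (idist m).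
  rewrite -(RintegralD measurableT (idist n) (idist m)).
  rewrite -(RintegralZr _ measurableT i1).
  have m1 : measurable_fun [set: Omega]
     (fun w => inner (sf_eval (f_ n) w) D - inner (sf_eval (f_ m) w) D).
    by apply/measurable_EFinP; exact: measurable_int (integrableB measurableT (vE n D).1 (vE m D).1).
  apply: le_trans (ler_norm _) _.
  have [] // := dominated_Rintegral measurableT m1 _ (integrableZr measurableT `|D| i1).
  move=> w _; rewrite -innerBl; apply: le_trans (inner_le _ _) _; rewrite ler_wpM2r//=.
  have -> : sf_eval (f_ n) w - sf_eval (f_ m) w =
    (X w - sf_eval (f_ m) w) - (X w - sf_eval (f_ n) w).
    by zmodule.
  by apply: le_trans (ler_normB _ _) _; rewrite addrC.
have : cvg (v n @[n --> \oo]).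
  apply/cauchy_cvgP/cauchy_exP => e e0; have e2 : 0 < e / 2 by rewrite divr_gt0.
  move/cvgrPdist_lt : Icvg => /(_ _ e2)[N _ HN].
  have hN n : (N <= n)%N -> \int[P]_w `|X w - sf_eval (f_ n) w| < e / 2.
    by move=> /HN /=; rewrite sub0r normrN; exact: le_lt_trans (ler_norm _).
  exists (v N); exists N => // n /= Nn; rewrite -ball_normE /=.
  apply: le_lt_trans (vB N n) _; rewrite [ltRHS]splitr.
  by apply: ltrD; exact: hN.
move=> /cvg_ex[l vl]; exists l; exists f_; split=> //.
have -> : (fun n => (\int[P]_w `|X w - sf_eval (f_ n) w|%:E)%E) =
    (fun n => (\int[P]_w `|X w - sf_eval (f_ n) w|)%:E).
  apply/funext => n; rewrite /Rintegral fineK//.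
  exact: (integrable_fin_num measurableT (idist n)).
by apply: cvg_EFin; [exact: nearW|exact: Icvg].
Qed.

End bochner_existence.

(** * Covariance and regularity of the fractional Ornstein-Uhlenbeck process *)

Theorem corollary27 (R : realType) (H : hilbertType R)
    (H_separable : separable_space H)
    (d : measure_display) (Omega : measurableType d) (P : probability Omega R)
    (T : R) (T_gt0 : 0 < T)
    (gamma alpha beta : R)
    (gamma01 : 0 < gamma < 1) (alpha01 : 0 < alpha < 1)
    (rho_gt0 : 0 < gamma + alpha - 1)
    (beta01 : 0 < beta < 1) (beta_alpha : 0 < beta + alpha - 1)
    (W : R -> Omega -> H)
    (W_gaussian : is_gaussian_process P T W)
    (W_zero_mean : has_mean P T W (fun=> 0))
    (W_holder : forall w, holder_on T gamma (W^~ w))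
    (QW : R -> R -> bop H)
    (QW_covariance : is_covariance_operator P T W QW)
    (QW_regular : Qclass T beta QW)
    (A : bop H) (y : H)
    (Y : R -> Omega -> H)
    (Y_process : is_process T Y)
    (Y_holder : forall kappa, 0 < kappa < gamma + alpha - 1 ->
       forall w, holder_on T kappa (Y^~ w))
    (Y_solution : forall w, solves_fOU_equation T alpha A y (W^~ w) (Y^~ w)) :
  exists QY : R -> R -> bop H,
    [/\ is_covariance_operator P T Y QY,
        forall t t' : R, t \in `[0, T] -> t' \in `[0, T] ->
          is_double_integral t t' (ML_kernel alpha A t) QW
            (ML_kernel alpha (adjoint A) t') (QY t t') &
        forall eta, 0 < eta < beta + alpha - 1 -> Qclass T eta QY].
Proof.
have /andP[g0 g1] := gamma01; have /andP[al0 al1] := alpha01.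
have /andP[b0 b1] := beta01.
have algam : 1 - alpha < gamma by move: rho_gt0; lra.
have alb : 1 - alpha < beta by move: beta_alpha; lra.
(* Any positive exponent below [rho] would do: the tested equation asks for some Hölder continuity
   of [Y]. *)
pose kapp := (gamma + alpha - 1) / 2.
have kapp0 : 0 < kapp by rewrite divr_gt0.
have kapp1 : 0 < kapp < gamma + alpha - 1.
  by rewrite kapp0 /kapp ltr_pdivrMr// ltr_pMr// ltr1n.
have YH := Y_holder _ kapp1.
(* A sample point exists because [P] has mass [1]. As [Y - X] is the same for all sample points, its
   value at [w0] will be the mean of [Y]. *)
have [w0 _] : [set: Omega] !=set0.
  apply/set0P/eqP => e; have := @probability_setT _ _ _ P.
  by rewrite e measure0 => /eqP; rewrite eq_sym onee_eq0.
pose X t w := fOU_path alpha T A (W^~ w) t.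
pose m t := Y t w0 - X t w0.
have YX t w : 0 <= t -> t <= T -> Y t w = m t + X t w.
  move=> t0 tT; rewrite /m -(fOU_mean_eq al0 al1 T_gt0 algam kapp0 t0 tT (W_holder w)
    (W_holder w0) (YH w) (YH w0) (Y_solution w) (Y_solution w0)).
  by rewrite subrK.
have YmX t w : 0 <= t -> t <= T -> Y t w - m t = X t w.
  by move=> t0 tT; rewrite (YX t w t0 tT) addrAC subrr add0r.
have X2 := fOU_path_L2 A al0 al1 T_gt0 algam alb W_zero_mean W_holder
  QW_covariance QW_regular.
have Xcov := fOU_path_cov A al0 al1 T_gt0 algam alb W_zero_mean W_holder
  QW_covariance QW_regular.
have Xsq t t0 tT := fOU_path_square_integrable A al0 al1 T_gt0 algam alb
  W_zero_mean W_holder QW_covariance QW_regular W_gaussian (t := t) H_separable t0 tT.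
have inT t : t \in `[0, T] -> 0 <= t /\ t <= T by rewrite in_itv/= => /andP[].
have mnorm t : t \in `[0, T] -> measurable_fun [set: Omega] (fun w => `|Y t w|).
  move=> tT; have := open_measurable_dist (X := Y t) 0 (Y_process _ tT).
  by under eq_fun do rewrite subr0.
have Ysq t : t \in `[0, T] ->
    P.-integrable [set: Omega] (EFin \o (fun w => `|Y t w| ^+ 2)).
  move=> tin; have [t0 tT] := inT t tin; have [mX iX] := Xsq t t0 tT.
  have i1 : P.-integrable [set: Omega] (EFin \o (fun w => `|X t w| ^+ 2)).
    apply/integrableP; split; first exact/measurable_EFinP.
    apply: le_lt_trans iX; rewrite le_eqVlt; apply/orP; left; apply/eqP.
    by apply: eq_integral => w _; rewrite gee0_abs// lee_fin sqr_ge0.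
  have ic : P.-integrable [set: Omega] (EFin \o cst (`|m t| ^+ 2)).
    exact: finite_measure_integrable_cst.
  apply: (le_integrableT _ _ (integrableZl measurableT 2 (integrableD measurableT ic i1))).
    by apply: measurable_funX; exact: mnorm.
  move=> w; rewrite ger0_norm ?sqr_ge0//= YX//; have := ler_normD (m t) (X t w).
  have := normr_ge0 (m t + X t w); have := sqr_ge0 (`|m t| - `|X t w|).
  by move: (`|m t + _|) (`|m t|) (`|X t w|) => p q r; nra.
have Ynorm t : t \in `[0, T] -> P.-integrable [set: Omega] (EFin \o (fun w => `|Y t w|)).
  move=> tin; apply: L2_integrable; split; first exact: mnorm.
  exact: Ysq.
exists (covint alpha A QW); split.
- split.
    split=> // t tin; have /integrableP[_] := Ysq t tin; apply: le_lt_trans.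
    rewrite le_eqVlt; apply/orP; left; apply/eqP.
    by apply: eq_integral => w _; rewrite gee0_abs// lee_fin sqr_ge0.
  exists m => [t tin|s t sin tin g h].
    have [t0 tT] := inT t tin.
    (* The Bochner mean of [Y t] exists by separability; testing, with [X t] centred, identifies it
       with [m t]. *)
    have [v vY] := bochner_exists H_separable (Y_process _ tin) (Ynorm t tin).
    suff -> : m t = v by [].
    apply: inner_inj => g; have [x1 x2] := X2 t g t0 tT.
    have [_ <-] := bochner_weak measurableT vY (open_measurable_inner g (Y_process _ tin)).
    have ic : P.-integrable [set: Omega] (EFin \o cst (inner (m t) g)).
      exact: finite_measure_integrable_cst.
    have -> : (fun w => inner (Y t w) g) =
        (fun w => cst (inner (m t) g) w + inner (X t w) g).
      by apply/funext => w; rewrite YX// innerDl.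
    rewrite (RintegralD measurableT ic (L2_integrable x1)) x2 addr0 Rintegral_cst//.
    have -> : fine (P [set: Omega]) = 1 by rewrite probability_setT.
    by rewrite mulr1.
  have [s0 sT] := inT s sin; have [t0 tT] := inT t tin.
  have -> : (fun w => inner (Y t w - m t) g * inner (Y s w - m s) h) =
      (fun w => inner (X t w) g * inner (X s w) h).
    by apply/funext => w; rewrite (YmX t w t0 tT) (YmX s w s0 sT).
  have fin := integrable_fin_num measurableT (L2M (X2 t g t0 tT).1 (X2 s h s0 sT).1).
  rewrite unlock -(Xcov s t g h s0 sT t0 tT) /Rintegral fineK; last exact: fin.
  by [].
- move=> t t' /inT[t0 tT] /inT[t'0 t'T].
  by apply: (covint_double_integral al0 al1 T_gt0 alb QW_regular); apply/andP.
- move=> eta /andP[e0 e1].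
  have e2 : eta <= 1 by move: e1 b1 al1; lra.
  have e3 : 1 - alpha + eta < beta by move: e1; lra.
  have := covint_Qclass A al0 al1 T_gt0 alb QW_regular e0 e2 e3.
  by [].
Qed.
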